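(* Let $R$ be a standard graded ring of dimension $d\geq 2$ over a perfect field of characteristic $p>0$, and let $I\subset R$ be a homogeneous ideal of finite colength. Let $M$ be a finitely generated non-negatively graded $R$-module. Let $\Lambda$ be the set of minimal prime ideals $P$ of $R$ such that $\dim R/P=\dim R$. Then $$HKd(M,I)=\sum_{P\in\Lambda}HKd(R/P,I)\,\lambda(M_P),$$ where $\lambda(M_P)$ denotes the length of the $R_P$-module $M_P$.
   Context: A standard graded ring over $k$ is a Noetherian graded ring $R=\bigoplus_{m\ge0}R_m$ with $R_0=k$, generated over $k$ by $R_1$. For $q=p^n$, $I^{[q]}$ denotes the ideal generated by $q$-th powers of elements of $I$; $\ell$ denotes length, and $N_m$ is the degree $m$ component of a graded module $N$. For a finitely generated non-negatively graded $R$-module $M$ with $d=\dim R\ge2$, the Hilbert-Kunz density function of $(M,I)$ is the function $HKd(M,I):\mathbb{R}\to\mathbb{R}$, $$HKd(M,I)(x)=\lim_{n\to\infty}\frac{1}{q^{d-1}}\ell(M/I^{[q]}M)_{\lfloor xq\rfloor},\qquad q=p^n$$ (the limit exists for every $x$). $HKd(R/P,I)$ is this function for the $R$-module $R/P$. *)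

(* Defs.v *)
From HB Require Import structures.
From mathcomp Require Import all_boot all_order all_algebra.
From mathcomp Require Import generic_quotient ring_quotient ring.
From mathcomp Require Import all_classical all_reals.
From mathcomp Require Import ereal topology normedtype sequences.

Set Implicit Arguments.
Unset Strict Implicit.
Unset Printing Implicit Defensive.

Import Order.TTheory GRing.Theory Num.Theory.
Import numFieldNormedType.Exports.

Local Open Scope classical_set_scope.
Local Open Scope quotient_scope.
Local Open Scope ring_scope.

Section GeneratedSubmodule.
Variables (A : pzRingType) (V : lmodType A).

(* The smallest submodule containing S; for V := A^o, the ideal generated
   by S. *)
Definition span_of (S : set V) : {pred V} :=
  fun x => `[< forall N : {pred V}, GRing.submod_closed N ->
                 (forall y, S y -> y \in N) -> x \in N >].

Lemma span_ofP (S : set V) x : reflect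
  (forall N : {pred V}, GRing.submod_closed N ->
     (forall y, S y -> y \in N) -> x \in N) (x \in span_of S).
Proof. exact: asboolP. Qed.

Lemma span_of_closed (S : set V) : GRing.submod_closed (span_of S).
Proof.
split=> [|a u v /span_ofP uS /span_ofP vS].
  by apply/span_ofP => N [].
apply/span_ofP => N Nclosed SN.
by apply: (proj2 Nclosed); [apply: uS | apply: vS].
Qed.

HB.instance Definition _ (S : set V) :=
  GRing.isSubmodClosed.Build A V (span_of S)
    (GRing.submod_closed_semi (span_of_closed S)).

Definition finitely_generated (N : {pred V}) : Prop :=
  exists s : seq V, N =i span_of [set` s].

(* Structurally, a [submodClosed] is only closed under addition and scaling;
   this copy is also a [zmodClosed], as [Quotient.quot] requires. *)
Definition submod_zmod (N : submodClosed V) : {pred V} := fun x => x \in N.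

Lemma submod_zmod_closed (N : submodClosed V) :
  GRing.submod_closed (submod_zmod N).
Proof. exact: submodClosedP. Qed.

HB.instance Definition _ (N : submodClosed V) :=
  GRing.isSubmodClosed.Build A V (submod_zmod N)
    (GRing.submod_closed_semi (submod_zmod_closed N)).

Definition quotmod (N : submodClosed V) : Type := Quotient.quot (submod_zmod N).

Section QuotientModule.
Variable N : submodClosed V.

HB.instance Definition _ := GRing.Zmodule.on (quotmod N).

Definition quotmod_proj (v : V) : quotmod N :=
  \pi_(Quotient.quot (submod_zmod N)) v.

Definition quotmod_repr (x : quotmod N) : V :=
  repr (x : Quotient.quot (submod_zmod N)).

Lemma quotmod_projE u v :
  (quotmod_proj u = quotmod_proj v) <-> (u - v \in N).
Proof.
rewrite /quotmod_proj; split=> [/eqP|] uv.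
  by move: uv; rewrite -(Quotient.idealrBE (submod_zmod N)).
by apply/eqP; rewrite -(Quotient.idealrBE (submod_zmod N)).
Qed.

Lemma quotmod_projD : {morph quotmod_proj : u v / u + v}.
Proof.
by move=> u v; apply: (@raddfD _ _ \pi_(Quotient.quot (submod_zmod N))).
Qed.

Lemma quotmod_projK : cancel quotmod_repr quotmod_proj.
Proof. exact: reprK. Qed.

Definition quotmod_scale (a : A) (x : quotmod N) : quotmod N :=
  quotmod_proj (a *: quotmod_repr x).

Lemma quotmod_projZ a v :
  quotmod_proj (a *: v) = quotmod_scale a (quotmod_proj v).
Proof.
apply/quotmod_projE; rewrite -scalerBr rpredZ //; apply/quotmod_projE.
by rewrite quotmod_projK.
Qed.

Lemma quotmod_scalerA a b x :
  quotmod_scale a (quotmod_scale b x) = quotmod_scale (a * b) x.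
Proof. by rewrite -quotmod_projZ scalerA. Qed.

Lemma quotmod_scale1r : left_id 1 quotmod_scale.
Proof. by move=> x; rewrite /quotmod_scale scale1r quotmod_projK. Qed.

Lemma quotmod_scalerDr : right_distributive quotmod_scale +%R.
Proof.
move=> a x y; rewrite -[x]quotmod_projK -[y]quotmod_projK.
by rewrite -quotmod_projD -!quotmod_projZ scalerDr quotmod_projD.
Qed.

Lemma quotmod_scalerDl x : {morph quotmod_scale^~ x : a b / a + b}.
Proof. by move=> a b; rewrite /quotmod_scale scalerDl quotmod_projD. Qed.

HB.instance Definition _ := GRing.Zmodule_isLmodule.Build A (quotmod N)
  quotmod_scalerA quotmod_scale1r quotmod_scalerDr quotmod_scalerDl.

End QuotientModule.
End GeneratedSubmodule.


Section RestrictScalars.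
Variables (k : comNzRingType) (A : comAlgType k) (V : lmodType A).

Definition restrict_scalars : Type := V.

HB.instance Definition _ := GRing.Zmodule.on restrict_scalars.

Definition restrict_scale (c : k) (v : restrict_scalars) : restrict_scalars :=
  (c%:A : A) *: (v : V).

Lemma restrict_scalerA a b v :
  restrict_scale a (restrict_scale b v) = restrict_scale (a * b) v.
Proof. by rewrite /restrict_scale scalerA -scalerAl mul1r scalerA. Qed.

Lemma restrict_scale1r : left_id 1 restrict_scale.
Proof. by move=> v; rewrite /restrict_scale !scale1r. Qed.

Lemma restrict_scalerDr : right_distributive restrict_scale +%R.
Proof. by move=> a u v; rewrite /restrict_scale scalerDr. Qed.

Lemma restrict_scalerDl v : {morph restrict_scale^~ v : a b / a + b}.
Proof. by move=> a b; rewrite /restrict_scale !scalerDl. Qed.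

HB.instance Definition _ := GRing.Zmodule_isLmodule.Build k restrict_scalars
  restrict_scalerA restrict_scale1r restrict_scalerDr restrict_scalerDl.

End RestrictScalars.

Arguments restrict_scalars k A V : clear implicits.

Definition strict_chain (T : Type) (n : nat) (N : nat -> {pred T}) : Prop :=
  forall i, (i < n)%N ->
    {subset N i <= N i.+1} /\ exists2 x, x \in N i.+1 & x \notin N i.

(* The length of a submodule W of V, as an element of {0, 1, ..., +oo}. *)
Definition submodule_length (K : realType) (A : pzRingType) (V : lmodType A)
    (W : {pred V}) : \bar K :=
  ereal_sup [set n%:R%:E | n in [set n : nat | exists N : nat -> {pred V},
    [/\ forall i, (i <= n)%N -> GRing.submod_closed (N i),
        forall i, (i <= n)%N -> {subset N i <= W}
      & strict_chain n N]]].

Definition module_length (K : realType) (A : pzRingType) (V : lmodType A) :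
    \bar K :=
  submodule_length K (@predT V).

(* The points of Spec R. The library's [prime_idealr R], whose carrier is a
   [{pred R}], lives in too large a universe to be the base type of a [set];
   each point of [spectrum R] is canonically a [prime_idealr R]. *)
Record spectrum (R : comNzRingType) := Spectrum {
  prime_pred : R -> bool;
  prime_pred_ideal : idealr_closed prime_pred;
  prime_pred_prime : prime_idealr_closed prime_pred }.

Coercion prime_mem (R : comNzRingType) (P : spectrum R) : {pred R} :=
  prime_pred P.

HB.instance Definition _ (R : comNzRingType) (P : spectrum R) :=
  isIdealr.Build R (prime_mem P) (prime_pred_ideal P).
HB.instance Definition _ (R : comNzRingType) (P : spectrum R) :=
  isPrimeIdealrClosed.Build R (prime_mem P) (@prime_pred_prime R P).

HB.instance Definition _ (R : comNzRingType) := gen_eqMixin (spectrum R).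
HB.instance Definition _ (R : comNzRingType) := gen_choiceMixin (spectrum R).

Lemma spectrum_eq (R : comNzRingType) (P Q : spectrum R) : P =i Q -> P = Q.
Proof.
case: P Q => [P iP pP] [Q iQ pQ] PQ.
have eqPQ : P = Q by apply/funext => x; exact: (PQ x).
by subst Q; f_equal; apply: Prop_irrelevance.
Qed.

Definition krull_dim (K : realType) (R : comNzRingType) : \bar K :=
  ereal_sup [set n%:R%:E | n in [set n : nat |
    exists P : nat -> spectrum R,
      strict_chain n (fun i => (P i : {pred R}))]].

Definition minimal_prime (R : comNzRingType) (P : spectrum R) : Prop :=
  forall Q : spectrum R, {subset Q <= P} -> {subset P <= Q}.

Definition top_dim_minimal_primes (K : realType) (R : comNzRingType) :
    set (spectrum R) :=
  [set P | minimal_prime P /\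
           krull_dim K {ideal_quot P} = krull_dim K R].

Arguments top_dim_minimal_primes K R _ : clear implicits.

(* A prime ideal seen as an R-submodule of R, so that [quotmod] yields R/P as
   an R-module, where [{ideal_quot P}] is R/P as a ring. *)
Section IdealAsSubmodule.
Variables (R : comNzRingType) (P : spectrum R).

Definition prime_submod : {pred R^o} := fun x => x \in P.

Lemma prime_submod_closed : GRing.submod_closed prime_submod.
Proof.
split=> [|a u v uP vP]; first exact: (idealr0 P).
rewrite /prime_submod unfold_in; apply: (@rpredD _ P) => //.
exact: (@idealMr _ P).
Qed.

HB.instance Definition _ := GRing.isSubmodClosed.Build R R^o prime_submod
  (GRing.submod_closed_semi prime_submod_closed).

End IdealAsSubmodule.

Section Localization.
Variables (R : comNzRingType) (P : spectrum R).

Definition denominator : Type := {s : R | s \notin P}.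

HB.instance Definition _ := Choice.on denominator.

Lemma denominator1_subproof : 1 \notin P.
Proof. by rewrite idealr1. Qed.

Definition den (s : denominator) : R := val s.

Lemma denominatorM_subproof (s t : denominator) : den s * den t \notin P.
Proof. by rewrite prime_idealrM negb_or (valP s) (valP t). Qed.

Definition denominator1 : denominator := Sub 1 denominator1_subproof.
Definition denominatorM (s t : denominator) : denominator :=
  Sub (den s * den t) (denominatorM_subproof s t).

Lemma den1 : den denominator1 = 1. Proof. by []. Qed.

Lemma denM s t : den (denominatorM s t) = den s * den t. Proof. by []. Qed.

Section Module.
Variable V : lmodType R.

(* m/s = n/t iff u (t m - s n) = 0 for some u outside P. *)
Definition frac_equiv (x y : V * denominator) : bool :=
  `[< exists u : denominator,
        den u *: (den y.2 *: x.1) = den u *: (den x.2 *: y.1) >].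

Lemma frac_equivP (x y : V * denominator) : reflect
  (exists u : denominator,
     den u *: (den y.2 *: x.1) = den u *: (den x.2 *: y.1)) (frac_equiv x y).
Proof. exact: asboolP. Qed.

Lemma frac_equiv_refl : reflexive frac_equiv.
Proof. by move=> x; apply/frac_equivP; exists denominator1. Qed.

Lemma frac_equiv_sym : symmetric frac_equiv.
Proof.
by move=> x y; apply/frac_equivP/frac_equivP => -[u e]; exists u; rewrite e.
Qed.

Lemma frac_equiv_trans : transitive frac_equiv.
Proof.
move=> y x z /frac_equivP[u exy] /frac_equivP[w eyz]; apply/frac_equivP.
exists (denominatorM (denominatorM u w) y.2).
move: exy eyz => /(congr1 (fun v => (den w * den z.2) *: v)) exy.
move=> /(congr1 (fun v => (den u * den x.2) *: v)) eyz.
rewrite /= ?denM ?den1 !scalerA in exy eyz *.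
transitivity ((den w * den z.2 * den u * den y.2) *: x.1).
  by congr (_ *: _); ring.
rewrite exy.
transitivity ((den u * den x.2 * den w * den z.2) *: y.1).
  by congr (_ *: _); ring.
rewrite eyz.
by congr (_ *: _); ring.
Qed.

Canonical frac_equiv_equiv :=
  EquivRel frac_equiv frac_equiv_refl frac_equiv_sym frac_equiv_trans.

Definition localization : Type := {eq_quot frac_equiv}.

HB.instance Definition _ := Choice.on localization.

Definition locfrac (m : V) (s : denominator) : localization :=
  \pi_{eq_quot frac_equiv} (m, s).

Lemma frac_eqP (m n : V) (s t : denominator) :
  locfrac m s = locfrac n t <-> exists u : denominator,
    den u *: (den t *: m) = den u *: (den s *: n).
Proof.
split=> [/eqP|e].
  by rewrite /locfrac eqmodE => /frac_equivP.
by apply/eqP; rewrite /locfrac eqmodE; apply/frac_equivP.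
Qed.

Definition frac_repr (x : localization) : V * denominator :=
  repr (x : {eq_quot frac_equiv}).

Lemma frac_reprK x : locfrac (frac_repr x).1 (frac_repr x).2 = x.
Proof. by rewrite /locfrac -surjective_pairing; apply: reprK. Qed.

Lemma frac_ind (Q : localization -> Prop) :
  (forall m s, Q (locfrac m s)) -> forall x, Q x.
Proof. by move=> H x; rewrite -[x]frac_reprK. Qed.

Lemma frac_repr_frac m s : exists u : denominator,
  den u *: (den s *: (frac_repr (locfrac m s)).1) =
  den u *: (den (frac_repr (locfrac m s)).2 *: m).
Proof. by apply/frac_eqP; rewrite frac_reprK. Qed.

Definition frac_add (x y : localization) : localization :=
  let: (m, s) := frac_repr x in let: (n, t) := frac_repr y in
  locfrac (den t *: m + den s *: n) (denominatorM s t).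

Definition frac_opp (x : localization) : localization :=
  let: (m, s) := frac_repr x in locfrac (- m) s.

Lemma frac_addE m s n t : frac_add (locfrac m s) (locfrac n t) =
  locfrac (den t *: m + den s *: n) (denominatorM s t).
Proof.
rewrite /frac_add.
case: (frac_repr _) (frac_repr_frac m s) => m' s' [u /= eu].
case: (frac_repr _) (frac_repr_frac n t) => n' t' [w /= ew].
apply/frac_eqP; exists (denominatorM u w).
rewrite /= ?denM ?den1 !scalerDr !scalerA in eu ew *.
congr (_ + _).
  transitivity ((den w * den t * den t') *: ((den u * den s) *: m')).
    by rewrite scalerA; congr (_ *: _); ring.
  by rewrite eu scalerA; congr (_ *: _); ring.
transitivity ((den u * den s * den s') *: ((den w * den t) *: n')).
  by rewrite scalerA; congr (_ *: _); ring.
by rewrite ew scalerA; congr (_ *: _); ring.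
Qed.

Lemma frac_oppE m s : frac_opp (locfrac m s) = locfrac (- m) s.
Proof.
rewrite /frac_opp; case: (frac_repr _) (frac_repr_frac m s) => m' s' [u /= eu].
by apply/frac_eqP; exists u; rewrite !scalerN eu.
Qed.

Lemma frac_addA : associative frac_add.
Proof.
elim/frac_ind=> m s; elim/frac_ind=> n t; elim/frac_ind=> q r.
rewrite !frac_addE; apply/frac_eqP; exists denominator1.
rewrite /= ?denM ?den1 !scale1r !scalerDr !scalerA addrA.
by congr (_ *: _ + _ *: _ + _ *: _); ring.
Qed.

Lemma frac_addC : commutative frac_add.
Proof.
elim/frac_ind=> m s; elim/frac_ind=> n t.
rewrite !frac_addE; apply/frac_eqP; exists denominator1.
rewrite /= ?denM ?den1 !scale1r !scalerDr !scalerA addrC.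
by congr (_ *: _ + _ *: _); ring.
Qed.

Lemma frac_add0 : left_id (locfrac 0 denominator1) frac_add.
Proof.
elim/frac_ind=> m s; rewrite !frac_addE; apply/frac_eqP; exists denominator1.
by rewrite /= ?denM ?den1 scaler0 add0r !scale1r mul1r.
Qed.

Lemma frac_addN : left_inverse (locfrac 0 denominator1) frac_opp frac_add.
Proof.
elim/frac_ind=> m s; rewrite frac_oppE frac_addE.
apply/frac_eqP; exists denominator1.
by rewrite /= ?denM ?den1 scalerN addNr !scaler0.
Qed.

HB.instance Definition _ := GRing.isZmodule.Build localization
  frac_addA frac_addC frac_add0 frac_addN.

Lemma fracD m s n t : locfrac m s + locfrac n t =
  locfrac (den t *: m + den s *: n) (denominatorM s t).
Proof. exact: frac_addE. Qed.

End Module.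

Section Scale.
Variable V : lmodType R.

Definition frac_scale (a : localization R^o) (x : localization V) :
    localization V :=
  let: (b, s) := frac_repr a in let: (m, t) := frac_repr x in
  locfrac ((b : R) *: m) (denominatorM s t).

Lemma frac_scaleE (a : R^o) s (m : V) t :
  frac_scale (locfrac a s) (locfrac m t) =
  locfrac ((a : R) *: m) (denominatorM s t).
Proof.
rewrite /frac_scale.
case: (frac_repr _) (frac_repr_frac a s) => a' s' [u /= eu].
case: (frac_repr _) (frac_repr_frac m t) => m' t' [w /= ew].
apply/frac_eqP; exists (denominatorM u w).
rewrite /= ?denM ?den1 !scalerA in ew *.
transitivity ((den u * (den s * a')) *: ((den w * den t) *: m')).
  by rewrite scalerA; congr (_ *: _); ring.
have -> : den u * (den s * a') = den u * (den s' * a) by exact: eu.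
by rewrite ew scalerA; congr (_ *: _); ring.
Qed.

Lemma frac_scaleDr : right_distributive frac_scale +%R.
Proof.
elim/frac_ind=> a s; elim/frac_ind=> m t; elim/frac_ind=> n r.
rewrite !(fracD, frac_scaleE); apply/frac_eqP; exists denominator1.
rewrite /= ?denM ?den1 !scale1r !scalerDr !scalerA.
by congr (_ *: _ + _ *: _); ring.
Qed.

Lemma frac_scaleDl x : {morph frac_scale^~ x : a b / a + b}.
Proof.
elim/frac_ind: x => m r; elim/frac_ind=> a s; elim/frac_ind=> b t.
rewrite !(fracD, frac_scaleE); apply/frac_eqP; exists denominator1.
rewrite /= ?denM ?den1 !scale1r !scalerDr !scalerDl !scalerDr !scalerA.
by congr (_ *: _ + _ *: _); rewrite /GRing.scale /= ?denM ?den1; ring.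
Qed.

Lemma frac_scale1 : left_id (locfrac (1 : R^o) denominator1) frac_scale.
Proof.
elim/frac_ind=> m s; rewrite frac_scaleE; apply/frac_eqP; exists denominator1.
by rewrite /= ?denM ?den1 !scale1r mul1r.
Qed.

End Scale.

Lemma frac_scaleA (V : lmodType R) (a b : localization R^o)
    (x : localization V) :
  frac_scale a (frac_scale b x) = frac_scale (frac_scale a b) x.
Proof.
elim/frac_ind: a => a s; elim/frac_ind: b => b t; elim/frac_ind: x => m r.
rewrite !frac_scaleE; apply/frac_eqP; exists denominator1.
rewrite /= ?denM ?den1 !scale1r !scalerA.
by congr (_ *: _); rewrite /GRing.scale /= ?denM ?den1; ring.
Qed.

Definition local_ring : Type := localization R^o.

HB.instance Definition _ := GRing.Zmodule.on local_ring.

Lemma local_ring_mulC : commutative (@frac_scale R^o).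
Proof.
elim/frac_ind=> a s; elim/frac_ind=> b t.
rewrite !frac_scaleE; apply/frac_eqP; exists denominator1.
by rewrite /GRing.scale /= ?denM ?den1; ring.
Qed.

Lemma local_ring_mulDl :
  left_distributive (@frac_scale R^o : local_ring -> local_ring -> local_ring)
    +%R.
Proof. by move=> a b x; apply: frac_scaleDl. Qed.

Lemma local_ring_mulA :
  associative (@frac_scale R^o : local_ring -> local_ring -> local_ring).
Proof. by move=> a b x; apply: frac_scaleA. Qed.

Lemma local_ring_1neq0 :
  (locfrac (1 : R^o) denominator1 : local_ring) != 0.
Proof.
apply/eqP=> /frac_eqP[u]; rewrite /= ?denM ?den1 !scale1r scaler0 => u0.
have : den u * 1 = 0 by exact: u0.
move=> /eqP; rewrite mulr1 => /eqP e; move: (valP u).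
by rewrite -/(den u) e idealr0.
Qed.

HB.instance Definition _ := GRing.Zmodule_isComNzRing.Build local_ring
  local_ring_mulA local_ring_mulC (@frac_scale1 R^o) local_ring_mulDl
  local_ring_1neq0.

HB.instance Definition _ (V : lmodType R) :=
  GRing.Zmodule_isLmodule.Build local_ring (localization V)
    (@frac_scaleA V) (@frac_scale1 V) (@frac_scaleDr V) (@frac_scaleDl V).

End Localization.

(* V is the internal direct sum of the additive subgroups G 0, G 1, ... *)
Definition direct_decomposition (V : zmodType) (G : nat -> {pred V}) : Prop :=
  [/\ forall m, zmod_closed (G m),
      forall v, exists (n : nat) (f : nat -> V),
        (forall i, f i \in G i) /\ v = \sum_(i < n) f i
    & forall (n : nat) (f : nat -> V), (forall i, f i \in G i) ->
        \sum_(i < n) f i = 0 -> forall i, (i < n)%N -> f i = 0].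

Definition noetherian (R : comNzRingType) : Prop :=
  forall J : submodClosed R^o, finitely_generated J.

Record standard_graded (k : fieldType) (R : comAlgType k)
    (G : nat -> {pred R}) : Prop := StandardGraded {
  sg_noetherian : noetherian R;
  sg_direct : direct_decomposition G;
  sg_mul : forall i j x y, x \in G i -> y \in G j -> x * y \in G (i + j)%N;
  sg_degree0 : forall x, x \in G 0%N <-> exists c : k, x = c%:A;
  sg_generated : forall S : {pred R}, GRing.subalg_closed S ->
    {subset G 1%N <= S} -> forall x, x \in S }.

Definition graded_module (R : comNzRingType) (G : nat -> {pred R})
    (V : lmodType R) (H : nat -> {pred V}) : Prop :=
  direct_decomposition H /\
  forall i j a v, a \in G i -> v \in H j -> a *: v \in H (i + j)%N.

Definition homogeneous_ideal (R : comNzRingType) (G : nat -> {pred R})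
    (I : {pred R^o}) : Prop :=
  I =i span_of [set x : R^o | x \in I /\ exists m, x \in G m].

Definition frobenius_power (R : comNzRingType) (I : {pred R^o}) (q : nat) :
    {pred R^o} :=
  span_of [set x : R^o | exists2 a : R, a \in I & x = a ^+ q].

Definition ideal_mul_module (R : comNzRingType) (J : {pred R^o})
    (V : lmodType R) : {pred V} :=
  span_of [set v | exists (a : R) (w : V), a \in J /\ v = a *: w].

Arguments ideal_mul_module {R} J V _.

HB.instance Definition _ (R : comNzRingType) (J : {pred R^o})
    (V : lmodType R) :=
  GRing.isSubmodClosed.Build R V (ideal_mul_module J V)
    (GRing.submod_closed_semi (span_of_closed _)).

(* The grading induced on V/N by a grading H of V. *)
Definition quot_grading (R : comNzRingType) (V : lmodType R)
    (N : submodClosed V) (H : nat -> {pred V}) (m : nat) :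
    {pred quotmod N} :=
  fun y => `[< exists2 v, v \in H m & y = quotmod_proj N v >].

Arguments quot_grading {R V} N H m _.

(* Components of negative degree are zero. *)
Definition component (V : zmodType) (H : nat -> {pred V}) (j : int) :
    {pred V} :=
  if j is Posz m then H m else pred1 0.

Section HilbertKunzDensity.
Variables (K : realType) (k : fieldType) (R : comAlgType k).
Variables (p d : nat) (I : {pred R^o}) (V : lmodType R) (H : nat -> {pred V}).

(* The length of the degree j component of V / I^[q] V over the degree 0
   part k of R. *)
Definition HK_length (q : nat) (j : int) : \bar K :=
  @submodule_length K k _
    (component (quot_grading (ideal_mul_module (frobenius_power I q) V) H) j
     : {pred restrict_scalars k R
               (quotmod (ideal_mul_module (frobenius_power I q) V))}).

(* [lim] and [fine] are total; on the modules considered here the lengths are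
   finite and the limit exists. *)
Definition HKd (x : K) : K :=
  lim ((fun n : nat =>
    ((p ^ n) ^ d.-1)%:R^-1 *
    fine (HK_length (p ^ n) (Num.floor (x * (p ^ n)%:R)))) @ \oo).

End HilbertKunzDensity.

(* HKd (R/P, I), for R/P graded by the images of the components of R. *)
Definition HKd_quotient (K : realType) (k : fieldType) (R : comAlgType k)
    (G : nat -> {pred R}) (p d : nat) (I : {pred R^o}) (P : spectrum R) :
    K -> K :=
  HKd p d I (quot_grading (prime_submod P) G).

(* Main.v *)
Require Import Defs.
From HB Require Import structures.
From mathcomp Require Import all_boot all_order all_algebra.
From mathcomp Require Import generic_quotient ring_quotient zify ring lra.
From mathcomp Require Import all_classical all_reals.
From mathcomp Require Import ereal topology normedtype sequences.

Set Implicit Arguments.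
Unset Strict Implicit.
Unset Printing Implicit Defensive.

Import Order.TTheory GRing.Theory Num.Theory.
Import numFieldNormedType.Exports.

Local Open Scope classical_set_scope.
Local Open Scope quotient_scope.
Local Open Scope ring_scope.

(* A graded prime filtration of M, with factors (R/P_i)(-a_i), bounds the length of
   (M/I^[q]M)_m above by the sum of those of (R/(P_i + I^[q]))_(m - a_i), and the
   shifts a_i only matter up to O(m^(d-2)). The reverse bound can fail, because of
   Tor_1(R/I^[q], -). It does hold up to O(m^(d-2)) when M is killed by the
   nilradical of R: adjoining to H a generator v with annihilator A modulo H changes
   the colength at least by that of R/A, computed in the reduced ring, which differs
   from the product of the R/P, dim R/P = d, only in dimension less than d.
   For Q = p^N large, the Frobenius pushforward of M is killed by the nilradical and,
   k being perfect, has the same lengths as M. The pushforward of R/P has Q^(d-1)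
   factors R/P, up to smaller dimension, by comparing leading coefficients of Hilbert
   functions. Hence
     l(M/I^[qQ]M)_(Qm + r) = Q^(d-1) sum_i l(R/(P_i + I^[q]))_m + O(m^(d-2)),
   so the normalized lengths of R/P converge and HKd(M) is the sum of the HKd(R/P_i).
   A minimal prime P occurs l(M_P) times among the P_i, and the primes with
   dim R/P < d contribute 0. *)

(** * Lengths of modules *)

(** The obstacle is the kernel of H/I^[q]H -> H'/I^[q]H' for H' = H + Rv. If A is the annihilator of
    v modulo H, this kernel is a quotient of the kernel of A/I^[q]A -> R/I^[q], so it can be
    measured inside R. There the length of A/I^[q]A is bounded above by a prime filtration of A, and
    that of R/I^[q] is bounded below by splitting R along its top-dimensional primes. The two bounds
    match only if each of these primes occurs once in a filtration of R; hence the passage to the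
    quotient by the nilradical, legitimate as soon as the nilradical kills v. Every error term is C
    (m+1)^(d-2) with C independent of q. For m about xq it becomes O(1/q) after division by q^(d-1).
    The comparison of degree m at q with degree Qm + r at qQ holds for all large N, where Q = p^N;
    two consecutive values of N make the normalized lengths of R/P a Cauchy sequence, so that no
    prior knowledge of the limit is used. *)

Definition sumset (V : zmodType) (X Y : set V) : set V :=
  [set z | exists x y, [/\ X x, Y y & z = x + y]].

Notation "X :+: Y" := (sumset X Y) (at level 50, left associativity).

Section Sumset.
Variable V : zmodType.
Implicit Types X Y Z : set V.

Lemma sumsetC X Y : X :+: Y = Y :+: X.
Proof.
by apply/seteqP; split=> z [x [y [Xx Yy ->]]]; exists y, x; split=> //; rewrite addrC.
Qed.

Lemma sumsetA X Y Z : X :+: (Y :+: Z) = X :+: Y :+: Z.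
Proof.
apply/seteqP; split=> z.
  move=> [x [_ [Xx [y [w [Yy Zw ->]]] ->]]]; exists (x + y), w.
  by split=> //; [exists x, y | rewrite addrA].
move=> [_ [w [[x [y [Xx Yy ->]]] Zw ->]]]; exists x, (y + w).
by split=> //; [exists y, w | rewrite addrA].
Qed.

Lemma sumset0 X : X :+: [set 0] = X.
Proof.
apply/seteqP; split=> z; first by move=> [x [_ [Xx -> ->]]]; rewrite addr0.
by move=> Xz; exists z, 0; rewrite addr0.
Qed.

Lemma sumset0l X : [set 0] :+: X = X.
Proof. by rewrite sumsetC sumset0. Qed.

Lemma sumsetS X Y X' Y' : X `<=` X' -> Y `<=` Y' -> X :+: Y `<=` X' :+: Y'.
Proof.
by move=> sX sY z [x [y [Xx Yy ->]]]; exists x, y; split; [exact: sX| exact: sY|].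
Qed.

End Sumset.

Section Length.
Variables (A : pzRingType) (V : lmodType A).
Implicit Types (W X Y T : set V) (N : nat -> set V) (n : nat).

Definition submod W := W 0 /\ forall a u v, W u -> W v -> W (a *: u + v).

Lemma submod0 W : submod W -> W 0. Proof. by case. Qed.

Lemma submodD W u v : submod W -> W u -> W v -> W (u + v).
Proof. by move=> [_ WP] Wu Wv; rewrite -[u]scale1r; apply: WP. Qed.

Lemma submodZ W a u : submod W -> W u -> W (a *: u).
Proof. by move=> [W0 WP] Wu; rewrite -[_ *: _]addr0; apply: WP. Qed.

Lemma submodN W u : submod W -> W u -> W (- u).
Proof. by move=> sW Wu; rewrite -scaleN1r; apply: submodZ. Qed.

Lemma submodB W u v : submod W -> W u -> W v -> W (u - v).
Proof. by move=> sW Wu Wv; apply: submodD => //; apply: submodN. Qed.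

Lemma submodDr W u v : submod W -> W u -> W (v + u) -> W v.
Proof. by move=> sW Wu Wvu; rewrite -[v](addrK u); apply: submodB. Qed.

Lemma submodBr W u v : submod W -> W u -> W (v - u) -> W v.
Proof. by move=> sW Wu Wvu; rewrite -[v](subrK u); apply: submodD. Qed.

Lemma submod_sum W (I : Type) (r : seq I) (F : I -> V) :
  submod W -> (forall i, W (F i)) -> W (\sum_(i <- r) F i).
Proof.
move=> sW WF; elim: r => [|i r IH]; first by rewrite big_nil; apply: submod0.
by rewrite big_cons; apply: submodD.
Qed.

Lemma submod_set0 : submod [set 0].
Proof. by split=> // a u v -> ->; rewrite scaler0 addr0. Qed.

Lemma submod_setT : submod setT. Proof. by []. Qed.

Lemma submodI X Y : submod X -> submod Y -> submod (X `&` Y).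
Proof.
move=> sX sY; split; first by split; apply: submod0.
move=> a u v [Xu Yu] [Xv Yv].
by split; apply: submodD => //; apply: submodZ.
Qed.

Lemma submod_sumset X Y : submod X -> submod Y -> submod (X :+: Y).
Proof.
move=> sX sY; split; first by exists 0, 0; rewrite addr0; split=> //; apply: submod0.
move=> a _ _ [x [y [Xx Yy ->]]] [x' [y' [Xx' Yy' ->]]].
exists (a *: x + x'), (a *: y + y').
split; [exact: (proj2 sX) | exact: (proj2 sY) |].
by rewrite scalerDr addrACA.
Qed.

Lemma sumset_subl X Y : submod Y -> X `<=` X :+: Y.
Proof. by move=> sY x Xx; exists x, 0; rewrite addr0; split=> //; apply: submod0. Qed.

Lemma sumset_subr X Y : submod X -> Y `<=` X :+: Y.
Proof. by move=> sX; rewrite sumsetC; apply: sumset_subl. Qed.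

Lemma sumset_min X Y W : submod W -> X `<=` W -> Y `<=` W -> X :+: Y `<=` W.
Proof. by move=> sW XW YW _ [x [y [/XW Wx /YW Wy ->]]]; apply: submodD. Qed.

Lemma sumset_absorb X Y : submod X -> submod Y -> X `<=` Y -> X :+: Y = Y.
Proof.
move=> sX sY XY; apply/seteqP; split; first exact: sumset_min.
exact: sumset_subr.
Qed.

Lemma sumset_modular X Y Z : submod Z -> X `<=` Z ->
  (X :+: Y) `&` Z = X :+: (Y `&` Z).
Proof.
move=> sZ XZ; apply/seteqP; split=> z.
  move=> [[x [y [Xx Yy ->]]] Zxy]; exists x, y; split=> //; split=> //.
  by apply: (submodDr (u := x)) => //; [exact: XZ | rewrite addrC].
move=> [x [y [Xx [Yy Zy] ->]]]; split; first by exists x, y.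
by apply: submodD => //; apply: XZ.
Qed.

(** Y/X is zero or simple. Allowing zero keeps the condition stable under images, intersections and
    sums, so series are transported without deleting repetitions. *)
Definition simple_step X Y := X `<=` Y /\
  forall x y, Y x -> ~ X x -> Y y -> exists a, X (y - a *: x).

(* A composition series whose steps are allowed to be trivial. *)
Definition cseries N n := [/\ N 0%N = [set 0], forall i, submod (N i)
  & forall i, (i < n)%N -> simple_step (N i) (N i.+1)].

Definition schain W n := exists N, [/\ forall i, (i <= n)%N -> submod (N i),
  forall i, (i <= n)%N -> N i `<=` W &
  forall i, (i < n)%N -> N i `<=` N i.+1 /\ exists2 x, N i.+1 x & ~ N i x].

Definition fin W := submod W /\ exists N n, cseries N n /\ W `<=` N n.

(** Defined by strict chains, without reference to a series, so that it agrees with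
    [submodule_length]; the default 0 is met only when no maximum exists. *)
Definition len W : nat :=
  xget 0%N [set n | schain W n /\ forall m, schain W m -> (m <= n)%N].

Definition jump N W i : bool := `[< exists x, [/\ W x, N i.+1 x & ~ N i x] >].

(** The number of proper steps in the trace of N on W. One fixed N measures all submodules at once,
    so lengths compare index by index. *)
Definition jumps N n W : nat := \sum_(i < n) jump N W i.

Lemma cseries_le N n i j : cseries N n -> (i <= j <= n)%N -> N i `<=` N j.
Proof.
move=> [_ _ step]; elim: j => [|j IH] /andP[].
  by rewrite leqn0 => /eqP-> _ x.
rewrite leq_eqVlt => /predU1P[-> _ x //|]; rewrite ltnS => ij jn x Nx.
by apply: (proj1 (step j jn)); apply: IH => //; rewrite ij ltnW.
Qed.

Lemma jump_sub N W W' i : W `<=` W' -> (jump N W i <= jump N W' i)%N.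
Proof.
move=> WW; rewrite /jump; case: asboolP => // -[x [Wx Nx Nx']].
by case: asboolP => //; case; exists x; split=> //; apply: WW.
Qed.

Lemma jumps_sub N n W W' : W `<=` W' -> (jumps N n W <= jumps N n W')%N.
Proof. by move=> WW; apply: leq_sum => i _; apply: jump_sub. Qed.

(** Jumps of W are jumps of W', so the inequality of counts makes them coincide. Inductively along
    N, an element y of W' is corrected by a multiple of an element of W witnessing the jump, which
    moves it to the previous step. *)
Lemma jumps_eq N n W W' : cseries N n -> submod W -> submod W' ->
  W `<=` W' -> W' `<=` N n -> (jumps N n W' <= jumps N n W)%N -> W' `<=` W.
Proof.
move=> cN sW sW' WW WN le.
have je i : (i < n)%N -> jump N W i = jump N W' i.
  move=> lti; have := jump_sub N i WW.
  have : (jump N W' i <= jump N W i)%N.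
    move: le; rewrite /jumps (bigD1 (Ordinal lti)) //=.
    rewrite [X in (_ <= X)%N](bigD1 (Ordinal lti)) //= => le.
    have : (\sum_(j < n | j != Ordinal lti) jump N W j <=
            \sum_(j < n | j != Ordinal lti) jump N W' j)%N.
      by apply: leq_sum => j _; apply: jump_sub.
    move=> le'; rewrite -(leq_add2r (\sum_(j < n | j != Ordinal lti) jump N W' j)).
    by rewrite (leq_trans le) // leq_add2l.
  by case: (jump N W' i) (jump N W i) => -[].
suff H i : (i <= n)%N -> W' `&` N i `<=` W.
  by move=> x Wx; apply: (H n (leqnn n)); split=> //; apply: WN.
elim: i => [|i IH] lei y [W'y Ny].
  by case: cN Ny => -> _ _ ->; apply: submod0.
case: (pselect (N i y)) => [Niy|Niy]; first by apply: IH; rewrite 1?ltnW.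
have : jump N W i by rewrite je //; apply/asboolP; exists y.
move=> /asboolP[x [Wx Nx Nix]].
case: (cN) => _ sN step; case: (step i lei) => _ /(_ x y Nx Nix Ny) [a Na].
apply: (submodBr (u := a *: x)) => //; first exact: submodZ.
apply: IH; first exact: ltnW.
by split=> //; apply: submodB => //; apply: submodZ => //; apply: WW.
Qed.

(** By [jumps_eq] every strict inclusion in the chain gains at least one jump. *)
Lemma schain_jumps N n W m : cseries N n -> W `<=` N n ->
  schain W m -> (m <= jumps N n W)%N.
Proof.
move=> cN WN [C [sC CW stC]].
have H i : (i <= m)%N -> (i <= jumps N n (C i))%N.
  elim: i => // i IH lti; apply: leq_ltn_trans (IH (ltnW lti)) _.
  have [Ci [x Cx Cix]] := stC i lti.
  rewrite ltnNge; apply/negP => /(@jumps_eq N n (C i) (C i.+1) cN) sub.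
  apply/Cix/sub => //; try (by apply: sC; lia).
  by apply: subset_trans WN; apply: CW.
by apply: leq_trans (H m _) (jumps_sub _ _ (CW _ _)).
Qed.

(** The chain consists of the traces of N on W with repetitions removed: the index of a member of C
    counts the jumps so far. *)
Lemma jumps_schain N n W : cseries N n -> submod W -> W `<=` N n ->
  schain W (jumps N n W).
Proof.
move=> cN sW WN.
suff H j : (j <= n)%N -> exists C, [/\ forall i, submod (C i),
    forall i, C i `<=` W, C (jumps N j W) = W `&` N j &
    forall i, (i < jumps N j W)%N -> C i `<=` C i.+1 /\ exists2 x, C i.+1 x & ~ C i x].
  by have [C [sC CW _ stC]] := H n (leqnn n); exists C; split.
elim: j => [|j IH] ltj.
  exists (fun=> [set 0]); case: (cN) => N0 _ _.
  rewrite /jumps big_ord0; split=> //.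
  - by move=> _; apply: submod_set0.
  - by move=> _ _ ->; apply: submod0.
  rewrite N0; apply/seteqP; split=> [_ ->|x []//].
  by split=> //; apply: submod0.
have [C [sC CW Ce stC]] := IH (ltnW ltj).
have [N0 sN step] := cN.
rewrite /jumps big_ord_recr /= -/(jumps N j W).
case: (boolP (jump N W j)) => [/asboolP [x [Wx Nx Njx]]|].
  exists (fun i => if (i <= jumps N j W)%N then C i else W `&` N j.+1).
  rewrite addn1; split=> [i|i|/=|i].
  - by case: ifP => // _; apply: submodI.
  - by case: ifP => // _ y [].
  - by rewrite ltnn.
  rewrite ltnS => le; have [lti|eqi] := ltnP i (jumps N j W).
    by rewrite le; apply: stC.
  have -> : i = jumps N j W by apply/eqP; rewrite eqn_leq le.
  rewrite leqnn Ce; split; last by exists x; [split | case].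
  by move=> y [Wy Ny]; split=> //; apply: (proj1 (step j ltj)).
move=> /asboolPn nj; rewrite addn0; exists C; split=> //.
rewrite Ce; apply/seteqP; split=> y [Wy Ny]; split=> //.
  exact: (proj1 (step j ltj)).
by apply: contrapT => Njy; apply: nj; exists y.
Qed.

Lemma len_jumps N n W : cseries N n -> submod W -> W `<=` N n ->
  len W = jumps N n W.
Proof.
move=> cN sW WN; apply: xget_unique.
  split; first exact: jumps_schain.
  by move=> m; apply: schain_jumps.
move=> m [cm max]; apply/eqP; rewrite eqn_leq schain_jumps //=.
exact/max/jumps_schain.
Qed.

Lemma fin_schain W : fin W -> schain W (len W).
Proof.
by move=> [sW [N [n [cN WN]]]]; rewrite (len_jumps cN) //; apply: jumps_schain.
Qed.

Lemma schain_len W m : fin W -> schain W m -> (m <= len W)%N.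
Proof.
by move=> [sW [N [n [cN WN]]]]; rewrite (len_jumps cN) //; apply: schain_jumps.
Qed.

Lemma fin_submod W : fin W -> submod W. Proof. by case. Qed.

Lemma fin_sub W W' : submod W -> W `<=` W' -> fin W' -> fin W.
Proof.
move=> sW WW [_ [N [n [cN WN]]]]; split=> //; exists N, n; split=> //.
exact: subset_trans WN.
Qed.

Lemma fin_set0 : fin [set 0].
Proof.
split; first exact: submod_set0.
by exists (fun=> [set 0]), 0%N; split=> //; split=> // _; apply: submod_set0.
Qed.

Lemma len_set0 : len [set 0] = 0%N.
Proof.
have [_ [N [n [cN N0]]]] := fin_set0.
rewrite (len_jumps cN) //; last exact: submod_set0.
rewrite /jumps big1 // => i _; rewrite /jump; case: asboolP => // -[x [-> _]] [].
by apply: submod0; case: cN.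
Qed.

Lemma simple_step_sumset X Y Z : submod Z -> simple_step X Y ->
  simple_step (Z :+: X) (Z :+: Y).
Proof.
move=> sZ [XY st]; split; first exact: sumsetS.
move=> _ _ [z [x [Zz Yx ->]]] nX [z' [y [Zz' Yy ->]]].
have [|a Xa] := st x y Yx _ Yy; first by move=> Xx; apply: nX; exists z, x.
exists a, (z' - a *: z), (y - a *: x); split=> //.
  by apply: submodB => //; apply: submodZ.
by rewrite scalerDr opprD addrACA.
Qed.

Lemma fin_sumset X Y : fin X -> fin Y -> fin (X :+: Y).
Proof.
move=> [sX [N [n [cN XN]]]] [sY [M [m [cM YM]]]].
split; first exact: submod_sumset.
have [N0 sN stN] := cN; have [M0 sM stM] := cM.
exists (fun i => if (i <= n)%N then N i else N n :+: M (i - n)%N), (n + m)%N.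
split; last first.
  apply: subset_trans (sumsetS XN YM) _; case: leqP => le.
    have -> : m = 0%N by lia.
    by rewrite M0 sumset0 addn0.
  by rewrite addKn.
split=> [|i|i lti].
- by [].
- by case: leqP => // _; apply: submod_sumset.
case: (ltnP i n) => [lt|le]; first by rewrite ltnW //; apply: stN.
have -> : (if (i <= n)%N then N i else N n :+: M (i - n)%N) = N n :+: M (i - n)%N.
  case: leqP => // le'; have -> : i = n by lia.
  by rewrite subnn M0 sumset0.
by rewrite subSn //; apply: simple_step_sumset => //; apply: stM; lia.
Qed.

Lemma simple_step_cyclic X x : submod X ->
  (forall b, ~ X (b *: x) -> exists a, X (x - a *: (b *: x))) ->
  simple_step X (X :+: range (fun a => a *: x)).
Proof.
move=> sX H; split.
  by move=> y Xy; exists y, 0; rewrite addr0; split=> //; exists 0; rewrite ?scale0r.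
move=> _ _ [y [_ [Xy [b _ <-] ->]]] nX [z [_ [Xz [c _ <-] ->]]].
have [|a Xa] := H b; first by move=> Xb; apply: nX; apply: submodD.
exists (c * a).
have -> : z + c *: x - (c * a) *: (y + b *: x) =
  (z - (c * a) *: y) + c *: (x - a *: (b *: x)).
  by rewrite scalerDr opprD addrACA scalerBr !scalerA.
by apply: submodD => //; [apply: submodB => //|]; apply: submodZ.
Qed.

Lemma len_sub W W' : submod W -> W `<=` W' -> fin W' -> (len W <= len W')%N.
Proof.
move=> sW WW [sW' [N [n [cN WN]]]]; rewrite !(len_jumps cN) //.
  exact: jumps_sub.
exact: subset_trans WN.
Qed.

End Length.

(** * Rank-nullity, the modular law and relative lengths *)

Lemma linear_fun0 (A : pzRingType) (V U : lmodType A) (f : V -> U) :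
  linear f -> f 0 = 0.
Proof. by move=> lf; have := lf (-1) 0 0; rewrite scaler0 addr0 scaleN1r addNr. Qed.

Section RankNullity.
Variables (A : pzRingType) (V U : lmodType A) (f : V -> U).
Hypothesis lf : linear f.

Let f0 : f 0 = 0. Proof. exact: linear_fun0. Qed.

Let fB x y : f (x - y) = f x - f y.
Proof. by have := lf (-1) y x; rewrite !scaleN1r ![- _ + _]addrC. Qed.

Let fZ a x : f (a *: x) = a *: f x.
Proof. by have := lf a x 0; rewrite f0 !addr0. Qed.

Let fD x y : f (x + y) = f x + f y.
Proof. by have := lf 1 x y; rewrite !scale1r. Qed.

Lemma submod_image W : submod W -> submod (f @` W).
Proof.
move=> sW; split; first by exists 0; [exact: submod0 | exact: f0].
move=> a _ _ [u Wu <-] [v Wv <-]; exists (a *: u + v); last exact: lf.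
exact: (proj2 sW).
Qed.

Lemma submod_preimage W : submod W -> submod (f @^-1` W).
Proof.
move=> sW; split; first by rewrite /preimage /= f0; apply: submod0.
by move=> a u v /= Wu Wv; rewrite lf; apply: (proj2 sW).
Qed.

Lemma submod_kernel : submod [set x | f x = 0%R].
Proof. exact: submod_preimage (submod_set0 U). Qed.

Lemma image_sumset X Y : f @` (X :+: Y) = (f @` X) :+: (f @` Y).
Proof.
apply/seteqP; split=> z.
  move=> [_ [x [y [Xx Yy ->]]] <-]; exists (f x), (f y).
  by split; [exists x | exists y | rewrite fD].
move=> [_ [_ [[x Xx <-] [y Yy <-] ->]]]; exists (x + y) => //.
by exists x, y.
Qed.

Lemma cseries_image N n : cseries N n -> cseries (fun i => f @` N i) n.
Proof.
move=> [N0 sN st]; split.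
- by rewrite N0 image_set1 f0.
- by move=> i; apply: submod_image.
move=> i lti; have [Ni H] := st i lti; split; first exact: image_subset.
move=> _ _ [x Nx <-] nN [y Ny <-].
have [|a Na] := H x y Nx _ Ny; first by move=> Nix; apply: nN; exists x.
by exists a, (y - a *: x) => //; rewrite fB fZ.
Qed.

Lemma fin_image W : fin W -> fin (f @` W).
Proof.
move=> [sW [N [n [cN WN]]]]; split; first exact: submod_image.
exists (fun i => f @` N i), n; split; first exact: cseries_image.
exact: image_subset.
Qed.

(** Each factor of the series traced on W is zero or simple, so a nonzero one survives in exactly
    one of the image and the kernel. *)
Lemma rank_nullity W : fin W ->
  len W = (len (f @` W) + len (W `&` [set x | f x = 0%R]))%N.
Proof.
move=> fW; have [sW [N [n [cN WN]]]] := fW.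
have [N0 sN st] := cN.
pose M i := W `&` N i.
have cM : cseries M n.
  split.
  - rewrite /M N0; apply/seteqP; split=> [x []//|_ ->].
    by split=> //; apply: submod0.
  - by move=> i; apply: submodI.
  move=> i lti; have [Ni H] := st i lti; split.
    by move=> x [Wx Nx]; split=> //; apply: Ni.
  move=> x y [Wx Nx] nN [Wy Ny].
  have [|a Na] := H x y Nx _ Ny; first by move=> Nix; apply: nN.
  by exists a; split=> //; apply: submodB => //; apply: submodZ.
have Mn : M n = W by apply/seteqP; split=> [x []//|x Wx]; split=> //; apply: WN.
have WM : W `<=` M n by rewrite Mn.
have sK : submod (W `&` [set x | f x = 0%R]).
  by apply: submodI => //; apply: submod_kernel.
rewrite (len_jumps cM) // (len_jumps (cseries_image cM)); last 2 first.
- exact: submod_image.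
- exact: image_subset.
rewrite (len_jumps cM) //; last by rewrite Mn => x [].
rewrite /jumps -big_split /=; apply: eq_bigr => i _.
have [_ sM stM] := cM; have [Mi H] := stM i (ltn_ord i).
rewrite /jump; case: asboolP => [[x [Wx Mx nx]]|nj]; last first.
  case: asboolP => [[_ [_ [x Mx <-] nx]]|_].
    by exfalso; apply: nj; exists x; split; [case: Mx | | move=> Mix; apply: nx; exists x].
  by case: asboolP => // -[x [[Wx _] Mx nx]]; exfalso; apply: nj; exists x.
case: (pselect (exists y, [/\ M i.+1 y, ~ M i y & f y = 0])) => [[y [My nMy fy]]|nk].
  case: asboolP => [[_ [_ [z Mz <-] nz]]|_].
    exfalso; apply: nz; have [a Ma] := H y z My nMy Mz.
    by exists (z - a *: y) => //; rewrite fB fZ fy scaler0 subr0.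
  case: asboolP => // -[]; exists y; split=> //; split=> //.
  by case: My.
case: asboolP => [_|nz].
  case: asboolP => // -[y [[Wy fy] My nMy]].
  by exfalso; apply: nk; exists y.
exfalso; apply: nk; apply: contrapT => nk.
apply: nz; exists (f x); split; [by exists x| by exists x|].
move=> [y My fxy]; apply: nk; exists (x - y); split.
- by apply: submodB => //; apply: Mi.
- by move=> Mxy; apply: nx; apply: submodBr Mxy.
by rewrite fB fxy subrr.
Qed.

Lemma len_inj W : fin W -> (forall x, W x -> f x = 0 -> x = 0) ->
  len (f @` W) = len W.
Proof.
move=> fW inj; rewrite (rank_nullity fW).
suff -> : W `&` [set x | f x = 0%R] = [set 0] by rewrite len_set0 addn0.
apply/seteqP; split=> [x [Wx fx]|_ ->]; first exact: inj.
by split=> //; apply: submod0; case: fW.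
Qed.

End RankNullity.

Section Modularity.
Variables (A : pzRingType) (V : lmodType A).
Implicit Types X Y T : set V.

Let lfst : linear (@fst V V). Proof. by []. Qed.
Let lsnd : linear (@snd V V). Proof. by []. Qed.
Let ladd : linear (fun z : V * V => z.1 + z.2).
Proof. by move=> a u v /=; rewrite scalerDr addrACA. Qed.
Let pair_ext (z w : V * V) : z.1 = w.1 -> z.2 = w.2 -> z = w.
Proof. by case: z w => [? ?] [? ?] /= -> ->. Qed.
Let linl : linear (fun x : V => (x, 0 : V)).
Proof. by move=> a u v; apply: pair_ext; rewrite //= scaler0 addr0. Qed.
Let linr : linear (fun x : V => (0 : V, x)).
Proof. by move=> a u v; apply: pair_ext; rewrite //= scaler0 addr0. Qed.

(** Rank-nullity for the first projection and for addition on the product of X and Y: the images are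
    X and X + Y, the kernels copies of Y and of the intersection. *)
Lemma len_modular X Y : fin X -> fin Y ->
  (len (X :+: Y) + len (X `&` Y) = len X + len Y)%N.
Proof.
move=> fX fY; have sX := fin_submod fX; have sY := fin_submod fY.
pose P : set (V * V) := [set z | X z.1 /\ Y z.2].
have fP : fin P.
  have := fin_sumset (fin_image linl fX) (fin_image linr fY).
  congr fin; apply/seteqP; split=> [_ [_ [_ [[x Xx <-] [y Yy <-] ->]]]|[x y] [/= Xx Yy]].
    by split; rewrite /= ?addr0 ?add0r.
  exists (x, 0), (0, y); split; [by exists x| by exists y |].
  by apply: pair_ext; rewrite /= ?addr0 ?add0r.
have e1 := rank_nullity lfst fP; have e2 := rank_nullity ladd fP.
have i1 : (@fst V V) @` P = X.
  apply/seteqP; split=> [_ [[x y] [/= Xx Yy] <-]//|x Xx].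
  by exists (x, 0) => //; split=> //; apply: submod0.
have i2 : (fun z : V * V => z.1 + z.2) @` P = X :+: Y.
  apply/seteqP; split=> [_ [[x y] [/= Xx Yy] <-]//|_ [x [y [Xx Yy ->]]]].
    by exists x, y.
  by exists (x, y).
have k1 : len (P `&` [set z | z.1 = 0]) = len Y.
  rewrite -(len_inj lsnd) ; last 2 first.
  - by apply: fin_sub (fP) => [|z []//]; apply: submodI; [case: fP | apply: submod_kernel lfst].
  - by move=> [x y] [_ /= ->] ->.
  congr len; apply/seteqP; split=> [_ [[x y] [[/= _ Yy] _] <-]//|y Yy].
  by exists (0, y) => //; split=> //; split=> //; apply: submod0.
have k2 : len (P `&` [set z | z.1 + z.2 = 0]) = len (X `&` Y).
  rewrite -(len_inj lfst) ; last 2 first.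
  - by apply: fin_sub (fP) => [|z []//]; apply: submodI; [case: fP | apply: submod_kernel ladd].
  - by move=> [x y] [_ /=] + x0; rewrite x0 add0r => ->.
  congr len; apply/seteqP; split=> [_ [[x y] [[/= Xx Yy] e] <-]|x [Xx Yx]].
    split=> //=; move: e => /eqP; rewrite addr_eq0 => /eqP->; exact: submodN.
  exists (x, - x) => //; split; last by rewrite /= subrr.
  by split=> //=; apply: submodN.
by rewrite -i2 -k2 -e2 e1 i1 k1.
Qed.

(* The length of (X + T)/T; X has finite length, T need not. *)
Definition rlen X T : nat := (len X - len (X `&` T))%N.

Lemma fin_capl X T : fin X -> submod T -> fin (X `&` T).
Proof.
move=> fX sT; have sX := fin_submod fX.
by apply: fin_sub (fX) => [|x []//]; apply: submodI.
Qed.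

Lemma rlen_cap_len X T : fin X -> submod T -> (rlen X T + len (X `&` T) = len X)%N.
Proof.
move=> fX sT; rewrite /rlen subnK //; apply: len_sub => [||//].
  by apply: submodI => //; case: fX.
by move=> x [].
Qed.

Lemma rlen_fin X T : fin X -> fin T -> (rlen X T + len T = len (X :+: T))%N.
Proof.
move=> fX fT; have := len_modular fX fT.
have := rlen_cap_len fX (fin_submod fT); lia.
Qed.

Lemma rlen_cap X T Z : X `<=` Z -> rlen X T = rlen X (T `&` Z).
Proof.
move=> XZ; rewrite /rlen; congr (_ - len _)%N.
by apply/seteqP; split=> [x [Xx Tx]|x [Xx [Tx _]]]; split=> //; split=> //; apply: XZ.
Qed.

(** Additivity along T, Y + T, X + Y + T. As T may have infinite length, it is first replaced by its
    trace on X + Y, where relative lengths are differences of lengths. *)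
Lemma rlen_sumset X Y T : fin X -> fin Y -> submod T ->
  rlen (X :+: Y) T = (rlen Y T + rlen X (Y :+: T))%N.
Proof.
move=> fX fY sT; have sX := fin_submod fX; have sY := fin_submod fY.
have fXY := fin_sumset fX fY; have sXY := fin_submod fXY.
pose T' := T `&` (X :+: Y).
have fT' : fin T' by rewrite /T' setIC; apply: fin_capl.
rewrite (@rlen_cap (X :+: Y) T (X :+: Y)) // (@rlen_cap Y T (X :+: Y)); last first.
  exact: sumset_subr.
rewrite (@rlen_cap X (Y :+: T) (X :+: Y)); last exact: sumset_subl.
rewrite sumset_modular //; last exact: sumset_subr.
rewrite -/T'.
have := rlen_fin fXY fT'; have := rlen_fin fY fT'; have := rlen_fin fX (fin_sumset fY fT').
by rewrite sumsetA; lia.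
Qed.

Lemma rlen_subr X T T' : fin X -> submod T -> submod T' -> T `<=` T' ->
  (rlen X T' <= rlen X T)%N.
Proof.
move=> fX sT sT' TT; have := rlen_cap_len fX sT; have := rlen_cap_len fX sT'.
suff : (len (X `&` T) <= len (X `&` T'))%N by lia.
apply: len_sub; [|exact: setIS|exact: fin_capl].
by apply: submodI => //; case: fX.
Qed.

Lemma rlen_subset X T : X `<=` T -> rlen X T = 0%N.
Proof. by move=> XT; rewrite /rlen setIidl // subnn. Qed.

Lemma rlen_subl X X' T : fin X -> fin X' -> submod T ->
  X `<=` X' :+: T -> (rlen X T <= rlen X' T)%N.
Proof.
move=> fX fX' sT XX; have sX := fin_submod fX; have sX' := fin_submod fX'.
apply: (@leq_trans (rlen (X' :+: X) T)).
  by rewrite rlen_sumset // leq_addr.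
by rewrite sumsetC rlen_sumset // (@rlen_subset X) ?addn0.
Qed.

Lemma rlen_subadd X Y T : fin X -> fin Y -> submod T ->
  (rlen (X :+: Y) T <= rlen X T + rlen Y T)%N.
Proof.
move=> fX fY sT; rewrite rlen_sumset // addnC leq_add2r.
apply: rlen_subr => //; first by apply: submod_sumset => //; case: fY.
by apply: sumset_subr; case: fY.
Qed.

Lemma rlen_cap_modular X S T : fin X -> submod S -> submod T ->
  S `<=` X -> T `<=` X ->
  (rlen X (S `&` T) + rlen X (S :+: T) = rlen X S + rlen X T)%N.
Proof.
move=> fX sS sT SX TX.
have := rlen_cap_len fX sS; have := rlen_cap_len fX sT.
have := rlen_cap_len fX (submodI sS sT); have := rlen_cap_len fX (submod_sumset sS sT).
have STX : S :+: T `<=` X by apply: sumset_min => //; case: fX.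
have STX' : S `&` T `<=` X by move=> x [Sx _]; apply: SX.
rewrite (setIidr SX) (setIidr TX) (setIidr STX) (setIidr STX').
have := len_modular (fin_sub sS SX fX) (fin_sub sT TX fX); lia.
Qed.

End Modularity.

Section RelImage.
Variables (A : pzRingType) (V U : lmodType A) (f : V -> U).
Hypothesis lf : linear f.

Lemma rlen_image X (T : set U) : fin X -> submod T -> rlen (f @` X) T = rlen X (f @^-1` T).
Proof.
move=> fX sT; have sX := fin_submod fX.
have sfT := submod_preimage lf sT.
have fXT := fin_capl fX sfT.
have e1 := rank_nullity lf fX; have e2 := rank_nullity lf fXT.
have e3 := rlen_cap_len (fin_image lf fX) sT; have e4 := rlen_cap_len fX sfT.
have i : f @` (X `&` f @^-1` T) = f @` X `&` T.
  apply/seteqP; split=> [_ [x [Xx Tx] <-]|_ [[x Xx <-] Tx]]; last by exists x.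
  by split=> //; exists x.
have k : X `&` f @^-1` T `&` [set x | f x = 0%R] = X `&` [set x | f x = 0%R].
  apply/seteqP; split=> [x [[]]//|x [Xx /= fx]]; split=> //; split=> //=.
  by rewrite fx; apply: submod0.
by rewrite i k in e2; lia.
Qed.

Lemma rlen_image_le X T (T' : set U) : fin X -> submod T -> submod T' ->
  T `<=` f @^-1` T' -> (rlen (f @` X) T' <= rlen X T)%N.
Proof.
by move=> fX sT sT' TT; rewrite rlen_image //; apply: rlen_subr => //; apply: submod_preimage.
Qed.

End RelImage.

Lemma submod_pred (A : pzRingType) (V : lmodType A) (N : {pred V}) :
  GRing.submod_closed N <-> submod [set x | x \in N].
Proof. by []. Qed.

Lemma submodule_lengthE (K : realType) (A : pzRingType) (V : lmodType A)
    (W : {pred V}) (X : set V) : (forall x, x \in W <-> X x) -> fin X ->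
  submodule_length K W = (len X)%:R%:E.
Proof.
move=> WX fX; apply/eqP; rewrite eq_le; apply/andP; split.
  apply: ge_ereal_sup => _ [n [N [sN NW stN]] <-]; rewrite lee_fin ler_nat.
  apply: schain_len => //; exists (fun i => [set x | x \in N i]); split=> i lei.
  - exact: sN.
  - by move=> x /(NW i lei) /WX.
  have [Ni [x Nx Nix]] := stN i lei; split; first by move=> y; apply: Ni.
  by exists x => //; apply/negP.
apply: ereal_sup_ubound; exists (len X) => //.
have [N [sN NX stN]] := fin_schain fX.
exists (fun i => (fun x => `[< N i x >]) : {pred V}); split.
- move=> i lei; have [N0 NP] := sN i lei; split; first exact/asboolP.
  by move=> a u v /asboolP Nu /asboolP Nv; apply/asboolP; apply: NP.
- by move=> i lei x /asboolP Nx; apply/WX; apply: NX Nx.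
move=> i lti; have [Ni [x Nx Nix]] := stN i lti.
split; first by move=> y /asboolP Ny; apply/asboolP; apply: Ni.
by exists x; [apply/asboolP | apply/negP => /asboolP].
Qed.

(** * Homogeneous components *)

Section Components.
Variables (V : zmodType) (H : nat -> {pred V}).
Hypothesis dH : direct_decomposition H.

Let H0 m : 0 \in H m. Proof. by case: dH => /(_ m) []. Qed.
Let HB m u v : u \in H m -> v \in H m -> u - v \in H m.
Proof. by case: dH => /(_ m) [_ HB] _ _; apply: HB. Qed.
Let HN m v : v \in H m -> - v \in H m.
Proof. by move=> Hv; rewrite -sub0r; apply: HB. Qed.
Let HD m u v : u \in H m -> v \in H m -> u + v \in H m.
Proof. by move=> Hu Hv; rewrite -[v]opprK; apply: HB => //; apply: HN. Qed.

Lemma sum_ord_widen (f : nat -> V) n N : (n <= N)%N ->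
  (forall i, (n <= i)%N -> f i = 0) -> \sum_(i < N) f i = \sum_(i < n) f i.
Proof.
move=> leN f0; rewrite -!(big_mkord xpredT) (big_cat_nat (n := n)) //=.
rewrite [X in _ + X]big1_seq ?addr0 // => i /andP[_]; rewrite mem_index_iota.
by move=> /andP[le _]; apply: f0.
Qed.

Lemma component_exists v : exists f : nat -> V, (forall i, f i \in H i) /\
  exists n, (forall i, (n <= i)%N -> f i = 0) /\ v = \sum_(i < n) f i.
Proof.
have [_ /(_ v) [n [f [Hf ->]]] _] := dH.
exists (fun i => if (i < n)%N then f i else 0); split=> [i|].
  by case: ifP.
exists n; split=> [i|]; first by rewrite ltnNge => ->.
by apply: eq_bigr => i _; rewrite ltn_ord.
Qed.

(** [cid] picks some decomposition of v; by [hcomp_unique] the choice is immaterial. *)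
Definition hcomp v : nat -> V := sval (cid (component_exists v)).

Lemma hcomp_in v i : hcomp v i \in H i.
Proof. by rewrite /hcomp; case: cid => f []. Qed.

Lemma hcomp_fin v : exists n, forall N, (n <= N)%N ->
  hcomp v N = 0 /\ v = \sum_(i < N) hcomp v i.
Proof.
rewrite /hcomp; case: cid => f /= [Hf [n [f0 ->]]].
by exists n => N leN; rewrite f0 // (sum_ord_widen leN).
Qed.

Lemma hcomp_unique (f : nat -> V) n i : (forall j, f j \in H j) ->
  (forall j, (n <= j)%N -> f j = 0) -> hcomp (\sum_(j < n) f j) i = f i.
Proof.
move=> Hf f0; set v := \sum_(j < n) f j.
have [m vm] := hcomp_fin v; pose N := maxn m (maxn n i.+1).
have [_ ve] := vm N (leq_maxl _ _).
have fe : v = \sum_(j < N) f j by rewrite (@sum_ord_widen f n) // /N; lia.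
have [_ _ ind] := dH.
apply/eqP; rewrite -subr_eq0; apply/eqP.
apply: (ind N (fun j => hcomp v j - f j)).
- by move=> j; apply: HB => //; apply: hcomp_in.
- by rewrite sumrB -ve -fe subrr.
by rewrite /N; lia.
Qed.

Lemma hcompD u v i : hcomp (u + v) i = hcomp u i + hcomp v i.
Proof.
have [n un] := hcomp_fin u; have [m vm] := hcomp_fin v.
pose N := maxn n m.
have [_ eu] := un N (leq_maxl _ _); have [_ ev] := vm N (leq_maxr _ _).
rewrite {1}eu {1}ev -big_split /=.
apply: (@hcomp_unique (fun j => hcomp u j + hcomp v j)) => j.
  by apply: HD; apply: hcomp_in.
rewrite geq_max => /andP[nj mj].
by rewrite (proj1 (un j nj)) (proj1 (vm j mj)) addr0.
Qed.

Lemma hcomp_homog m v i : v \in H m -> hcomp v i = if i == m then v else 0.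
Proof.
move=> Hv; have e : v = \sum_(j < m.+1) (if j == m :> nat then v else 0).
  rewrite -(big_mkord xpredT (fun j => if j == m then v else 0)) big_nat_recr //=.
  rewrite eqxx big1_seq ?add0r // => j /andP[_]; rewrite mem_index_iota /= => lt.
  by case: eqP lt => // ->; rewrite ltnn.
rewrite {1}e (@hcomp_unique (fun j => if j == m then v else 0)) //.
  by move=> j; case: eqP => [->|].
by move=> j; case: eqP => // ->; rewrite ltnn.
Qed.

Lemma hcomp0 i : hcomp 0 i = 0.
Proof. by rewrite (@hcomp_homog i) // eqxx. Qed.

Lemma hcomp_sum (I : Type) (r : seq I) (F : I -> V) i :
  hcomp (\sum_(j <- r) F j) i = \sum_(j <- r) hcomp (F j) i.
Proof.
elim: r => [|j r IH]; first by rewrite !big_nil hcomp0.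
by rewrite !big_cons hcompD IH.
Qed.

Lemma hcomp_sum_shift (f : nat -> V) a n m : (forall j, f j \in H (a + j)%N) -> (m < n)%N ->
  hcomp (\sum_(j < n) f j) m = if (a <= m)%N then f (m - a)%N else 0.
Proof.
move=> Hf ltm; rewrite hcomp_sum.
rewrite (eq_bigr (fun j : 'I_n => if m == (a + j)%N then f j else 0)); last first.
  by move=> j _; apply: hcomp_homog.
case: leqP => [le|lt]; last by rewrite big1 // => j _; case: eqP => // e; lia.
have lta : (m - a < n)%N by lia.
rewrite (bigD1 (Ordinal lta)) //= subnKC // eqxx big1 ?addr0 // => j.
by rewrite -val_eqE /= => /negP ne; case: eqP => // e; case: ne; apply/eqP; lia.
Qed.

Lemma hcomp_eq v m : v \in H m -> hcomp v m = v.
Proof. by move=> Hv; rewrite (hcomp_homog m Hv) eqxx. Qed.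

End Components.

Section GradedScale.
Variables (R : comNzRingType) (G : nat -> {pred R}).
Variables (V : lmodType R) (H : nat -> {pred V}).
Hypothesis dH : direct_decomposition H.
Hypothesis HZ : forall i j a v, a \in G i -> v \in H j -> a *: v \in H (i + j)%N.

Lemma hcompZ i a v m : a \in G i ->
  hcomp dH (a *: v) m = if (i <= m)%N then a *: hcomp dH v (m - i) else 0.
Proof.
move=> Ga; have [n vn] := hcomp_fin dH v.
have [_ {1}->] := vn (maxn n m.+1) (leq_maxl _ _).
rewrite scaler_sumr (@hcomp_sum_shift _ _ dH (fun j => a *: hcomp dH v j) i) ?leq_maxr //.
by move=> j; apply: HZ => //; apply: hcomp_in.
Qed.

End GradedScale.

(** * Graded families of subspaces *)

Section Subspaces.
Variables (k : fieldType) (R : comAlgType k).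

Section Subspace.
Variable V : lmodType R.
Implicit Types (X Y W T : set V).

Definition ksub W := @submod k (restrict_scalars k R V) W.
Definition kfin W := @fin k (restrict_scalars k R V) W.
Definition klen W := @len k (restrict_scalars k R V) W.
Definition krel X T := @rlen k (restrict_scalars k R V) X T.

Lemma submod_ksub W : submod W -> ksub W.
Proof. by move=> [W0 WP]; split=> // c u v; apply: WP. Qed.

Lemma ksub0 W : ksub W -> W 0. Proof. by case. Qed.
Lemma ksubD W u v : ksub W -> W u -> W v -> W (u + v).
Proof. exact: submodD. Qed.
Lemma ksubZ W (c : k) u : ksub W -> W u -> W (c%:A *: u).
Proof. exact: submodZ. Qed.
Lemma ksubB W u v : ksub W -> W u -> W v -> W (u - v).
Proof. exact: submodB. Qed.
Lemma ksubDr W u v : ksub W -> W u -> W (v + u) -> W v.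
Proof. exact: submodDr. Qed.
Lemma ksubBr W u v : ksub W -> W u -> W (v - u) -> W v.
Proof. exact: submodBr. Qed.
Lemma ksub_sum W (I : Type) (r : seq I) (F : I -> V) :
  ksub W -> (forall i, W (F i)) -> W (\sum_(i <- r) F i).
Proof. exact: (@submod_sum k (restrict_scalars k R V)). Qed.
Lemma ksub_set0 : ksub [set 0]. Proof. exact: submod_set0. Qed.
Lemma ksubI X Y : ksub X -> ksub Y -> ksub (X `&` Y).
Proof. exact: submodI. Qed.
Lemma ksub_sumset X Y : ksub X -> ksub Y -> ksub (X :+: Y).
Proof. exact: submod_sumset. Qed.
Lemma ksub_subl X Y : ksub Y -> X `<=` X :+: Y.
Proof. exact: sumset_subl. Qed.
Lemma ksub_subr X Y : ksub X -> Y `<=` X :+: Y.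
Proof. exact: sumset_subr. Qed.
Lemma ksub_min X Y W : ksub W -> X `<=` W -> Y `<=` W -> X :+: Y `<=` W.
Proof. exact: sumset_min. Qed.
Lemma ksub_absorb X Y : ksub X -> ksub Y -> X `<=` Y -> X :+: Y = Y.
Proof. exact: sumset_absorb. Qed.
Lemma ksub_modular X Y Z : ksub Z -> X `<=` Z ->
  (X :+: Y) `&` Z = X :+: (Y `&` Z).
Proof. exact: sumset_modular. Qed.
Lemma kfin_sub W W' : ksub W -> W `<=` W' -> kfin W' -> kfin W.
Proof. exact: fin_sub. Qed.
Lemma kfin_ksub W : kfin W -> ksub W. Proof. by case. Qed.
Lemma kfin_set0 : kfin [set 0]. Proof. exact: fin_set0. Qed.
Lemma kfin_sumset X Y : kfin X -> kfin Y -> kfin (X :+: Y).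
Proof. exact: fin_sumset. Qed.
Lemma krel_cap X T Z : X `<=` Z -> krel X T = krel X (T `&` Z).
Proof. exact: (@rlen_cap k (restrict_scalars k R V) X T Z). Qed.
Lemma krel_subr X T T' : kfin X -> ksub T -> ksub T' -> T `<=` T' ->
  (krel X T' <= krel X T)%N.
Proof. exact: (@rlen_subr k (restrict_scalars k R V)). Qed.
Lemma krel_subset X T : X `<=` T -> krel X T = 0%N.
Proof. exact: (@rlen_subset k (restrict_scalars k R V)). Qed.
Lemma krel_subl X X' T : kfin X -> kfin X' -> ksub T ->
  X `<=` X' :+: T -> (krel X T <= krel X' T)%N.
Proof. exact: (@rlen_subl k (restrict_scalars k R V)). Qed.
Lemma krel_sumset X Y T : kfin X -> kfin Y -> ksub T ->
  krel (X :+: Y) T = (krel Y T + krel X (Y :+: T))%N.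
Proof. exact: (@rlen_sumset k (restrict_scalars k R V)). Qed.
Lemma krel_subadd X Y T : kfin X -> kfin Y -> ksub T ->
  (krel (X :+: Y) T <= krel X T + krel Y T)%N.
Proof. exact: (@rlen_subadd k (restrict_scalars k R V)). Qed.
Lemma krel_cap_modular X S T : kfin X -> ksub S -> ksub T ->
  S `<=` X -> T `<=` X ->
  (krel X (S `&` T) + krel X (S :+: T) = krel X S + krel X T)%N.
Proof. exact: (@rlen_cap_modular k (restrict_scalars k R V)). Qed.

Lemma krel_set0 T : ksub T -> krel [set 0] T = 0%N.
Proof. by move=> sT; apply: krel_subset => _ ->; apply: ksub0. Qed.

Lemma kfin_line x : kfin (range (fun c : k => (c%:A : R) *: x)).
Proof.
have st : @simple_step k (restrict_scalars k R V) [set 0]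
    ([set 0] :+: range (fun c : k => c *: (x : restrict_scalars k R V))).
  apply: simple_step_cyclic; first exact: submod_set0.
  move=> b bx; exists b^-1; have b0 : b != 0.
    by apply/eqP => b0; apply: bx; rewrite b0 scale0r.
  by rewrite scalerA mulVf // scale1r /= subrr.
rewrite sumset0l in st.
have sl : ksub (range (fun c : k => (c%:A : R) *: x)).
  split; first by exists 0 => //; rewrite !scale0r.
  move=> c _ _ [b _ <-] [b' _ <-]; exists (c * b + b') => //.
  by rewrite !scalerDl /GRing.scale /= /restrict_scale scalerA -scalerAl mul1r scalerA.
split=> //.
exists (fun i => if i is 0%N then [set 0] else range (fun c : k => (c%:A : R) *: x)), 1%N.
by split=> //; split=> // [[|i]|[|i]] //; apply: submod_set0.
Qed.

Lemma klenE (K : realType) (W : {pred (restrict_scalars k R V)}) X :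
  (forall x, x \in W <-> X x) -> kfin X ->
  submodule_length K W = (klen X)%:R%:E.
Proof. exact: submodule_lengthE. Qed.

End Subspace.

Section Map.
Variables (V U : lmodType R) (f : V -> U).
Hypothesis lf : linear f.

Let lkf : @GRing.linear_for k (restrict_scalars k R V) (restrict_scalars k R U) *:%R f.
Proof. by move=> c u v; apply: lf. Qed.

Lemma ksub_image (W : set V) : ksub W -> ksub (f @` W).
Proof. exact: (submod_image lkf). Qed.
Lemma ksub_preimage (W : set U) : ksub W -> ksub (f @^-1` W).
Proof. exact: (submod_preimage lkf). Qed.
Lemma kfin_image (W : set V) : kfin W -> kfin (f @` W).
Proof. exact: (fin_image lkf). Qed.
Lemma krel_image X (T : set U) : kfin X -> ksub T ->
  krel (f @` X) T = krel X (f @^-1` T).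
Proof. exact: (rlen_image lkf). Qed.
Lemma krel_image_le X (T : set V) (T' : set U) : kfin X -> ksub T -> ksub T' ->
  T `<=` f @^-1` T' -> (krel (f @` X) T' <= krel X T)%N.
Proof. exact: (rlen_image_le lkf). Qed.
Lemma krank_nullity (W : set V) : kfin W ->
  klen W = (klen (f @` W) + klen (W `&` [set x | f x = 0%R]))%N.
Proof. exact: (rank_nullity lkf). Qed.
End Map.

End Subspaces.

Section Families.
Variables (k : fieldType) (R : comAlgType k) (G : nat -> {pred R}).
Hypothesis hR : standard_graded G.

Definition piece m : set R^o := [set x | x \in G m].

Lemma piece_direct : direct_decomposition G. Proof. exact: sg_direct hR. Qed.

Lemma piece_scalar (c : k) : c%:A \in G 0%N.
Proof. by apply/(sg_degree0 hR); exists c. Qed.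

Lemma piece1 : 1 \in G 0%N.
Proof. by have := piece_scalar 1; rewrite scale1r. Qed.

Lemma pieceM i j x y : x \in G i -> y \in G j -> x * y \in G (i + j)%N.
Proof. exact: sg_mul. Qed.

Lemma pieceX i x n : x \in G i -> x ^+ n \in G (n * i)%N.
Proof.
move=> Gx; elim: n => [|n IH]; first by rewrite expr0 piece1.
by rewrite exprS mulSn pieceM.
Qed.

Lemma graded_self : @graded_module R G R^o G.
Proof. by split; [exact: piece_direct | move=> i j a v; apply: pieceM]. Qed.

Section Shift.
Variable V : zmodType.

(* The family F(-a). *)
Definition sh a (F : nat -> set V) m : set V :=
  if (a <= m)%N then F (m - a)%N else [set 0].

Lemma sh0 F : sh 0 F = F.
Proof. by apply/funext => m; rewrite /sh subn0. Qed.

Lemma sh_sh a b F : sh a (sh b F) = sh (a + b) F.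
Proof.
apply/funext => m; rewrite /sh; case: leqP => le; last by rewrite ifF //; lia.
by rewrite subnDA; case: ifP; case: ifP => //; lia.
Qed.

Lemma sh_id a F m : sh a F (m + a) = F m.
Proof. by rewrite /sh leq_addl addnK. Qed.

Lemma sh_sub a F F' m : (forall m, F m `<=` F' m) -> sh a F m `<=` sh a F' m.
Proof. by move=> FF x; rewrite /sh; case: ifP => // _; apply: FF. Qed.

End Shift.

Section GradedFamily.
Variable V : lmodType R.
Implicit Types F H L : nat -> set V.

(** A graded submodule, given by its homogeneous parts. No grading of V is required, so the notion
    also applies to the Frobenius pushforward, where only the degrees are reindexed. *)
Definition gfam F := (forall m, ksub (F m)) /\
  forall i j b v, b \in G i -> F j v -> F (i + j)%N (b *: v).

Definition fadd F F' m := F m :+: F' m.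
Definition smul (x : R) (X : set V) : set V := [set x *: v | v in X].
(** The degree m part of Rv, with v placed in degree a. *)
Definition cyc a (v : V) m : set V := [set (b : R) *: v | b in sh a piece m].

Lemma gfam_ksub F m : gfam F -> ksub (F m). Proof. by case. Qed.

Lemma gfamZ F i m b v : gfam F -> b \in G i -> (i <= m)%N ->
  F (m - i)%N v -> F m (b *: v).
Proof. by move=> [_ FP] Gb le Fv; rewrite -(subnKC le); apply: FP. Qed.

Lemma gfam0 F m : gfam F -> F m 0.
Proof. by case=> sF _; apply: ksub0 (sF m). Qed.

Lemma linear_smul (x : R) : linear (fun v : V => x *: v).
Proof. by move=> a u v; rewrite scalerDr !scalerA mulrC. Qed.

Lemma linear_act (v : V) : linear (fun b : R^o => (b : R) *: v).
Proof. by move=> a b c; rewrite scalerDl scalerA. Qed.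

Lemma ksub_smul x X : ksub X -> ksub (smul x X).
Proof. by move=> sX; apply: (ksub_image (linear_smul x) sX). Qed.

Lemma kfin_smul x X : kfin X -> kfin (smul x X).
Proof. by move=> sX; apply: (kfin_image (linear_smul x) sX). Qed.

Lemma ksub_sh a F m : (forall m, ksub (F m)) -> ksub (sh a F m).
Proof. by move=> sF; rewrite /sh; case: ifP => // _; apply: ksub_set0. Qed.

Lemma kfin_sh a F m : (forall m, kfin (F m)) -> kfin (sh a F m).
Proof. by move=> sF; rewrite /sh; case: ifP => // _; apply: kfin_set0. Qed.

Lemma gfam_sh a F : gfam F -> gfam (sh a F).
Proof.
move=> [sF FP]; split=> [m|i j b v Gb]; first exact: ksub_sh.
rewrite /sh; case: leqP => [le Fv|lt ->].
  by rewrite ifT; [rewrite -addnBA //; apply: FP | lia].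
by rewrite scaler0; case: ifP => // _; apply: ksub0.
Qed.

Lemma gfam_fadd F F' : gfam F -> gfam F' -> gfam (fadd F F').
Proof.
move=> [sF FP] [sF' FP']; split=> [m|i j b _ Gb [v [v' [Fv Fv' ->]]]].
  exact: ksub_sumset.
by exists (b *: v), (b *: v'); split; [exact: FP|exact: FP'|rewrite scalerDr].
Qed.

Lemma gfam_smul x F : gfam F -> gfam (fun m => smul x (F m)).
Proof.
move=> [sF FP]; split=> [m|i j b _ Gb [v Fv <-]]; first exact: ksub_smul.
by exists (b *: v); [exact: FP | rewrite !scalerA mulrC].
Qed.

End GradedFamily.

Definition hpiece (V : lmodType R) (H : nat -> {pred V}) m : set V := [set x | x \in H m].

Lemma gfam_hpiece (V : lmodType R) (H : nat -> {pred V}) :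
  graded_module G H -> gfam (hpiece H).
Proof.
move=> [[Hz _ _] HZ]; split=> [m|i j b v Gb Hv]; last exact: HZ.
have [H0 HB] := Hz m.
have HN x : x \in H m -> - x \in H m by move=> Hx; rewrite -sub0r; apply: HB.
split=> // c u v Hu Hv; rewrite /hpiece /= -[v]opprK; apply: HB; last exact: HN.
by have := HZ _ _ _ _ (piece_scalar c) Hu.
Qed.

Lemma gfam_piece : gfam piece. Proof. exact: gfam_hpiece graded_self. Qed.

Section CyclicFamily.
Variable V : lmodType R.
Implicit Types F H L : nat -> set V.

Lemma gfam_cyc a (v : V) : gfam (cyc a v).
Proof.
have [sF FP] := gfam_sh a gfam_piece.
split=> [m|i j b _ Gb [x Gx <-]].
  exact: ksub_image (linear_act v) _ (sF m).
by exists (b * x); [exact: FP | rewrite scalerA].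
Qed.

Lemma cyc_gen a (v : V) : cyc a v a v.
Proof. by exists 1; rewrite ?scale1r // /sh leqnn subnn; apply: piece1. Qed.

Lemma cyc_sub F a (v : V) : gfam F -> F a v -> forall m, cyc a v m `<=` F m.
Proof.
move=> gF Fv m _ [b + <-]; rewrite /sh; case: leqP => [le Gb|_ ->]; last first.
  by rewrite scale0r; apply: gfam0.
by rewrite -(subnK le); apply: (proj2 gF).
Qed.

Lemma krel_cyc a (v : V) m T : (forall m, kfin (piece m)) -> ksub T ->
  krel (cyc a v m) T = krel (sh a piece m) [set b | T ((b : R) *: v)].
Proof. by move=> fG sT; apply: (krel_image (linear_act v)) => //; apply: kfin_sh. Qed.

(* For I generated by the x_i of degree d_i, fs being the list of the (d_i, x_i):
   the degree m part of I^[q] F. Lemma names abbreviate this family as J. *)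
Definition powers_fam (fs : seq (nat * R)) q F m : set V :=
  foldr (fun df S => smul (df.2 ^+ q) (sh (q * df.1) F m) :+: S) [set 0] fs.

Definition homog_seq (fs : seq (nat * R)) := forall df, df \in fs -> df.2 \in G df.1.

Lemma homog_seq_cons df fs : homog_seq (df :: fs) ->
  df.2 \in G df.1 /\ homog_seq fs.
Proof.
move=> h; split; first by apply: h; rewrite mem_head.
by move=> e efs; apply: h; rewrite inE efs orbT.
Qed.

Lemma ksub_J fs q F m : gfam F -> ksub (powers_fam fs q F m).
Proof.
move=> gF; elim: fs => [|df fs IH]; first exact: ksub_set0.
apply: ksub_sumset => //; apply: ksub_smul.
exact: gfam_ksub (gfam_sh _ gF).
Qed.

Lemma gfam_J fs q F : gfam F -> gfam (powers_fam fs q F).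
Proof.
move=> gF; elim: fs => [|df fs IH].
  split=> [m|i j b v _ ->]; first exact: ksub_set0.
  by rewrite scaler0.
exact: gfam_fadd (gfam_smul _ (gfam_sh _ gF)) IH.
Qed.

Lemma kfin_J fs q F m : (forall m, kfin (F m)) -> kfin (powers_fam fs q F m).
Proof.
move=> gF; elim: fs => [|df fs IH]; first exact: kfin_set0.
by apply: kfin_sumset => //; apply: kfin_smul; apply: kfin_sh.
Qed.

Lemma J_sub fs q F m : homog_seq fs -> gfam F -> powers_fam fs q F m `<=` F m.
Proof.
move=> + gF; elim: fs => [_ _ ->|df fs IH /homog_seq_cons[Gf /IH {}IH]].
  exact: gfam0.
apply: ksub_min => //; first exact: gfam_ksub.
move=> _ [v + <-]; rewrite /sh; case: leqP => [le Fv|_ ->].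
  by apply: gfamZ le Fv => //; apply: pieceX.
by rewrite scaler0; apply: gfam0.
Qed.

Lemma J_mono fs q F F' m : (forall m, F m `<=` F' m) ->
  powers_fam fs q F m `<=` powers_fam fs q F' m.
Proof.
move=> FF; elim: fs => // df fs IH; apply: sumsetS => //.
by apply: image_subset; apply: sh_sub.
Qed.

Lemma smul_sumset x X Y : smul x (X :+: Y) = smul x X :+: smul x (Y : set V).
Proof. exact: image_sumset (linear_smul x) _ _. Qed.

Lemma sh_fadd a F F' m : sh a (fadd F F') m = sh a F m :+: sh a F' m.
Proof. by rewrite /sh; case: ifP => // _; rewrite sumset0. Qed.

Lemma J_fadd fs q F F' m :
  powers_fam fs q (fadd F F') m = powers_fam fs q F m :+: powers_fam fs q F' m.
Proof.
elim: fs => [|df fs IH] /=; first by rewrite sumset0.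
rewrite IH sh_fadd smul_sumset -!sumsetA; congr (_ :+: _).
by rewrite !sumsetA; congr (_ :+: _); rewrite sumsetC.
Qed.

Lemma sh_J fs q a F m : sh a (powers_fam fs q F) m = powers_fam fs q (sh a F) m.
Proof.
elim: fs => [|df fs IH] /=; first by rewrite /sh; case: ifP.
rewrite -IH sh_sh addnC -sh_sh /sh; case: ifP => //= _.
by rewrite /smul image_set1 scaler0 sumset0.
Qed.

End CyclicFamily.

Lemma J_image (V U : lmodType R) (f : V -> U) fs q (F : nat -> set V) m :
  linear f -> powers_fam fs q (fun m => f @` F m) m = f @` powers_fam fs q F m.
Proof.
move=> lf; have f0 := linear_fun0 lf.
have fZ a v : f (a *: v) = a *: f v by have := lf a v 0; rewrite f0 !addr0.
elim: fs => [|df fs IH] /=; first by rewrite image_set1 f0.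
rewrite IH (image_sumset lf); congr (_ :+: _).
have -> : sh (q * df.1) (fun m0 => f @` F m0) m = f @` sh (q * df.1) F m.
  by rewrite /sh; case: ifP => // _; rewrite image_set1 f0.
apply/seteqP; split=> [_ [_ [v Fv <-] <-]|_ [_ [v Fv <-] <-]].
  by exists (df.2 ^+ q *: v); [exists v | rewrite fZ].
by exists (f v); [exists v | rewrite fZ].
Qed.

Lemma J_cyc (V : lmodType R) fs q a (v : V) m :
  powers_fam fs q (cyc a v) m = [set (b : R) *: v | b in sh a (powers_fam fs q piece) m].
Proof. by rewrite (J_image _ _ _ _ (linear_act v)) sh_J. Qed.

End Families.

(** * Spans and homogeneous generators *)

Section Sums.
Variables (k : fieldType) (R : comAlgType k) (V : lmodType R) (T : eqType).
Implicit Types (f : T -> set V) (s : seq T).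

Definition sums f s : set V := foldr (fun x S => f x :+: S) [set 0] s.

Lemma ksub_sums f s : (forall x, ksub (f x)) -> ksub (sums f s).
Proof.
by move=> sf; elim: s => [|x s IH]; [exact: ksub_set0 | exact: ksub_sumset].
Qed.

Lemma kfin_sums f s : (forall x, kfin (f x)) -> kfin (sums f s).
Proof.
by move=> sf; elim: s => [|x s IH]; [exact: kfin_set0 | exact: kfin_sumset].
Qed.

Lemma sums_sub f s x : (forall x, ksub (f x)) -> x \in s -> f x `<=` sums f s.
Proof.
move=> sf; elim: s => // y s IH; rewrite inE => /predU1P[<-|xs].
  by apply: ksub_subl; apply: ksub_sums.
by apply: subset_trans (IH xs) _; apply: ksub_subr.
Qed.

Lemma sums_min f s W : ksub W -> (forall x, x \in s -> f x `<=` W) ->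
  sums f s `<=` W.
Proof.
move=> sW; elim: s => [_ _ ->|x s IH fW]; first exact: ksub0.
apply: ksub_min => //; first by apply: fW; rewrite mem_head.
by apply: IH => y ys; apply: fW; rewrite inE ys orbT.
Qed.

End Sums.

Section Span.
Variables (R : comNzRingType) (V : lmodType R).

Definition lin (s : seq V) : set V :=
  foldr (fun x S => range (fun a : R => a *: x) :+: S) [set 0] s.

Lemma submod_line (x : V) : submod (range (fun a : R => a *: x)).
Proof.
split; first by exists 0; rewrite ?scale0r.
by move=> a _ _ [b _ <-] [c _ <-]; exists (a * b + c); rewrite ?scalerDl ?scalerA.
Qed.

Lemma submod_lin s : submod (lin s).
Proof.
elim: s => [|x s IH]; first exact: submod_set0.
by apply: submod_sumset => //; apply: submod_line.
Qed.

Lemma lin_mem s x : x \in s -> lin s x.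
Proof.
elim: s => // y s IH; rewrite inE => /predU1P[<-|xs] /=.
  by apply: sumset_subl; [exact: submod_lin | exists 1; rewrite ?scale1r].
by apply: sumset_subr; [exact: submod_line | exact: IH].
Qed.

Lemma lin_min s W : submod W -> (forall x, x \in s -> W x) -> lin s `<=` W.
Proof.
move=> sW; elim: s => [_ _ ->|x s IH sub]; first exact: submod0.
apply: sumset_min => //.
  by move=> _ [a _ <-]; apply: submodZ => //; apply: sub; rewrite mem_head.
by apply: IH => y ys; apply: sub; rewrite inE ys orbT.
Qed.

Lemma span_of_min (S : set V) (W : set V) x : submod W -> S `<=` W ->
  x \in span_of S -> W x.
Proof.
move=> [W0 WP] SW /span_ofP/(_ (fun y => `[< W y >])) H; apply/asboolP/H.
  split; first exact/asboolP.
  by move=> a u v /asboolP Wu /asboolP Wv; apply/asboolP/WP.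
by move=> y /SW Wy; apply/asboolP.
Qed.

Lemma span_of_gen (S : set V) x : S x -> x \in span_of S.
Proof. by move=> Sx; apply/span_ofP => N _; apply. Qed.

Lemma span_of_lin (s : seq V) x : x \in span_of [set` s] <-> lin s x.
Proof.
split; first by apply: span_of_min; [exact: submod_lin | exact: lin_mem].
have [s0 sP] := span_of_closed [set` s].
apply: (@lin_min s [set y | y \in span_of [set` s]]) => [|y ys]; first by split.
exact: span_of_gen.
Qed.

Lemma lin_catl s t x : lin s x -> lin (s ++ t) x.
Proof.
by apply: lin_min; [exact: submod_lin | move=> y ys; apply: lin_mem; rewrite mem_cat ys].
Qed.

Lemma lin_catr s t x : lin t x -> lin (s ++ t) x.
Proof.
by apply: lin_min; [exact: submod_lin | move=> y ys; apply: lin_mem; rewrite mem_cat ys orbT].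
Qed.

Lemma span_of_finite (S : set V) x : x \in span_of S ->
  exists2 l : seq V, (forall y, y \in l -> S y) & lin l x.
Proof.
pose W : set V := [set x | exists2 l : seq V, (forall y, y \in l -> S y) & lin l x].
apply: (span_of_min (W := W)).
  split; first by exists [::].
  move=> a u v [l lS lu] [l' lS' lv]; exists (l ++ l').
    by move=> y; rewrite mem_cat => /orP[/lS|/lS'].
  by apply: (proj2 (submod_lin _)); [exact: lin_catl | exact: lin_catr].
move=> y Sy; exists [:: y]; last by apply: lin_mem; rewrite mem_head.
by move=> z; rewrite inE => /eqP->.
Qed.

Lemma span_of_finite_seq (S : set V) (s : seq V) : (forall y, y \in s -> y \in span_of S) ->
  exists2 l : seq V, (forall x, x \in l -> S x) & forall y, y \in s -> lin l y.
Proof.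
elim: s => [|y s IH] sS; first by exists [::].
have [l lS ly] := span_of_finite (sS y (mem_head _ _)).
have [|l' lS' ls] := IH; first by move=> z zs; apply: sS; rewrite inE zs orbT.
exists (l ++ l') => [x|z]; first by rewrite mem_cat => /orP[/lS|/lS'].
by rewrite inE => /predU1P[->|/ls lz]; [exact: lin_catl | exact: lin_catr].
Qed.

End Span.

Section Generation.
Variables (k : fieldType) (R : comAlgType k) (G : nat -> {pred R}).
Hypothesis hR : standard_graded G.

Local Notation dG := (piece_direct hR).

Section GradedModule.
Variables (V : lmodType R) (H : nat -> {pred V}).
Hypothesis dH : direct_decomposition H.
Hypothesis HZ : forall i j a v, a \in G i -> v \in H j -> a *: v \in H (i + j)%N.

Definition gens (l : seq (nat * V)) m : set V :=
  sums (fun av => cyc G av.1 av.2 m) l.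

Lemma hcompZr a (b : R) v m : v \in H a ->
  hcomp dH (b *: v) m = if (a <= m)%N then hcomp dG b (m - a) *: v else 0.
Proof.
move=> Hv; have [n bn] := hcomp_fin dG b.
have [_ {1}->] := bn (maxn n m.+1) (leq_maxl _ _).
rewrite scaler_suml (@hcomp_sum_shift _ _ dH (fun j => hcomp dG b j *: v) a) ?leq_maxr //.
by move=> j; rewrite addnC; apply: HZ => //; apply: hcomp_in.
Qed.

Lemma ksub_gens l m : ksub (gens l m).
Proof. by apply: ksub_sums => -[a v]; case: (gfam_cyc hR a v). Qed.

Lemma gfam_gens l : gfam G (gens l).
Proof.
split=> [m|i j b v Gb]; first exact: ksub_gens.
elim: l v => [v -> |av l IH _ [u [w [Fu Fw ->]]]]; first by rewrite scaler0.
exists (b *: u), (b *: w); rewrite scalerDr; split=> //; last exact: IH.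
by apply: (proj2 (gfam_cyc hR _ _)).
Qed.

Lemma lin_gens l y m : (forall av, av \in l -> av.2 \in H av.1) ->
  lin [seq av.2 | av <- l] y -> gens l m (hcomp dH y m).
Proof.
elim: l y => [y _ /= -> |av l IH y Hl /= [_ [y' [[b _ <-] ly' ->]]]].
  by rewrite hcomp0.
have Hv : av.2 \in H av.1 by apply: Hl; rewrite mem_head.
rewrite hcompD (hcompZr _ _ Hv).
exists (if (av.1 <= m)%N then hcomp dG b (m - av.1) *: av.2 else 0), (hcomp dH y' m).
split=> //; last by apply: IH => // bw bwl; apply: Hl; rewrite inE bwl orbT.
rewrite /cyc /sh; case: ifP => _; last by exists 0; rewrite ?scale0r.
by exists (hcomp dG b (m - av.1)) => //; apply: hcomp_in.
Qed.

Lemma homogeneous_gens (s : seq V) : exists l,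
  (forall av, av \in l -> exists2 y, y \in s & av.2 = hcomp dH y av.1) /\
  forall y m, lin s y -> gens l m (hcomp dH y m).
Proof.
have [l [Hl sl]] : exists l : seq (nat * V),
    (forall av, av \in l -> exists2 y, y \in s & av.2 = hcomp dH y av.1) /\
    forall y, y \in s -> lin [seq av.2 | av <- l] y.
  elim: s => [|x s [l [Hl sl]]]; first by exists [::].
  have [n xn] := hcomp_fin dH x; have [_ xe] := xn n (leqnn n).
  exists ([seq (i, hcomp dH x i) | i <- iota 0 n] ++ l); split.
    move=> av; rewrite mem_cat => /orP[/mapP[i _ ->]|/Hl[y ys e]].
      by exists x => //; rewrite mem_head.
    by exists y => //; rewrite inE ys orbT.
  move=> y; rewrite inE map_cat => /predU1P[->|ys].
    rewrite [X in lin _ X]xe; apply: submod_sum => [|i]; first exact: submod_lin.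
    apply: lin_mem; rewrite mem_cat -map_comp; apply/orP; left.
    by apply/mapP; exists (i : nat) => //; rewrite mem_iota /= add0n.
  exact/lin_catr/sl.
exists l; split=> // y m ly; apply: lin_gens.
  by move=> av /Hl[z _ ->]; apply: hcomp_in.
by apply: lin_min ly => //; exact: submod_lin.
Qed.

End GradedModule.

Lemma hcompM (x y : R) m :
  hcomp dG (x * y) m = \sum_(i < m.+1) hcomp dG x i * hcomp dG y (m - i).
Proof.
have [n xn] := hcomp_fin dG x.
have [_ {1}->] := xn (maxn n m.+1) (leq_maxl _ _).
rewrite mulr_suml hcomp_sum.
rewrite (eq_bigr (fun i : 'I_(maxn n m.+1) =>
    if (i <= m)%N then hcomp dG x i * hcomp dG y (m - i) else 0)); last first.
  by move=> i _; exact: (@hcompZ R G R^o G dG (proj2 (graded_self hR)) _ _ y m (hcomp_in dG x i)).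
rewrite (@sum_ord_widen _ (fun i =>
    if (i <= m)%N then hcomp dG x i * hcomp dG y (m - i) else 0) m.+1).
- by apply: eq_bigr => i _; rewrite -ltnS ltn_ord.
- lia.
by move=> i lt; rewrite leqNgt lt.
Qed.

(** Generators of the ideal spanned by R_1 can be taken in R_1; in degree 1 their coefficients have
    degree 0, so they span R_1 over k. Quantifying over subspaces W avoids enumerating the
    monomials. *)
Lemma piece_span : exists xs : seq R, (forall x, x \in xs -> x \in G 1%N) /\
  forall N (W : set R^o), ksub W ->
    (forall s : seq R, {subset s <= xs} -> size s = N -> W (\prod_(x <- s) x)) ->
    piece G N `<=` W.
Proof.
have [xs [Gxs G1xs]] : exists xs : seq R^o, (forall x, x \in xs -> piece G 1 x) /\
    piece G 1 `<=` lin xs.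
  have [s sE] := sg_noetherian hR (span_of (piece G 1)).
  have [xs Gxs sxs] : exists2 xs : seq R^o, (forall x, x \in xs -> piece G 1 x) &
      forall y, y \in s -> lin xs y.
    by apply: span_of_finite_seq => y ys; rewrite sE; apply: span_of_gen.
  exists xs; split=> // y Gy.
  apply: (@span_of_min R R^o [set` s]) => //; first exact: submod_lin.
  by rewrite -sE; apply: span_of_gen.
exists xs; split=> //.
pose prods i : set R^o := [set r | forall W : set R^o, ksub W ->
  (forall s : seq R, {subset s <= xs} -> size s = i -> W (\prod_(x <- s) x)) -> W r].
have sprods i : ksub (prods i).
  split=> [W sW _|c u v pu pv W sW WP]; first exact: ksub0 sW.
  by apply: (ksubD sW); [apply: (ksubZ c sW); apply: pu | apply: pv].
have prodsM i j a b : prods i a -> prods j b -> prods (i + j)%N (a * b).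
  move=> pa pb W sW WP.
  apply: (pa [set a | W ((a : R) * b)]) => [|s sxs si].
    split; first by rewrite /= mul0r; apply: (ksub0 sW).
    move=> c u v Wu Wv; rewrite /= mulrDl; apply: (ksubD sW) => //.
    rewrite -[X in W X](_ : c%:A *: ((u : R) * b : R^o) = _); first exact: (ksubZ c sW).
    by rewrite /GRing.scale /= /restrict_scale /GRing.scale /= mulrA.
  apply: (pb [set b | W ((\prod_(x <- s) x) * (b : R))]) => [|t txs tj].
    split; first by rewrite /= mulr0; apply: (ksub0 sW).
    move=> c u v Wu Wv; rewrite /= mulrDr; apply: (ksubD sW) => //.
    rewrite -[X in W X](_ : c%:A *: ((\prod_(x <- s) x) * (u : R) : R^o) = _).
      exact: (ksubZ c sW).
    by rewrite /GRing.scale /= /restrict_scale /GRing.scale /= mulrCA.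
  rewrite /= -big_cat; apply: WP; last by rewrite size_cat si tj.
  by move=> x; rewrite mem_cat => /orP[/sxs|/txs].
have prods1 : prods 0%N 1.
  by move=> W sW WP; have := WP [::]; rewrite big_nil; apply.
have p0 a : a \in G 0%N -> prods 0%N a.
  move=> /(sg_degree0 hR)[c ->].
  have := ksubZ c (sprods 0%N) prods1.
  by rewrite /GRing.scale /= mulr1.
have p1 y : y \in G 1%N -> prods 1%N y.
  move=> Gy; have := G1xs y Gy.
  move=> ly.
  have := @lin_gens R^o G dG (proj2 (graded_self hR)) [seq (1%N, x) | x <- xs] y 1.
  rewrite -map_comp map_id hcomp_eq // => H.
  apply: (sums_min (sprods 1%N)) (H _ ly); last by move=> _ /mapP[x xxs ->]; exact: Gxs.
  move=> _ /mapP[x xxs ->] _ [b + <-].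
  rewrite /sh /= subnn => /p0 pb; rewrite -[1%N]add0n; apply: prodsM => //.
  move=> W sW WP; have := WP [:: x]; rewrite big_seq1; apply=> //.
  by move=> z; rewrite inE => /eqP->.
(* The elements whose degree i component is a combination of monomials of length i, for all i, form
   a subalgebra containing R_1, hence all of R. *)
pose S : {pred R} := fun r => `[< forall i, prods i (hcomp dG r i) >].
have Salg : GRing.subalg_closed S.
  split.
  - apply/asboolP => i; rewrite (hcomp_homog dG i (piece1 hR)).
    by case: eqP => [->//|_]; apply: ksub0 (sprods i).
  - move=> c u v /asboolP Su /asboolP Sv; apply/asboolP => i; rewrite hcompD.
    apply: (ksubD (sprods i)) => //.
    have := hcompM c%:A u i; rewrite -scalerAl mul1r => ->.
    rewrite big_ord_recl big1 ?addr0 => [|j _]; last first.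
      by rewrite (hcomp_homog dG _ (piece_scalar hR c)) mul0r.
    by rewrite subn0 (hcomp_eq dG (piece_scalar hR c)); apply: (ksubZ c (sprods i)).
  move=> u v /asboolP Su /asboolP Sv; apply/asboolP => i; rewrite hcompM.
  apply: (ksub_sum _ (sprods i)) => j.
  rewrite -[X in prods X](@subnKC j i); first exact: prodsM.
  by rewrite -ltnS.
have SG : {subset G 1%N <= S}.
  move=> y Gy; apply/asboolP => i; rewrite (hcomp_homog dG i Gy).
  by case: eqP => [->|_]; [exact: p1 | exact: ksub0 (sprods i)].
move=> N W sW WP r Gr; have /asboolP/(_ N) := sg_generated hR Salg SG r.
by rewrite hcomp_eq // => /(_ W sW WP).
Qed.

End Generation.

Definition pset (R : comNzRingType) (P : spectrum R) : set R^o := [set x | x \in P].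

(** * Prime filtrations *)

Section Noetherian.
Variables (k : fieldType) (R : comAlgType k) (G : nat -> {pred R}).
Hypothesis hR : standard_graded G.

Local Notation dG := (piece_direct hR).
Implicit Types P : spectrum R.
Local Notation piece := (piece G).
Local Notation cyc := (cyc G).
Local Notation gfam := (gfam G).

Definition kline (V : lmodType R) (x : V) : set V := range (fun c : k => (c%:A : R) *: x).

Lemma kline_mem (V : lmodType R) (x : V) : kline x x.
Proof. by exists 1; rewrite ?scale1r. Qed.

Lemma ksub_kline (V : lmodType R) (x : V) : ksub (kline x).
Proof. exact/kfin_ksub/kfin_line. Qed.

Lemma piece_spanning N : exists l : seq R^o, (forall g, g \in l -> piece N g) /\
  piece N `<=` sums (@kline R^o) l.
Proof.
have [xs [Gxs xsP]] := piece_span hR.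
pose fix prods n : seq R := if n is n'.+1 then [seq x * g | x <- xs, g <- prods n'] else [:: 1].
exists (prods N); split.
  elim: N => [g|N IH g /allpairsP[[x y] /= [/Gxs Gx /IH Gy ->]]].
    by rewrite inE => /eqP->; apply: piece1.
  exact: (pieceM hR Gx Gy).
apply: xsP => [|s sxs sN]; first by apply: ksub_sums; apply: ksub_kline.
apply: (@sums_sub _ _ R^o _ _ _ (\prod_(x <- s) x)); last exact: kline_mem.
  by move=> x; exact: (@ksub_kline R^o x).
elim: N s sxs sN => [|N IH] [|x s] sxs //= sN; first by rewrite big_nil mem_head.
rewrite big_cons; apply: allpairs_f; first by apply: sxs; rewrite mem_head.
by apply: IH => [y ys|]; [apply: sxs; rewrite inE ys orbT | case: sN].
Qed.

Lemma kfin_piece m : kfin (piece m).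
Proof.
have [l [_ sub]] := piece_spanning m.
apply: kfin_sub sub _; first exact: gfam_ksub (gfam_piece hR).
by apply: kfin_sums => x; apply: kfin_line.
Qed.

Lemma kfin_cyc (V : lmodType R) a (v : V) m : kfin (cyc a v m).
Proof. by apply: (kfin_image (linear_act v)); apply: kfin_sh => i; apply: kfin_piece. Qed.

Lemma prod_count_ge (x : R) Q (s : seq R) : (Q <= count_mem x s)%N ->
  exists t : seq R, [/\ {subset t <= s}, (size t + Q = size s)%N &
    \prod_(y <- s) y = x ^+ Q * \prod_(y <- t) y].
Proof.
elim: Q s => [|Q IH] s le; first by exists s; split; rewrite ?addn0 ?expr0 ?mul1r.
have xs : x \in s by rewrite -has_pred1 has_count; apply: leq_trans le.
have p := perm_to_rem xs.
have [|t [ts st e]] := IH (rem x s).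
  by move: le; rewrite (permP p) /= eqxx.
exists t; split.
- by move=> y /ts; apply: mem_rem.
- by rewrite (perm_size p) /= -st addnS.
by rewrite (perm_big _ p) big_cons e exprS /= mulrA.
Qed.

Lemma size_count_le Q (xs s : seq R) : {subset s <= xs} ->
  (forall x, x \in xs -> (count_mem x s <= Q)%N) -> (size s <= size xs * Q)%N.
Proof.
elim: xs s => [|x xs IH] s sxs cs.
  by case: s sxs {cs} => // x s /(_ x (mem_head _ _)).
rewrite mulSn -(count_predC (pred1 x) s) leq_add //; first by apply: cs; rewrite mem_head.
rewrite -size_filter; apply: IH => y.
  by rewrite mem_filter => /andP[/= /negPf ne /sxs]; rewrite inE ne.
move=> yxs; apply: leq_trans (cs y _); last by rewrite inE yxs orbT.
by rewrite -!size_filter -filter_predI !size_filter; apply: sub_count => z /= /andP[].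
Qed.

(* By the pigeonhole principle, a monomial of large degree in the generators is
   divisible by the Q-th power of one of them; hence R is a finite module over
   its subring of Q-th powers. *)
Lemma piece_pow Q : exists xs : seq R, (forall x, x \in xs -> x \in G 1%N) /\
  forall N, (size xs * Q < N)%N ->
    piece N `<=` sums (fun x => smul (x ^+ Q) (piece (N - Q))) xs.
Proof.
have [xs [Gxs xsP]] := piece_span hR; exists xs; split=> // N ltN.
have sS x : ksub (smul (x ^+ Q) (piece (N - Q))).
  exact: ksub_smul (gfam_ksub _ (gfam_piece hR)).
apply: xsP => [|s sxs sN]; first exact: ksub_sums.
have [x xxs lt] : exists2 x, x \in xs & (Q < count_mem x s)%N.
  apply: contrapT => nx; move: ltN; rewrite ltnNge => /negP; apply.
  rewrite -sN; apply: size_count_le => // x xxs; rewrite leqNgt; apply/negP => lt.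
  by apply: nx; exists x.
have [t [ts st ->]] := prod_count_ge (ltnW lt).
apply: (@sums_sub _ _ R^o _ _ _ x) => //.
exists (\prod_(y <- t) y) => //.
have -> : (N - Q = size t)%N by lia.
have {}ts y : y \in t -> y \in G 1%N by move=> /ts /sxs /Gxs.
elim: t ts {st} => [|y t IH] ts; first by rewrite big_nil; apply: piece1.
rewrite big_cons /= -add1n; apply: (pieceM hR); first by apply: ts; rewrite mem_head.
by apply: IH => z zt; apply: ts; rewrite inE zt orbT.
Qed.

Definition gideal (A : nat -> set R^o) := gfam A /\ forall m, A m `<=` piece m.

(* The ideal whose homogeneous components are the A m. *)
Definition bar (A : nat -> set R^o) : set R^o := [set x | forall m, A m (hcomp dG x m)].

Lemma submod_bar A : gfam A -> submod (bar A).
Proof.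
move=> gA; split=> [m|a u v Au Av m]; first by rewrite hcomp0; apply: gfam0 gA.
rewrite hcompD; apply: ksubD (gfam_ksub m gA) _ (Av m).
rewrite hcompM; apply: (ksub_sum _ (gfam_ksub m gA)) => i.
have im : (i <= m)%N by rewrite -ltnS.
by apply: (gfamZ gA _ im (Au _)); apply: hcomp_in.
Qed.

Lemma bar_fg A : gfam A -> exists s : seq R^o, (forall x, x \in s -> bar A x) /\
  forall x, bar A x -> lin s x.
Proof.
move=> gA; have [s sE] := sg_noetherian hR (span_of (bar A)).
exists s; split=> x.
  move=> xs; apply: (@span_of_min R R^o (bar A) (bar A) x (submod_bar gA)) => //.
  by rewrite sE; apply: span_of_gen.
by move=> Ax; apply/span_of_lin; rewrite -sE; apply: span_of_gen.
Qed.

Lemma bar_homog A m x : gfam A -> x \in G m -> (bar A x <-> A m x).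
Proof.
move=> gA Gx; split=> [/(_ m)|Ax i]; first by rewrite hcomp_eq.
rewrite (hcomp_homog dG i Gx); case: eqP => [->//|_]; exact: gfam0 gA.
Qed.

Lemma gideal_gens A : gideal A -> exists l : seq (nat * R^o),
  (forall av, av \in l -> A av.1 av.2) /\ forall m, A m = gens G l m.
Proof.
move=> [gA Asub]; have [s [sA As]] := bar_fg gA.
have [l [Hl lP]] := @homogeneous_gens k R G hR R^o G dG (proj2 (graded_self hR)) s.
have lA av : av \in l -> A av.1 av.2 by move=> /Hl[y /sA Ay ->]; apply: Ay.
exists l; split=> // m; apply/seteqP; split=> x.
  move=> Ax; have Gx := Asub _ _ Ax.
  by rewrite -(hcomp_eq dG Gx); apply/lP/As/(bar_homog gA Gx).
apply: sums_min; first exact: gfam_ksub gA.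
by move=> av /lA Aav; apply: cyc_sub.
Qed.

(** Without a maximal member, dependent choice would give a strictly increasing sequence. Its union
    is a graded ideal whose finitely many generators already lie in one term, where the sequence
    would have to stop. *)
Lemma gideal_max (S : set (nat -> set R^o)) A0 : S A0 ->
  (forall A, S A -> gideal A) ->
  exists A, S A /\ forall B, S B -> (forall m, A m `<=` B m) -> B = A.
Proof.
move=> SA0 gS; apply: contrapT => nomax.
have next (A : {A | S A}) : exists B : {A | S A},
    (forall m, sval A m `<=` sval B m) /\ sval B <> sval A.
  case: A => A SA /=; apply: contrapT => nB; apply: nomax; exists A; split=> // B SB AB.
  by apply: contrapT => ne; apply: nB; exists (exist _ B SB).
have [f fP] := choice next.
pose C n := iter n f (exist _ A0 SA0).
have Cmono i j m : (i <= j)%N -> sval (C i) m `<=` sval (C j) m.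
  elim: j => [|j IH]; first by rewrite leqn0 => /eqP-> x.
  rewrite leq_eqVlt => /predU1P[-> x //|]; rewrite ltnS => /IH sub x /sub.
  exact: (proj1 (fP (C j))).
have gC i : gideal (sval (C i)) by apply: gS; exact: proj2_sig.
pose U m := \bigcup_i sval (C i) m.
have gU : gfam U.
  split=> [m|i j b v Gb [n _ Cv]]; last first.
    by exists n => //; apply: (proj2 (proj1 (gC n))).
  split; first by exists 0%N => //; apply: gfam0 (proj1 (gC _)).
  move=> c u v [i _ Ci] [j _ Cj]; exists (maxn i j) => //.
  apply: ksubD (gfam_ksub m (proj1 (gC _))) _ (Cmono _ _ _ (leq_maxr _ _) _ Cj).
  exact: ksubZ (gfam_ksub m (proj1 (gC _))) (Cmono _ _ _ (leq_maxl _ _) _ Ci).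
have [s [sU Us]] := bar_fg gU.
have [n nP] : exists n, forall x, x \in s -> bar (sval (C n)) x.
  elim: s sU {Us} => [|x s IH] sU; first by exists 0%N.
  have [|n nP] := IH; first by move=> y ys; apply: sU; rewrite inE ys orbT.
  have Ux := sU x (mem_head _ _).
  have [i ix] : exists i : nat -> nat, forall m, sval (C (i m)) m (hcomp dG x m).
    have [|i ix] := @choice nat nat (fun m i => sval (C i) m (hcomp dG x m)).
      by move=> m; have [i _ Ci] := Ux m; exists i.
    by exists i.
  (* The generator x has finitely many nonzero components, and the one of degree m lies in
     [C (i m)]; the largest of these indices serves for all of x. *)
  have [N xN] := hcomp_fin dG x.
  pose M := maxn n (\max_(j < N) i j).
  exists M => y; rewrite inE => /predU1P[->|/nP ys] m; last first.
    by apply: (Cmono n); [exact: leq_maxl | exact: ys].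
  case: (ltnP m N) => [lt|/xN[-> _]]; last exact: gfam0 (proj1 (gC _)).
  apply: (Cmono (i m)); last exact: ix.
  apply: leq_trans (leq_maxr _ _).
  exact: (@leq_bigmax _ (fun j : 'I_N => i j) (Ordinal lt)).
apply: (proj2 (fP (C n))); apply/funext => m; apply/seteqP; split; last exact: (proj1 (fP (C n))).
move=> x Cx; have Gx := proj2 (gC n.+1) m x Cx.
apply/(bar_homog (proj1 (gC n)) Gx).
apply: (lin_min (submod_bar (proj1 (gC n))) nP).
by apply/Us/(bar_homog gU Gx); exists n.+1.
Qed.

Lemma submod_pset P : submod (pset P).
Proof. exact: (@prime_submod_closed R P). Qed.

Lemma psetM P x y : pset P (x * y) <-> pset P x \/ pset P y.
Proof. by rewrite /pset /= prime_idealrM; split=> /orP. Qed.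

Lemma pset1 P : ~ pset P 1.
Proof. by rewrite /pset /= idealr1. Qed.

Definition hprime P := forall x i, pset P x -> pset P (hcomp dG x i).

Definition colon (A : nat -> set R^o) j (b : R) i : set R^o :=
  [set c | piece i c /\ A (i + j)%N ((c : R) * b)].

Lemma gideal_colon A j b : gideal A -> gideal (colon A j b).
Proof.
move=> [gA Asub]; split; last by move=> m x [].
split=> [m|i l c v Gc [Gv Av]]; last first.
  split; first exact: (pieceM hR Gc Gv).
  by have := proj2 gA _ _ _ _ Gc Av; rewrite addnA /GRing.scale /= mulrA.
have [G0 GP] := gfam_ksub m (gfam_piece hR).
split=> [|c u v [Gu Au] [Gv Av]].
  by split=> //; rewrite mul0r; apply: gfam0 gA.
split; first exact: GP.
rewrite mulrDl; apply: ksubD (gfam_ksub _ gA) _ Av.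
have := ksubZ c (gfam_ksub _ gA) Au.
by rewrite /GRing.scale /= /restrict_scale /GRing.scale /= mulrA.
Qed.

(* A maximal colon ideal (A : b) is prime. *)
Lemma annihilator_prime A : gideal A -> (exists j b, piece j b /\ ~ A j b) ->
  exists P j b, [/\ hprime P, piece j b &
    forall i c, c \in G i -> (A (i + j)%N (c * b) <-> c \in P)].
Proof.
move=> gA [j0 [b0 [Gb0 Ab0]]].
pose S : set (nat -> set R^o) := [set B | exists j b, [/\ piece j b, ~ A j b & B = colon A j b]].
have [||_ [[j [b [Gb Ab ->]]] max]] := @gideal_max S (colon A j0 b0).
- by exists j0, b0.
- by move=> _ [j [b [_ _ ->]]]; apply: gideal_colon.
set B := colon A j b.
have gB : gideal B by apply: gideal_colon.
have hB i c : piece i c -> (bar B c <-> B i c) := bar_homog (proj1 gB).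
have B1 : ~ bar B 1.
  by move=> /(hB 0%N 1 (piece1 hR))[_]; rewrite mul1r.
(* Take the lowest components of u and v outside B, in degrees i and l. In degree i + l all other
   terms of the product lie in B, hence so does the product of these two components. *)
have Bp u v : bar B (u * v) -> bar B u \/ bar B v.
  move=> Buv; apply: contrapT => /not_orP[Bu Bv].
  have exi w : ~ bar B w -> exists i, ~~ `[< B i (hcomp dG w i) >].
    move=> Bw; apply: contrapT => nw; apply: Bw => i; apply: contrapT => Bi.
    by apply: nw; exists i; apply/asboolPn.
  have lowest w : ~ bar B w -> exists i, ~ B i (hcomp dG w i) /\
      forall l, (l < i)%N -> B l (hcomp dG w l).
    move=> /exi/ex_minnP[i /asboolPn Bi min]; exists i; split=> // l lt.
    by apply: contrapT => /asboolPn /min; rewrite leqNgt lt.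
  have [i [Bi lowi]] := lowest u Bu; have [l [Bl lowl]] := lowest v Bv.
  have Gu n := hcomp_in dG u n; have Gv n := hcomp_in dG v n.
  have := Buv (i + l)%N; rewrite hcompM.
  have lti : (i < (i + l).+1)%N by rewrite ltnS leq_addr.
  rewrite (bigD1 (Ordinal lti)) //= addKn => Bs.
  have {Bs}Bil : B (i + l)%N (hcomp dG u i * hcomp dG v l).
    refine (ksubDr (gfam_ksub (i + l)%N (proj1 gB)) _ Bs).
    rewrite big_mkcond; apply: (ksub_sum _ (gfam_ksub _ (proj1 gB))) => m.
    case: ifP => [|_]; last exact: gfam0 (proj1 gB).
    rewrite -val_eqE /= => ne; have lem : (m <= i + l)%N by rewrite -ltnS.
    case: (ltngtP m i) ne => // lt _.
      rewrite mulrC; apply: (gfamZ (proj1 gB) (Gv _) (leq_subr _ _)).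
      by rewrite subKn //; apply: lowi.
    apply: (gfamZ (proj1 gB) (Gu _) lem); apply: lowl; lia.
  have Avb : ~ A (l + j)%N (hcomp dG v l * b) by move=> Avb; apply: Bl; split; first exact: Gv.
  (* The multiple of b by the component of v is not in A, so its colon ideal competes with B, which
     it contains; maximality makes them equal. *)
  have e : colon A (l + j) (hcomp dG v l * b) = B.
    apply: max; first by exists (l + j)%N, (hcomp dG v l * b); split=> //; apply: (pieceM hR).
    move=> m c [Gc Ac]; split=> //; rewrite mulrCA addnCA.
    by apply: (proj2 (proj1 gA)).
  apply: Bi; rewrite -e; split; first exact: Gu.
  by case: Bil => _; rewrite -mulrA -addnA.
have [B0 BL] := submod_bar (proj1 gB).
pose Pp (x : R) : bool := `[< bar B x >].
have iP : idealr_closed Pp.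
  split; [exact/asboolP | exact/asboolPn |].
  by move=> a u v /asboolP Bu /asboolP Bv; apply/asboolP; apply: BL.
have pP : prime_idealr_closed Pp.
  by move=> u v /asboolP/Bp[]/asboolP h; apply/orP; [left | right].
exists (Spectrum iP pP), j, b; split=> //.
  move=> x i /asboolP Bx; apply/asboolP/(hB i); [exact: hcomp_in | exact: Bx].
move=> i c Gc; split=> [Acb|/asboolP/(hB i c Gc)[]//].
by apply/asboolP/(hB i c Gc).
Qed.

(* L is filtered up to H by graded submodules with successive quotients
   (R/P)(-a), for (P, a) in the list read from right to left. *)
Inductive pfilt (V : lmodType R) (L : nat -> set V) :
    (nat -> set V) -> seq (spectrum R * nat) -> Prop :=
| pfilt_nil : pfilt L L [::]
| pfilt_cons H s P a v : pfilt L H s -> hprime P ->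
    (forall i b, b \in G i -> (H (i + a)%N (b *: v) <-> b \in P)) ->
    pfilt L (fadd H (cyc a v)) ((P, a) :: s).

Section Pfilt.
Variable V : lmodType R.
Implicit Types (L H : nat -> set V).

Lemma pfilt_cat L H H' s s' : pfilt L H s -> pfilt H H' s' -> pfilt L H' (s' ++ s).
Proof. by move=> LH; elim=> // {}H' {}s' P a v _ IH hP vP; apply: pfilt_cons. Qed.

Lemma pfilt_sub L H s m : gfam L -> pfilt L H s -> L m `<=` H m.
Proof.
move=> gL; elim=> // {}H {}s P a v _ IH _ _ x Lx.
apply: ksub_subl (IH _ Lx); exact: gfam_ksub (gfam_cyc hR a v).
Qed.

Lemma pfilt_gfam L H s : gfam L -> pfilt L H s -> gfam H.
Proof.
by move=> gL; elim=> // {}H {}s P a v _ IH _ _; apply: gfam_fadd => //; apply: gfam_cyc.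
Qed.

Lemma pfilt_kfin L H s m : kfin (L m) -> pfilt L H s -> kfin (H m).
Proof.
by move=> gL; elim=> // {}H {}s P a v _ IH _ _; apply: kfin_sumset => //; apply: kfin_cyc.
Qed.

Lemma pfilt_hprime L H s Pa : pfilt L H s -> Pa \in s -> hprime Pa.1.
Proof.
elim=> // {}H {}s P a v _ IH hP _; rewrite inE => /predU1P[->//|]; exact: IH.
Qed.

End Pfilt.

Section PfiltAct.
Variable V : lmodType R.
Implicit Types (L H : nat -> set V).

Definition act a (v : V) (B : nat -> set R^o) m : set V := [set (b : R) *: v | b in sh a B m].

(** For B = R this carries a filtration of R/A to (H + Rv)/H, where A is the annihilator of v modulo
    H; a variable B serves the induction. *)
Lemma pfilt_act (A B : nat -> set R^o) s H a v : gfam A -> gfam H ->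
  pfilt A B s -> (forall m, B m `<=` piece m) ->
  (forall i b, b \in G i -> (A i b <-> H (i + a)%N (b *: v))) ->
  pfilt H (fadd H (act a v B)) [seq (x.1, (x.2 + a)%N) | x <- s].
Proof.
move=> gA gH; elim=> [|{}B {}s P c w pB IH hP wP] subG AH.
  have -> : fadd H (act a v A) = H; last exact: pfilt_nil.
  apply/funext => m; rewrite /fadd sumsetC; apply: (@ksub_absorb k).
  - by apply: ksub_image (linear_act v) _ _; apply: ksub_sh => i; apply: gfam_ksub gA.
  - exact: gfam_ksub gH.
  move=> _ [b + <-]; rewrite /sh; case: leqP => [le Ab|_ ->].
    by rewrite -(subnK le); apply/AH => //; apply: subG.
  by rewrite scale0r; apply: gfam0 gH.
have gB := pfilt_gfam gA pB.
have BG m : B m `<=` piece m.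
  by apply: subset_trans (subG m); apply: ksub_subl; apply: gfam_ksub (gfam_cyc hR c w).
have Gw : w \in G c.
  by apply: (subG c); apply: ksub_subr (gfam_ksub c gB) _ (cyc_gen hR c w).
have -> : fadd H (act a v (fadd B (cyc c w))) =
    fadd (fadd H (act a v B)) (cyc (c + a) (w *: v)).
  apply/funext => m; rewrite /fadd /act sh_fadd (image_sumset (linear_act v)) sumsetA.
  congr (_ :+: _); rewrite /cyc addnC -sh_sh.
  rewrite [in RHS]/sh [in LHS]/sh; case: ifP => _.
    apply/seteqP; split=> [_ [_ [b Gb <-] <-]|_ [b Gb <-]].
      by exists b; rewrite ?scalerA.
    by exists (b *: w); [exists b | rewrite scalerA].
  by rewrite !image_set1 !scale0r.
apply: pfilt_cons => //; first exact: IH.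
move=> i b Gb; have Gbw := pieceM hR Gb Gw; split.
  move=> [h [_ [Hh [b' + <-] e]]]; rewrite addnA /sh leq_addl addnK => Bb'.
  apply/(wP _ _ Gb); have Gb' := BG _ _ Bb'.
  have GB : b * w - b' \in G (i + c)%N.
    exact: ksubB (gfam_ksub _ (gfam_piece hR)) Gbw Gb'.
  refine (@ksubBr k R R^o _ b' (b * w) (gfam_ksub (i + c)%N gB) Bb' _).
  apply: (pfilt_sub gA pB); apply/AH => //.
  suff -> : (b * w - b') *: v = h by rewrite -addnA.
  by rewrite scalerBl -scalerA e addrK.
move=> /(wP _ _ Gb) Bbw; apply: ksub_subr; first exact: gfam_ksub gH.
by exists (b * w); rewrite ?scalerA // addnA /sh leq_addl addnK.
Qed.

End PfiltAct.

(** A largest graded ideal without a filtration could be enlarged by an element c whose annihilator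
    modulo it is prime; the larger ideal has a filtration, and one more factor extends it to the
    original one. *)
Lemma pfilt_gideal (A : nat -> set R^o) : gideal A -> exists s, pfilt A piece s.
Proof.
move=> gA; apply: contrapT => bad.
pose S : set (nat -> set R^o) := [set A | gideal A /\ ~ exists s, pfilt A piece s].
have [|A' [//]|B [[gB badB] max]] := @gideal_max S A; first by split.
have [[j [b [Gb Bb]]]|nex] := pselect (exists j b, piece j b /\ ~ B j b); last first.
  apply: badB; exists [::].
  have -> : B = piece; last exact: pfilt_nil.
  apply/funext => m; apply/seteqP; split; first exact: (proj2 gB).
  by move=> x Gx; apply: contrapT => Bx; apply: nex; exists m, x.
have [|P [l [c [hP Gc cP]]]] := annihilator_prime gB; first by exists j, b.
have gB' : gideal (fadd B (cyc l c)).
  split; first by apply: gfam_fadd (proj1 gB) (gfam_cyc hR _ _).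
  move=> m; apply: ksub_min; first exact: gfam_ksub (gfam_piece hR).
    exact: (proj2 gB).
  by apply: cyc_sub => //; apply: gfam_piece.
have BB' m : B m `<=` fadd B (cyc l c) m.
  by apply: ksub_subl; apply: gfam_ksub (gfam_cyc hR _ _).
have step : pfilt B (fadd B (cyc l c)) [:: (P, l)].
  by apply: pfilt_cons => //; apply: pfilt_nil.
have [[s fs]|badB'] := pselect (exists s, pfilt (fadd B (cyc l c)) piece s).
  by apply: badB; exists (s ++ [:: (P, l)]); apply: pfilt_cat step fs.
(* If the larger ideal has no filtration either, it equals B, so c lies in B and 1 in P. *)
have e : fadd B (cyc l c) = B by apply: max.
have : B (0 + l)%N (1 * c).
  rewrite add0n mul1r -[X in X l c]e.
  by apply: ksub_subr (gfam_ksub _ (proj1 gB)) _ (cyc_gen hR _ _).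
by move=> /(cP 0%N 1 (piece1 hR)); apply: pset1.
Qed.

End Noetherian.

(** * Eventually polynomial functions *)

Section Growth.

(** The base m + 1 is positive for every m, so that a larger C absorbs any finite number of
    values. *)
Definition bigO e (f : nat -> int) := exists C : nat, forall m, `|f m| <= (C * m.+1 ^ e)%N%:Z.

Lemma bigOD e f g : bigO e f -> bigO e g -> bigO e (fun m => f m + g m).
Proof.
move=> [C fC] [D gD]; exists (C + D)%N => m; rewrite mulnDl PoszD.
by apply: le_trans (ler_normD _ _) _; apply: lerD.
Qed.

Lemma bigON e f : bigO e f -> bigO e (fun m => - f m).
Proof. by move=> [C fC]; exists C => m; rewrite normrN. Qed.

Lemma bigOB e f g : bigO e f -> bigO e g -> bigO e (fun m => f m - g m).
Proof. by move=> fO gO; apply: bigOD => //; apply: bigON. Qed.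

Lemma bigOZ e (c : int) f : bigO e f -> bigO e (fun m => c * f m).
Proof.
move=> [C fC]; exists (`|c| * C)%N => m; rewrite normrM -mulnA PoszM abszE.
by apply: ler_wpM2l.
Qed.

Lemma bigO_ext e f g : bigO e f -> (forall m, f m = g m) -> bigO e g.
Proof. by move=> [C fC] fg; exists C => m; rewrite -fg. Qed.

Lemma bigO0 e : bigO e (fun=> 0).
Proof. by exists 0%N => m; rewrite normr0. Qed.

Lemma bigO_eventually e f g m0 : bigO e f -> (forall m, (m0 <= m)%N -> f m = g m) ->
  bigO e g.
Proof.
move=> [C fC] fg; exists (C + \max_(i < m0) `|g i|)%N => m.
case: (leqP m0 m) => le.
  rewrite -fg //; apply: le_trans (fC m) _; rewrite lez_nat leq_mul2r leq_addr orbT //.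
have le1 : (`|g m| <= \max_(i < m0) `|g i|)%N.
  exact: (@leq_bigmax _ (fun i : 'I_m0 => `|g i|%N) (Ordinal le)).
rewrite -abszE lez_nat mulnDl; apply: leq_trans (leq_addl _ _).
by apply: leq_trans le1 _; rewrite leq_pmulr // expn_gt0.
Qed.

Lemma normr_Posz (n : nat) : `|n%:Z| = n%:Z. Proof. by []. Qed.

Lemma Posz_exp (n i : nat) : (n ^ i)%N%:Z = n%:Z ^+ i.
Proof. by elim: i => [|i IH]; rewrite ?expn0 ?expr0 // expnS exprS PoszM IH. Qed.

(* The n-th difference of f eventually vanishes: f is eventually a polynomial of
   degree less than n. *)
Fixpoint evpoly n (f : nat -> int) : Prop :=
  if n is n'.+1 then evpoly n' (fun m => f m.+1 - f m)
  else exists m0, forall m, (m0 <= m)%N -> f m = 0.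

Lemma evpoly_eventually n f g m0 : (forall m, (m0 <= m)%N -> f m = g m) ->
  evpoly n f -> evpoly n g.
Proof.
elim: n f g => [|n IH] f g fg /=.
  by move=> [m1 f0]; exists (maxn m0 m1) => m; rewrite geq_max => /andP[/fg <- /f0].
by apply: IH => m le; rewrite !fg // leqW.
Qed.

Lemma evpoly0 n : evpoly n (fun=> 0).
Proof.
elim: n => [|n IH]; first by exists 0%N.
by apply: (@evpoly_eventually n (fun=> 0) _ 0%N).
Qed.

Lemma evpolyD n f g : evpoly n f -> evpoly n g -> evpoly n (fun m => f m + g m).
Proof.
elim: n f g => [|n IH] f g /=.
  move=> [m0 f0] [m1 g0]; exists (maxn m0 m1) => m.
  by rewrite geq_max => /andP[/f0 -> /g0 ->].
move=> ef eg; apply: (@evpoly_eventually n _ _ 0%N) (IH _ _ ef eg) => m _.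
by rewrite opprD addrACA.
Qed.

Lemma evpoly_shift n f a : evpoly n f ->
  evpoly n (fun m => if (a <= m)%N then f (m - a)%N else 0).
Proof.
elim: n f => [|n IH] f /=.
  move=> [m0 f0]; exists (a + m0)%N => m le; rewrite ifT; last by lia.
  by apply: f0; lia.
move=> /IH; apply: (@evpoly_eventually _ _ _ a) => m le.
by rewrite le leqW // subSn.
Qed.

Lemma evpolyS n f : evpoly n f -> evpoly n (fun m => f m.+1).
Proof.
elim: n f => [|n IH] f /=; last by move=> /IH.
by move=> [m0 f0]; exists m0 => m le; apply: f0; rewrite leqW.
Qed.

Lemma evpoly_leq n n' f : (n <= n')%N -> evpoly n f -> evpoly n' f.
Proof.
elim: n' n f => [|n' IH] [|n] f // le ef; last exact: (IH n _ le ef).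
apply: (IH 0%N) => //; have [m0 f0] := ef; exists m0 => m lem.
by rewrite !f0 ?subrr // leqW.
Qed.

(** Newton expansion: subtracting from f the antidifference of the expansion of its difference
    leaves an eventually constant function. *)
Lemma evpoly_binomial n f : evpoly n f -> exists (c : nat -> int) m0,
  forall m, (m0 <= m)%N -> f m = \sum_(j < n) c j * 'C(m, j)%:Z.
Proof.
elim: n f => [|n IH] f /=.
  by move=> [m0 f0]; exists (fun=> 0), m0 => m /f0 ->; rewrite big_ord0.
move=> /IH[c [m0 fc]].
pose g m := f m - \sum_(j < n) c j * 'C(m, j.+1)%:Z.
have gc m : g (m0 + m)%N = g m0.
  elim: m => [|m <-]; first by rewrite addn0.
  set M := (m0 + m)%N; rewrite addnS -/M /g.
  have -> : f M.+1 = f M + \sum_(j < n) c j * 'C(M, j)%:Z.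
    by rewrite -fc ?leq_addr // addrC subrK.
  have -> : \sum_(j < n) c j * 'C(M.+1, j.+1)%:Z =
      \sum_(j < n) c j * 'C(M, j.+1)%:Z + \sum_(j < n) c j * 'C(M, j)%:Z.
    by rewrite -big_split /=; apply: eq_bigr => j _; rewrite binS PoszD mulrDr.
  ring.
exists (fun j => if j is j'.+1 then c j' else g m0), m0 => m le.
rewrite big_ord_recl /= bin0 mulr1 -(gc (m - m0)%N) subnKC // /g.
by rewrite -addrA addNr addr0.
Qed.

Lemma bin_leq_expn m j : ('C(m, j) <= m ^ j)%N.
Proof.
apply: (@leq_trans ('C(m, j) * j`!)); first by rewrite leq_pmulr // fact_gt0.
rewrite bin_ffact; elim: j m => [|j IH] m; first by rewrite ffactn0.
rewrite ffactnSr expnSr; apply: leq_mul => //; exact: leq_subr.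
Qed.

Lemma bigO_bin e j : (j <= e)%N -> bigO e (fun m => 'C(m, j)%:Z).
Proof.
move=> le; exists 1%N => m; rewrite mul1n normr_Posz lez_nat.
apply: leq_trans (bin_leq_expn m j) _.
apply: (@leq_trans (m.+1 ^ j)); first by case: j {le} => // j; rewrite leq_exp2r.
by rewrite leq_pexp2l.
Qed.

Lemma bigO_binomial_sum e n (c : nat -> int) : (n <= e.+1)%N ->
  bigO e (fun m => \sum_(j < n) c j * 'C(m, j)%:Z).
Proof.
elim: n => [|n IH] le; first by apply: bigO_ext (bigO0 e) _ => m; rewrite big_ord0.
apply: (@bigO_ext _ (fun m => \sum_(j < n) c j * 'C(m, j)%:Z + c n * 'C(m, n)%:Z)).
  by apply: bigOD; [apply: IH; exact: ltnW | apply: bigOZ; apply: bigO_bin].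
by move=> m; rewrite big_ord_recr.
Qed.

Lemma evpoly_bigO e n f : (n <= e.+1)%N -> evpoly n f -> bigO e f.
Proof.
move=> le /evpoly_binomial[c [m0 fc]].
by apply: bigO_eventually (bigO_binomial_sum c le) _ => m /fc.
Qed.

Lemma ffact_leq_expn m j : (m ^_ j <= m ^ j)%N.
Proof.
elim: j => [|j IH]; first by rewrite ffactn0.
by rewrite ffactnSr expnSr; apply: leq_mul => //; apply: leq_subr.
Qed.

Lemma bigO_ffact e : bigO e (fun m => (m ^ e.+1)%:Z - (m ^_ e.+1)%:Z).
Proof.
suff [C eC] : exists C, forall m, (m ^ e.+1 <= m ^_ e.+1 + C * m.+1 ^ e)%N.
  exists C => m; have := eC m; have := ffact_leq_expn m e.+1; lia.
elim: e => [|e [C eC]].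
  by exists 0%N => m; rewrite ffactn1 expn1 mul0n addn0.
exists (C + e.+1)%N => m.
have le1 : (m ^ e.+2 <= m ^_ e.+1 * m + C * m.+1 ^ e.+1)%N.
  rewrite expnSr [(m.+1 ^ e.+1)%N]expnSr mulnA.
  apply: (@leq_trans ((m ^_ e.+1 + C * m.+1 ^ e) * m)); first by rewrite leq_mul2r eC orbT.
  by rewrite mulnDl leq_add2l leq_mul2l leqnSn orbT.
apply: leq_trans le1 _.
rewrite mulnDl addnCA addnC leq_add2l [(m ^_ e.+2)%N]ffactnSr.
apply: (@leq_trans (m ^_ e.+1 * (m - e.+1) + m ^_ e.+1 * e.+1)).
  by rewrite -mulnDr leq_mul2l; apply/orP; right; lia.
rewrite leq_add2l mulnC leq_mul2l; apply/orP; right.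
apply: leq_trans (ffact_leq_expn _ _) _; by rewrite leq_exp2r.
Qed.

(** The factor (e+1)! turns the leading binomial into a falling factorial, which keeps everything
    over the integers. *)
Lemma evpoly_asymptotic e f : evpoly e.+2 f -> exists c : int,
  bigO e (fun m => (e.+1)`!%:Z * f m - c * (m ^ e.+1)%:Z).
Proof.
move=> /evpoly_binomial[c [m0 fc]]; exists (c e.+1).
apply: (@bigO_eventually _ (fun m =>
   (e.+1)`!%:Z * (\sum_(j < e.+1) c j * 'C(m, j)%:Z) -
   c e.+1 * ((m ^ e.+1)%:Z - (m ^_ e.+1)%:Z)) _ m0).
  apply: bigOB; last by apply: bigOZ; apply: bigO_ffact.
  by apply: bigOZ; apply: bigO_binomial_sum.
move=> m /fc ->; rewrite [in RHS]big_ord_recr /= -bin_ffact PoszM; ring.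
Qed.

Lemma bigO_exp_shift e (Q : nat) (s : int) :
  bigO e (fun m => ((Q * m)%N%:Z + s) ^+ e.+1 - (Q * m)%N%:Z ^+ e.+1).
Proof.
exists (`|s| * (e.+1 * (Q + `|s|) ^ e))%N => m.
rewrite subrXX addrAC subrr add0r normrM -mulnA [leRHS]PoszM abszE ler_wpM2l //.
apply: le_trans (ler_norm_sum _ _ _) _.
apply: (@le_trans _ _ (\sum_(i < e.+1) (((Q + `|s|) * m.+1) ^ e)%N%:Z)).
  apply: ler_sum => i _; rewrite normrM !normrX.
  have -> : (((Q + `|s|) * m.+1) ^ e)%N%:Z =
     ((Q + `|s|) * m.+1)%N%:Z ^+ (e.+1.-1 - i) * ((Q + `|s|) * m.+1)%N%:Z ^+ i.
    by rewrite -exprD /= subnK ?Posz_exp // -ltnS.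
  apply: ler_pM; rewrite ?exprn_ge0 //; apply: lerXn2r; rewrite ?nnegrE //.
    apply: le_trans (ler_normD _ _) _; rewrite normr_Posz -abszE -PoszD lez_nat.
    by rewrite mulnDl mulnS mulnS; lia.
  by rewrite normr_Posz lez_nat; lia.
by rewrite sumr_const card_ord -mulr_natr natz -PoszM lez_nat expnMn mulnC -!mulnA.
Qed.

(* If h grows like a polynomial of degree e+1 and h(Qm + r - a) like N h(m), then
   comparing leading coefficients gives N = Q^(e+1). *)
Lemma count_unique e (h : nat -> int) (c w : int) a r (Q N : nat) : (0 < Q)%N ->
  bigO e (fun m => w * h m - c * (m ^ e.+1)%:Z) ->
  bigO e (fun m => (if (a <= Q * m + r)%N then h (Q * m + r - a)%N else 0) - N%:Z * h m) ->
  c = 0 \/ N = (Q ^ e.+1)%N.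
Proof.
move=> Q0 hc hN.
(* The hypotheses combine to D m^(e+1) = O(m^e), so D must vanish. *)
pose D : int := c * ((Q ^ e.+1)%N%:Z - N%:Z).
have hQ : bigO e (fun m => w * (if (a <= Q * m + r)%N then h (Q * m + r - a)%N else 0) -
    c * (Q * m)%N%:Z ^+ e.+1).
  apply: (@bigO_eventually _ (fun m => (if (a <= Q * m + r)%N then
     w * h (Q * m + r - a)%N - c * ((Q * m + r - a) ^ e.+1)%N%:Z else 0) +
     c * (((Q * m)%N%:Z + (r%:Z - a%:Z)) ^+ e.+1 - (Q * m)%N%:Z ^+ e.+1)) _ a).
    apply: bigOD; last by apply: bigOZ; apply: bigO_exp_shift.
    have [C hC] := hc; exists (C * (Q + r).+1 ^ e)%N => m.
    case: leqP => le; last by rewrite normr0.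
    apply: le_trans (hC _) _; rewrite lez_nat -mulnA leq_mul2l -expnMn.
    apply/orP; right; case: (e) => // e'; rewrite leq_exp2r //; nia.
  move=> m le; have le' : (a <= Q * m + r)%N by nia.
  have e1 : (Q * m)%N%:Z + (r%:Z - a%:Z) = (Q * m + r - a)%N%:Z by lia.
  rewrite le' e1 Posz_exp; ring.
have : bigO e (fun m => D * (m ^ e.+1)%:Z).
  apply: (bigO_ext (bigOB (bigOB (bigOZ w hN) hQ) (bigOZ (- N%:Z) hc))) => m.
  rewrite /D PoszM exprMn !Posz_exp; ring.
move=> [C DC].
have [D0|D0] := eqVneq D 0.
  move/eqP: D0; rewrite mulf_eq0 subr_eq0 => /orP[/eqP->|/eqP[<-]]; [by left | by right].
(* For m >= 1 the bound gives m^(e+1) <= C (m+1)^e <= C 2^e m^e, which fails at m = C 2^e + 1. *)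
exfalso; pose m := (C * 2 ^ e).+1.
have := DC m; rewrite normrM normr_Posz.
have D1 : 1 <= `|D| by rewrite -gtz0_ge1 normr_gt0.
move=> le.
have : (m ^ e.+1)%:Z <= (C * m.+1 ^ e)%N%:Z.
  by apply: le_trans le; rewrite ler_peMl.
rewrite lez_nat => {}le.
have : (m ^ e.+1 <= C * 2 ^ e * m ^ e)%N.
  apply: leq_trans le _; rewrite -mulnA leq_mul2l -expnMn; apply/orP; right.
  by case: (e) => // e'; rewrite leq_exp2r // /m; lia.
by rewrite expnS leq_pmul2r ?expn_gt0 // /m ltnn.
Qed.

End Growth.

(** * Hilbert functions of graded primes *)

Section PrimeChains.
Variable R : comNzRingType.
Implicit Types P Q : spectrum R.

(* dim R/P >= n. *)
Definition above P n := exists Q : nat -> spectrum R, pset P `<=` pset (Q 0%N) /\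
  forall i, (i < n)%N -> pset (Q i) `<=` pset (Q i.+1) /\
    exists2 x, pset (Q i.+1) x & ~ pset (Q i) x.

Lemma above_cons P Q x n : pset P `<=` pset Q -> pset Q x -> ~ pset P x ->
  above Q n -> above P n.+1.
Proof.
move=> PQ Qx Px [C [QC st]].
exists (fun i => if i is i'.+1 then C i' else P); split=> // -[_|i /st //].
by split; [move=> y /PQ /QC | exists x => //; apply: QC].
Qed.

Lemma pset_inj P Q : pset P = pset Q -> P = Q.
Proof.
move=> e; apply: spectrum_eq => x.
by apply/idP/idP => h; [have : pset Q x by rewrite -e | have : pset P x by rewrite e].
Qed.

End PrimeChains.

Section Hilbert.
Variables (k : fieldType) (R : comAlgType k) (G : nat -> {pred R}).
Hypothesis hR : standard_graded G.

Local Notation dG := (piece_direct hR).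
Local Notation piece := (piece G).
Local Notation cyc := (cyc G).
Local Notation gfam := (gfam G).
Local Notation pfilt := (pfilt hR).
Local Notation hprime := (hprime hR).
Local Notation kfin_piece := (kfin_piece hR).
Implicit Types P Q : spectrum R.

Lemma krel_eq (V : lmodType R) (X T T' : set V) : (forall x, X x -> (T x <-> T' x)) ->
  krel X T = krel X T'.
Proof.
move=> H; rewrite /krel /rlen; congr (_ - len _)%N.
by apply/seteqP; split=> x [Xx Tx]; split=> //; apply/(H x Xx).
Qed.

Lemma ksub_pset P : ksub (pset P). Proof. exact/submod_ksub/submod_pset. Qed.

Lemma hprime_sub P Q : hprime P ->
  (forall i x, x \in G i -> pset P x -> pset Q x) -> pset P `<=` pset Q.
Proof.
move=> hP PQ x Px; have [n xn] := hcomp_fin dG x; have [_ ->] := xn n (leqnn n).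
apply: (ksub_sum _ (ksub_pset Q)) => i.
by apply: (PQ i); [exact: hcomp_in | exact: hP].
Qed.

(* The Hilbert function of (R/P)(-a). *)
Definition hilb P a m := krel (sh a piece m) (pset P).

Lemma hilbE P a m : hilb P a m = if (a <= m)%N then hilb P 0 (m - a) else 0%N.
Proof.
rewrite /hilb sh0 /sh; case: ifP => // _.
by apply: krel_set0; apply: ksub_pset.
Qed.

Section PfiltHilbert.
Variable V : lmodType R.
Implicit Types (L H : nat -> set V).

Lemma krel_step H P a v m :
  gfam H -> (forall i b, b \in G i -> (H (i + a)%N (b *: v) <-> b \in P)) ->
  krel (cyc a v m) (H m) = hilb P a m.
Proof.
move=> gH vP; rewrite (krel_cyc _ _ _ kfin_piece) ?(gfam_ksub m gH) //; last exact: gfam_ksub gH.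
apply: krel_eq => b; rewrite /sh; case: leqP => [le Gb|_ ->].
  by rewrite /= -{1}(subnK le); apply: vP.
rewrite /= scale0r; split=> _; last exact: gfam0 gH.
exact: submod0 (submod_pset P).
Qed.

Lemma pfilt_hilb L H s m : gfam L -> kfin (L m) -> pfilt L H s ->
  krel (H m) (L m) = (\sum_(x <- s) hilb x.1 x.2 m)%N.
Proof.
move=> gL fL; elim=> [|{}H {}s P a v LH IH hP vP].
  by rewrite big_nil; apply: krel_subset.
have gH := pfilt_gfam gL LH; have fH := pfilt_kfin fL LH.
rewrite big_cons /= -IH /fadd sumsetC krel_sumset //; last 2 first.
- exact: kfin_cyc.
- exact: gfam_ksub gL.
rewrite addnC; congr (_ + _)%N.
have -> : H m :+: L m = H m.
  rewrite sumsetC; apply: ksub_absorb.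
  - exact: gfam_ksub gL.
  - exact: gfam_ksub gH.
  exact: pfilt_sub LH.
exact: krel_step.
Qed.

(** The factor (R/P)(-a) is generated by the class of v, which x kills because xv lies in L. This is
    the source of all inclusions into the primes of a filtration. *)
Lemma pfilt_annihilator L H s e (x : R) : gfam L -> pfilt L H s -> x \in G e ->
  (forall m v, H m v -> L (e + m)%N (x *: v)) -> forall Pa, Pa \in s -> pset Pa.1 x.
Proof.
move=> gL; elim=> [|{}H {}s P a v LH IH hP vP] Gx xH // Pa.
have gH := pfilt_gfam gL LH; have gc := gfam_cyc hR a v.
rewrite inE => /predU1P[->|Ps].
  apply/(vP e x Gx); apply: (pfilt_sub gL LH); apply: xH.
  by apply: ksub_subr (gfam_ksub _ gH) _ (cyc_gen hR _ _).
apply: IH => // m w Hw; apply: xH.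
exact: ksub_subl (gfam_ksub _ gc) _ Hw.
Qed.

End PfiltHilbert.

Definition pfam P m : set R^o := pset P `&` piece m.

Lemma gideal_pfam P : gideal G (pfam P).
Proof.
split; last by move=> m x [].
split=> [m|i j b v Gb [Pv Gv]].
  by apply: ksubI; [exact: ksub_pset | exact: gfam_ksub (gfam_piece hR)].
by split; [apply/psetM; right | exact: (pieceM hR)].
Qed.

(** These primes lie strictly above P when x is outside P, which drives inductions on the dimension.
    The last clause provides at least one of them: for x of positive degree, 1 is not in P + xR. *)
Lemma quotient_primes P b (x : R) : hprime P -> x \in G b ->
  exists s : seq (spectrum R * nat),
  [/\ forall m, krel (piece m) (pset P :+: cyc b (x : R^o) m) =
        (\sum_(y <- s) hilb y.1 y.2 m)%N,
      forall y, y \in s -> [/\ hprime y.1, pset P `<=` pset y.1 & pset y.1 x] &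
      (0 < b)%N -> exists y, y \in s].
Proof.
move=> hP Gx; pose A := fadd (pfam P) (cyc b (x : R^o)).
have gP := gideal_pfam P; have gc := gfam_cyc hR b (x : R^o).
have cG m : cyc b (x : R^o) m `<=` piece m by apply: cyc_sub => //; apply: gfam_piece.
have gA : gideal G A.
  split; first exact: gfam_fadd (proj1 gP) gc.
  move=> m; apply: ksub_min => //; first exact: gfam_ksub (gfam_piece hR).
  exact: (proj2 gP).
have [s fs] := pfilt_gideal hR gA.
exists s; split.
- move=> m; rewrite -(pfilt_hilb (proj1 gA) _ fs); last first.
    exact: kfin_sub (gfam_ksub _ (proj1 gA)) (proj2 gA m) (kfin_piece m).
  rewrite (@krel_cap _ _ _ _ _ (piece m)) // sumsetC ksub_modular //; last first.
    exact: gfam_ksub (gfam_piece hR).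
  by rewrite sumsetC.
- move=> y ys; split; first exact: pfilt_hprime fs ys.
    apply: (hprime_sub hP) => i z Gz Pz.
    apply: (pfilt_annihilator (proj1 gA) fs Gz _ ys) => m v Gv.
    apply: ksub_subl; first exact: gfam_ksub gc.
    split; last exact: (pieceM hR).
    by rewrite /GRing.scale /= mulrC; apply/psetM; right.
  apply: (pfilt_annihilator (proj1 gA) fs Gx _ ys) => m v Gv.
  apply: ksub_subr; first exact: gfam_ksub (proj1 gP).
  rewrite /cyc /sh leq_addr addKn; exists v => //.
  by rewrite /GRing.scale /= mulrC.
move=> b0; case: s fs => [fs|y s _]; last by exists y; rewrite mem_head.
have : piece 0%N 1 by exact: piece1.
have -> : piece = A by inversion fs.
move=> [z [w [[Pz _] + e]]]; rewrite /cyc /sh leqNgt b0 /= => -[_ -> w0].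
by case: (@pset1 _ _ P); rewrite /pset /= e -w0 scale0r addr0.
Qed.

Lemma evpoly_hilb_shift n P a : evpoly n (fun m => (hilb P 0 m)%:Z) ->
  evpoly n (fun m => (hilb P a m)%:Z).
Proof.
move=> /(evpoly_shift a); apply: evpoly_eventually 0%N _ => m _.
by rewrite (hilbE P a); case: ifP.
Qed.

Lemma piece_in_prime P m : (forall x, x \in G 1%N -> pset P x) -> (0 < m)%N ->
  piece m `<=` pset P.
Proof.
move=> G1 m0; have [xs [Gxs xsP]] := piece_span hR.
apply: xsP => [|[|x s] sxs sm]; [exact: ksub_pset | by rewrite -sm in m0 |].
rewrite big_cons; apply/psetM; left; apply: G1; apply: Gxs; apply: sxs.
exact: mem_head.
Qed.

Lemma krel_mul_prime P b (x : R) m : x \in G b -> ~ pset P x ->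
  krel (cyc b (x : R^o) (b + m)) (pset P) = hilb P 0 m.
Proof.
move=> Gx Px; rewrite (krel_cyc _ _ _ kfin_piece); last exact: ksub_pset.
rewrite /hilb !sh0 {1}addnC sh_id; apply: krel_eq => y _ /=.
split=> [/psetM[//|/Px//]|Py]; by apply/psetM; left.
Qed.

(** Multiplication by x is injective on the domain R/P, with cokernel R/(P + xR). *)
Lemma hilb_diff P b (x : R) m : x \in G b -> ~ pset P x ->
  hilb P 0 (b + m) =
  (hilb P 0 m + krel (piece (b + m)) (pset P :+: cyc b (x : R^o) (b + m)))%N.
Proof.
move=> Gx Px; rewrite -(krel_mul_prime m Gx Px) sumsetC -krel_sumset //; last 3 first.
- exact: kfin_piece.
- exact: kfin_cyc.
- exact: ksub_pset.
rewrite /hilb sh0 sumsetC ksub_absorb //; first exact: gfam_ksub (gfam_cyc hR _ _).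
  exact: gfam_ksub (gfam_piece hR).
by apply: cyc_sub => //; apply: gfam_piece.
Qed.

(** Induction on n, a bound for dim R/P. With a linear form x outside P, the difference of the
    Hilbert function is that of R/(P + xR), of smaller dimension; without such a form R/P lives in
    degree 0. *)
Lemma evpoly_hilb n P : hprime P -> ~ above P n.+1 ->
  evpoly n (fun m => (hilb P 0 m)%:Z).
Proof.
elim: n P => [|n IH] P hP nP.
all: have [[x [Gx Px]]|nx] := pselect (exists x, x \in G 1%N /\ ~ pset P x); last first.
1,3: apply: (@evpoly_leq 0%N) => //; exists 1%N => m m0; rewrite /hilb sh0 krel_subset //.
1,2: by apply: piece_in_prime m0 => x Gx; apply: contrapT => Px; apply: nx; exists x.
(* In dimension 0 a linear form outside P would produce a prime strictly above P. *)
- have [s [_ sP /(_ isT)[y ys]]] := quotient_primes hP Gx.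
  exfalso; apply: nP; have [_ Py yx] := sP y ys.
  apply: (above_cons Py yx Px); exists (fun=> y.1); by split.
have [s [sE sP _]] := quotient_primes hP Gx.
have : evpoly n (fun m => (\sum_(y <- s) hilb y.1 y.2 m)%:Z).
  have H : forall y, y \in s -> evpoly n (fun m => (hilb y.1 y.2 m)%:Z).
    move=> y ys; apply: evpoly_hilb_shift; have [hy Py yx] := sP y ys.
    by apply: IH => // ay; apply: nP; exact: (above_cons Py yx Px ay).
  elim: s {sE sP} H => [|y s IHs] H.
    by apply: (@evpoly_eventually _ (fun=> 0) _ 0%N) (evpoly0 n) => m _; rewrite big_nil.
  have Hs : forall y, y \in s -> evpoly n (fun m => (hilb y.1 y.2 m)%:Z).
    by move=> z zs; apply: H; rewrite inE zs orbT.
  apply: (@evpoly_eventually _ _ _ 0%N) (evpolyD (H y (mem_head _ _)) (IHs Hs)) => m _.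
  by rewrite big_cons PoszD.
move=> /evpolyS; apply: (@evpoly_eventually _ _ _ 0%N) => m _.
by rewrite -sE -[m.+1]add1n (hilb_diff m Gx Px) PoszD addrC addKr.
Qed.

End Hilbert.

Definition zerofam (V : zmodType) (m : nat) : set V := [set 0].

(** * Hilbert-Kunz estimates *)

Section Estimates.
Variables (k : fieldType) (R : comAlgType k) (G : nat -> {pred R}).
Hypothesis hR : standard_graded G.
Variable e : nat.
Hypothesis dim_le : forall P : spectrum R, ~ above P e.+3.
Variable fs : seq (nat * R).
Hypothesis hfs : homog_seq G fs.

Local Notation piece := (piece G).
Local Notation cyc := (cyc G).
Local Notation gfam := (gfam G).
Local Notation pfilt := (pfilt hR).
Local Notation hprime := (hprime hR).
Local Notation kfin_piece := (kfin_piece hR).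
Local Notation hilb := (hilb G).
Local Notation J := (powers_fam fs).
Implicit Types P Q : spectrum R.

(* dim R/P = dim R; the dimension is e + 2 throughout. *)
Definition big P := above P e.+2.

Lemma big_minimal P Q : big Q -> pset P `<=` pset Q -> P = Q.
Proof.
move=> bQ PQ; apply: pset_inj; apply/seteqP; split=> // x Qx.
by apply: contrapT => Px; apply: (dim_le (above_cons PQ Qx Px bQ)).
Qed.

(** Here dim R/P is at most e + 1, so the Hilbert polynomial has degree at most e, the order of the
    error terms. *)
Lemma hilb_small P a : hprime P -> ~ big P ->
  exists C, forall m, (hilb P a m <= C * m.+1 ^ e)%N.
Proof.
move=> hP nP; have := evpoly_bigO (leqnn _) (evpoly_hilb_shift a (evpoly_hilb hP nP)).
by move=> [C hC]; exists C => m; have := hC m; rewrite normr_Posz lez_nat.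
Qed.

Lemma sum_small (I : eqType) (s : seq I) (u : I -> nat -> nat) :
  (forall i, i \in s -> exists C, forall m, (u i m <= C * m.+1 ^ e)%N) ->
  exists C, forall m, (\sum_(i <- s) u i m <= C * m.+1 ^ e)%N.
Proof.
elim: s => [|i s IH] H; first by exists 0%N => m; rewrite big_nil.
have [C uC] := H i (mem_head _ _).
have [|D uD] := IH; first by move=> j js; apply: H; rewrite inE js orbT.
by exists (C + D)%N => m; rewrite big_cons mulnDl leq_add.
Qed.

(** A top-dimensional prime above P equals P, whereas all primes of the filtration contain x. *)
Lemma quotient_small P b (x : R) : hprime P -> x \in G b -> ~ pset P x ->
  exists C, forall m, (krel (piece m) (pset P :+: cyc b (x : R^o) m) <= C * m.+1 ^ e)%N.
Proof.
move=> hP Gx Px; have [s [sE sP _]] := quotient_primes hP Gx.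
have [C sC] : exists C, forall m, (\sum_(y <- s) hilb y.1 y.2 m <= C * m.+1 ^ e)%N.
  apply: sum_small => y ys; have [hy Py yx] := sP y ys; apply: hilb_small => // bigy.
  by apply: Px; rewrite (big_minimal bigy Py).
by exists C => m; rewrite sE.
Qed.

(* The length of (R/(P + I^[q]))(-a) in degree m. *)
Definition hk q P a m := krel (sh a piece m) (pset P :+: sh a (J q piece) m).

Lemma gfam_Jpiece q : gfam (J q piece). Proof. exact: gfam_J (gfam_piece hR). Qed.

Lemma ksub_Jpiece q a m : ksub (sh a (J q piece) m).
Proof. by apply: gfam_ksub (gfam_sh a (gfam_Jpiece q)). Qed.

Lemma kfin_shpiece a m : kfin (sh a piece m).
Proof. by apply: kfin_sh => i; apply: kfin_piece. Qed.

Lemma hkE q P a m : hk q P a m = if (a <= m)%N then hk q P 0 (m - a) else 0%N.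
Proof.
rewrite /hk !sh0 /sh; case: ifP => // _; rewrite sumset0.
by apply: krel_set0; apply: ksub_pset.
Qed.

Lemma ksub_hk q P a m : ksub (pset P :+: sh a (J q piece) m).
Proof. by apply: ksub_sumset; [exact: ksub_pset | exact: ksub_Jpiece]. Qed.

Lemma hk_le_hilb q P a m : (hk q P a m <= hilb P a m)%N.
Proof.
apply: krel_subr; [exact: kfin_shpiece|exact: ksub_pset|exact: ksub_hk|].
by apply: ksub_subl; apply: ksub_Jpiece.
Qed.

Lemma krel_mono (V : lmodType R) (X T T' : set V) : kfin X -> ksub T -> ksub T' ->
  (forall x, X x -> T x -> T' x) -> (krel X T' <= krel X T)%N.
Proof.
move=> fX sT sT' H; rewrite (@krel_cap _ _ _ X T X) //.
apply: krel_subr => //; first by apply: ksubI => //; exact: kfin_ksub.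
by move=> x [Tx Xx]; apply: H.
Qed.

Lemma ksub_act (V : lmodType R) (v : V) T : ksub T ->
  ksub [set b : R^o | T ((b : R) *: v)].
Proof. by move=> sT; apply: (ksub_preimage (linear_act v) sT). Qed.

(** Modulo P + I^[q]F', each summand f^q F of I^[q]F is an image of a shift of F/(P + F'). There are
    [size fs] of them, whatever q is. *)
Lemma J_krel q (F F' : nat -> set R^o) P m B : gfam F -> gfam F' ->
  (forall n, kfin (F n)) ->
  (forall n, (n <= m)%N -> (krel (F n) (pset P :+: F' n) <= B)%N) ->
  (krel (J q F m) (pset P :+: J q F' m) <= size fs * B)%N.
Proof.
move=> gF gF' fF FB; elim: fs => [|df fs' IH] /=.
  by rewrite krel_set0 // sumset0; apply: ksub_pset.
have sP := ksub_pset P.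
have sJ : ksub (powers_fam fs' q F' m) := ksub_J _ _ _ gF'.
have sS : ksub (smul (df.2 ^+ q) (sh (q * df.1) F' m)).
  by apply: ksub_smul; apply: gfam_ksub (gfam_sh _ gF').
have sT := ksub_sumset sP (ksub_sumset sS sJ).
have fX : kfin (sh (q * df.1) F m) by apply: kfin_sh.
have fJ : kfin (powers_fam fs' q F m) by apply: kfin_J.
apply: leq_trans (krel_subadd (kfin_smul _ fX) fJ sT) _.
rewrite mulSn leq_add //; last first.
  apply: leq_trans IH; apply: krel_subr => //; first exact: ksub_sumset.
  by apply: sumsetS => //; apply: ksub_subr.
apply: (@leq_trans (krel (sh (q * df.1) F m) (pset P :+: sh (q * df.1) F' m))).
  apply: (krel_image_le (linear_smul _)) => //.
    by apply: ksub_sumset => //; apply: gfam_ksub (gfam_sh _ gF').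
  move=> _ [p [b [Pp Fb ->]]]; exists (df.2 ^+ q * p), (df.2 ^+ q * b).
  split; [by apply/psetM; right | | by rewrite /GRing.scale /= mulrDr].
  by apply: ksub_subl => //; exists b.
rewrite /sh; case: ifP => le; last by rewrite sumset0 krel_set0.
by apply: FB; apply: leq_subr.
Qed.

Lemma hk_prime_ideal q P m : (forall x, x \in G 1%N -> pset P x) -> (0 < m)%N ->
  hk q P 0 m = 0%N.
Proof.
move=> G1 m0; apply: krel_subset; rewrite sh0; apply: subset_trans (piece_in_prime hR G1 m0) _.
by apply: ksub_subl; apply: ksub_Jpiece.
Qed.

Lemma cyc1_piece (x : R) m : x \in G 1%N -> cyc 1 (x : R^o) m `<=` piece m.
Proof. by move=> Gx; apply: cyc_sub => //; apply: gfam_piece. Qed.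

(** Multiplication by a linear form x outside P has as cokernel a quotient of R/(P + xR), which is
    small. *)
Lemma hk_succ_le P : hprime P -> exists C, forall q m,
  (hk q P 0 m.+1 <= hk q P 0 m + C * m.+2 ^ e)%N.
Proof.
move=> hP; have [[x [Gx Px]]|nx] := pselect (exists x, x \in G 1%N /\ ~ pset P x); last first.
  exists 0%N => q m; rewrite hk_prime_ideal // => x Gx.
  by apply: contrapT => Px; apply: nx; exists x.
have [C qC] := quotient_small hP Gx Px; exists C => q m.
rewrite /hk !sh0.
have sP := ksub_pset P; have sJ := gfam_ksub m.+1 (gfam_Jpiece q).
have sT := ksub_sumset sP sJ.
have sc := gfam_ksub m.+1 (gfam_cyc hR 1 (x : R^o)).
have fc := kfin_cyc hR 1 (x : R^o) m.+1.
have sG := gfam_ksub m.+1 (gfam_piece hR).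
rewrite -[X in (krel X _ <= _)%N](ksub_absorb sc sG (cyc1_piece Gx)).
rewrite (sumsetC (cyc _ _ _) (piece _)) krel_sumset //; last exact: kfin_piece.
apply: leq_add.
  rewrite (krel_cyc _ _ _ kfin_piece) // -{1}[m.+1]addn1 sh_id.
  apply: krel_mono; [exact: kfin_piece | | exact: ksub_act |].
    by apply: ksub_sumset => //; apply: gfam_ksub (gfam_Jpiece q).
  move=> _ _ [p [j [Pp Jj ->]]]; exists (p * x), (j * x).
  split; [by apply/psetM; left | | by rewrite /= scalerDl].
  by have := proj2 (gfam_Jpiece q) _ _ _ _ Gx Jj; rewrite add1n /GRing.scale /= mulrC.
apply: leq_trans (qC m.+1).
apply: krel_subr; [exact: kfin_piece | exact: ksub_sumset | exact: ksub_sumset |].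
by rewrite sumsetC; apply: sumsetS => //; apply: ksub_subl.
Qed.

(** Modulo P, multiplication by x identifies R/I^[q] with xR/I^[q]xR. The loss is then at most the
    length of I^[q]/I^[q]xR, a sum of images of [size fs] copies of R/xR. *)
Lemma hk_le_succ P : hprime P -> exists C, forall q m,
  (hk q P 0 m <= hk q P 0 m.+1 + C * m.+2 ^ e)%N.
Proof.
move=> hP; have [[x [Gx Px]]|nx] := pselect (exists x, x \in G 1%N /\ ~ pset P x); last first.
  (* If P contains R_1, only the degree 0 part of R/P is nonzero. *)
  exists (hilb P 0 0) => q [|m].
    apply: leq_trans (hk_le_hilb _ _ _ _) _; apply: leq_trans (leq_addl _ _).
    by rewrite leq_pmulr // expn_gt0.
  rewrite hk_prime_ideal // => x Gx.
  by apply: contrapT => Px; apply: nx; exists x.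
have [C qC] := quotient_small hP Gx Px; exists (size fs * C)%N => q m.
rewrite /hk !sh0.
have gc := gfam_cyc hR 1 (x : R^o).
have sP := ksub_pset P; have sJ := gfam_ksub m.+1 (gfam_Jpiece q).
have sJm := gfam_ksub m (gfam_Jpiece q).
have sc := gfam_ksub m.+1 gc.
have fc := kfin_cyc hR 1 (x : R^o) m.+1.
have sG := gfam_ksub m.+1 (gfam_piece hR).
have fJ : kfin (J q piece m.+1) by apply: kfin_J => j; apply: kfin_piece.
have sJc : ksub (J q (cyc 1 (x : R^o)) m.+1) := ksub_J _ _ _ gc.
have sT := ksub_sumset sP sJc.
apply: (@leq_trans (krel (cyc 1 (x : R^o) m.+1) (pset P :+: J q (cyc 1 (x : R^o)) m.+1))).
  rewrite (krel_cyc _ _ _ kfin_piece) // -{1}[m.+1]addn1 sh_id.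
  apply: krel_mono; [exact: kfin_piece | exact: ksub_act | exact: ksub_sumset |].
  move=> b Gb [p [w [Pp + e1]]]; rewrite J_cyc -[m.+1]addn1 sh_id => -[j Jj e2].
  exists (b - j), j; split=> //; last by rewrite subrK.
  have : pset P ((b - j) * x).
    suff -> : (b - j) * x = p by [].
    by move: e1; rewrite -e2 /GRing.scale /= => e1; rewrite mulrBl e1 addrK.
  by move=> /psetM[].
apply: (@leq_trans (krel (piece m.+1 :+: J q piece m.+1) (pset P :+: J q (cyc 1 (x : R^o)) m.+1))).
  apply: krel_subl => //; first by apply: kfin_sumset => //; exact: kfin_piece.
  move=> y cy; apply: ksub_subl => //; apply: ksub_subl => //.
  exact: cyc1_piece cy.
rewrite krel_sumset //; last exact: kfin_piece.
rewrite addnC; apply: leq_add.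
  apply: krel_subr; [exact: kfin_piece | exact: ksub_sumset | exact: ksub_sumset |].
  by rewrite sumsetC; apply: sumsetS => //; apply: ksub_subl.
rewrite -mulnA; apply: J_krel => //; [exact: gfam_piece | exact: kfin_piece |].
move=> n le; apply: leq_trans (qC n) _; rewrite leq_mul2l; apply/orP; right.
by case: (e) => // e'; rewrite leq_exp2r.
Qed.

Lemma leq_small C m m' : (m <= m')%N -> (C * m.+1 ^ e <= C * m'.+1 ^ e)%N.
Proof.
by move=> le; rewrite leq_mul2l; apply/orP; right; case: (e) => // e'; rewrite leq_exp2r.
Qed.

Lemma hk_shift P a : hprime P -> exists C, forall q m,
  (hk q P 0 m <= hk q P a m + C * m.+1 ^ e)%N /\
  (hk q P a m <= hk q P 0 m + C * m.+1 ^ e)%N.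
Proof.
move=> hP; have [C up] := hk_succ_le hP; have [D down] := hk_le_succ hP.
(* [hilb P 0 0] accounts for m = a, where the shift by a + 1 vanishes while the shift by a is in
   degree 0. *)
pose B := maxn (hilb P 0 0) (maxn C D).
have CB q m : (hk q P 0 m.+1 <= hk q P 0 m + B * m.+2 ^ e)%N.
  apply: leq_trans (up q m) _; rewrite leq_add2l leq_mul2r /B; lia.
have DB q m : (hk q P 0 m <= hk q P 0 m.+1 + B * m.+2 ^ e)%N.
  apply: leq_trans (down q m) _; rewrite leq_add2l leq_mul2r /B; lia.
elim: a => [|a [E IH]]; first by exists 0%N => q m; rewrite mul0n addn0.
exists (E + B)%N => q m.
have [h1 h2] : (hk q P a m <= hk q P a.+1 m + B * m.+1 ^ e)%N /\
    (hk q P a.+1 m <= hk q P a m + B * m.+1 ^ e)%N.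
  rewrite (hkE q P a) (hkE q P a.+1).
  case: (ltngtP m a) => [lt|lt|->]; first by split.
    have -> : (m - a = (m - a.+1).+1)%N by lia.
    have le : ((m - a.+1).+1 <= m)%N by lia.
    split.
      apply: leq_trans (CB _ _) _; rewrite leq_add2l; exact: leq_small.
    apply: leq_trans (DB _ _) _; rewrite leq_add2l; exact: leq_small.
  rewrite ?ltnn ?subnn; split=> //.
  apply: leq_trans (hk_le_hilb _ _ _ _) _; apply: (@leq_trans B); first by rewrite /B leq_maxl.
  by rewrite leq_pmulr // expn_gt0.
have [h3 h4] := IH q m; rewrite mulnDl; lia.
Qed.

(* The length of H/(L + I^[q] H) in degree m. *)
Definition hkm (V : lmodType R) q (L H : nat -> set V) m := krel (H m) (L m :+: J q H m).

Section Module.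
Variable V : lmodType R.
Implicit Types (L H : nat -> set V).

Lemma hkm_subadditive L H s q m : gfam L -> (forall n, kfin (L n)) -> pfilt L H s ->
  (hkm q L H m <= \sum_(x <- s) hk q x.1 x.2 m)%N.
Proof.
move=> gL fL; elim=> [|{}H {}s P a v LH IH hP vP].
  rewrite big_nil leqn0; apply/eqP/krel_subset.
  by apply: ksub_subl; apply: ksub_J gL.
have gH := pfilt_gfam gL LH.
have fH n : kfin (H n) := pfilt_kfin (fL n) LH.
have gc := gfam_cyc hR a v; have gH' := gfam_fadd gH gc.
have sL := gfam_ksub m gL; have sH := gfam_ksub m gH.
have sJ' : ksub (J q (fadd H (cyc a v)) m) := ksub_J _ _ _ gH'.
have sJ : ksub (J q H m) := ksub_J _ _ _ gH.
have sJc : ksub (J q (cyc a v) m) := ksub_J _ _ _ gc.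
have fc := kfin_cyc hR a v m.
have sT := ksub_sumset sL sJ'.
rewrite big_cons /= /hkm {1}/fadd sumsetC krel_sumset // addnC; apply: leq_add.
  rewrite (krel_cyc _ _ _ kfin_piece); last exact: ksub_sumset.
  apply: krel_mono; [exact: kfin_shpiece | exact: ksub_hk | |].
    by apply: ksub_act; apply: ksub_sumset.
  move=> b Gb [p [j [Pp Jj e1]]]; rewrite e1 in Gb *.
  exists (p *: v), (j *: v); split; last by rewrite scalerDl.
    have {Gb} : sh a piece m p.
      apply: ksubDr Gb; first by apply: gfam_ksub (gfam_sh a (gfam_piece hR)).
      by apply: sh_sub Jj => n; apply: J_sub hfs (gfam_piece hR).
    rewrite /sh; case: leqP => [le Gp|_ ->]; last by rewrite scale0r; apply: ksub0.
    by rewrite -(subnK le); apply/vP.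
  apply: ksub_subr => //; rewrite J_fadd; apply: ksub_subr => //.
  by rewrite J_cyc; exists j.
apply: leq_trans IH; apply: krel_subr => //; first exact: ksub_sumset.
by apply: sumsetS => //; rewrite J_fadd; apply: ksub_subl.
Qed.

(* The Tor-free comparison: adjoining a generator v to H changes the colength by
   that of R/A, where A is the annihilator of v modulo H. *)
Lemma hkm_cyclic H a v (A : nat -> set R^o) (Z : set R^o) q m :
  gfam H -> (forall n, kfin (H n)) -> gideal G A -> ksub Z ->
  (forall i b, b \in G i -> (A i b <-> H (i + a)%N (b *: v))) ->
  (forall b, Z b -> (b : R) *: v = 0) ->
  (hkm q (@zerofam V) H m + krel (sh a piece m) (Z :+: sh a (J q piece) m) <=
   hkm q (@zerofam V) (fadd H (cyc a v)) m + krel (sh a A m) (Z :+: sh a (J q A) m))%N.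
Proof.
move=> gH fH [gA AG] sZ vA Zv.
have gc := gfam_cyc hR a v; have gH' := gfam_fadd gH gc.
have sH := gfam_ksub m gH.
have fc := kfin_cyc hR a v m.
set shG := sh a piece m; set shA := sh a A m.
set shJ := sh a (J q piece) m; set shJA := sh a (J q A) m.
have fG : kfin shG := kfin_shpiece a m.
have sG := kfin_ksub fG.
have sA : ksub shA by apply: gfam_ksub (gfam_sh a gA).
have sJ : ksub shJ := ksub_Jpiece q a m.
have sJA : ksub shJA by apply: gfam_ksub (gfam_sh a (gfam_J fs q gA)).
have AsG : shA `<=` shG by apply: sh_sub.
have JsG : shJ `<=` shG.
  by apply: sh_sub => n; apply: J_sub hfs (gfam_piece hR).
have JAsJ : shJA `<=` shJ by apply: sh_sub => n; apply: J_mono.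
have JAsA : shJA `<=` shA by apply: sh_sub => n; apply: J_sub hfs gA.
have fA := kfin_sub sA AsG fG.
have vAsh b : shG b -> (shA b <-> H m ((b : R) *: v)).
  rewrite /shG /shA /sh; case: leqP => [le Gb|_ ->].
    by rewrite -{2}(subnK le); apply: vA.
  by rewrite scale0r; split=> // _; apply: ksub0.
have sJH : ksub (J q H m) := ksub_J _ _ _ gH.
have sJc : ksub (J q (cyc a v) m) := ksub_J _ _ _ gc.
pose X := J q H m :+: J q (cyc a v) m.
have sX : ksub X := ksub_sumset sJH sJc.
have JHH : J q H m `<=` H m by apply: J_sub hfs gH.
rewrite /hkm /zerofam !sumset0l J_fadd -/X.
have -> : krel (fadd H (cyc a v) m) X = (krel (H m) X + krel (cyc a v m) (H m :+: X))%N.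
  by rewrite /fadd sumsetC krel_sumset.
have -> : krel (cyc a v m) (H m :+: X) = krel shG (shA :+: shJ).
  rewrite (krel_cyc _ _ _ kfin_piece); last exact: ksub_sumset.
  apply: krel_eq => b Gb; split=> [[h [x [Hh [w [c [Jw Jc ->]]] e1]]]|[b1 [j [Ab1 Jj e1]]]].
    move: Jc e1; rewrite J_cyc => -[j Jj <-] e1.
    exists (b - j), j; split=> //; last by rewrite subrK.
    apply/vAsh; first by apply: ksubB => //; apply: JsG.
    suff -> : (b - j) *: v = h + w by apply: ksubD => //; apply: JHH.
    by rewrite scalerBl e1 addrA addrK.
  exists (b1 *: v), (j *: v); split; last by rewrite e1 scalerDl.
    by apply/vAsh => //; apply: AsG.
  by apply: ksub_subr => //; rewrite J_cyc; exists j.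
have le1 : (krel shG (Z :+: shJ) <= krel shA (Z :+: shJ) + krel shG (shA :+: shJ))%N.
  rewrite -[X in (krel X _ <= _)%N](ksub_absorb sA sG AsG) (sumsetC shA shG).
  rewrite krel_sumset //; last exact: ksub_sumset.
  rewrite leq_add2l; apply: krel_subr => //; try exact: ksub_sumset.
    by apply: ksub_sumset => //; apply: ksub_sumset.
  by apply: sumsetS => //; apply: ksub_subr.
(* With H' = H + Rv, Y modulo I^[q]H is the kernel of H/I^[q]H -> H'/I^[q]H', and YA gives that of
   A/(Z + I^[q]A) -> R/(Z + I^[q]). *)
pose Y := X `&` H m; pose YA := (Z :+: shJ) `&` shA.
have sZJ := ksub_sumset sZ sJ.
have sY : ksub Y := ksubI sX sH.
have fY : kfin Y by apply: kfin_sub (fH m) => // y [].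
have fYA : kfin YA by apply: kfin_sub fA => [|y []//]; apply: ksubI.
have e1 : krel (H m) (J q H m) = (krel Y (J q H m) + krel (H m) X)%N.
  rewrite -{1}(@ksub_absorb _ _ _ Y (H m)) // => [|y []//].
  rewrite (sumsetC Y) krel_sumset //; congr (_ + _)%N; apply: krel_eq => h Hh; split.
    move=> [y [w [[Xy _] Jw ->]]]; apply: ksubD => //.
    by apply: ksub_subl.
  by move=> Xh; apply: ksub_subl.
have e2 : (krel shA (Z :+: shJA) = krel YA (Z :+: shJA) + krel shA (Z :+: shJ))%N.
  have sYA := kfin_ksub fYA.
  rewrite -{1}(@ksub_absorb _ _ _ YA shA) // => [|y []//].
  rewrite (sumsetC YA) krel_sumset //; last exact: ksub_sumset.
  congr (_ + _)%N; apply: krel_eq => h Hh; split.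
    move=> [y [w [[Xy _] Jw ->]]]; apply: ksubD => //.
    by apply: sumsetS Jw.
  by move=> Xh; apply: ksub_subl; [exact: ksub_sumset | split].
(* The map b -> bv sends the second kernel onto the first; it is well defined because Z kills v. *)
suff : (krel Y (J q H m) <= krel YA (Z :+: shJA))%N by lia.
apply: (@leq_trans (krel [set (b : R) *: v | b in YA] (J q H m))).
  apply: krel_subl => //; first exact: kfin_image (linear_act v) _ fYA.
  move=> y [[w [c [Jw Jc ->]]]]; move: Jc; rewrite J_cyc => -[j Jj <-] Hwj.
  exists (j *: v), w; split=> //; last by rewrite addrC.
  exists j => //; split; first exact: ksub_subr.
  apply/vAsh; first exact: JsG.
  by rewrite addrC in Hwj; exact: (ksubDr sH (JHH _ Jw) Hwj).
apply: (krel_image_le (linear_act v)) => //; first exact: ksub_sumset.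
move=> _ [z [b [Zz Ab ->]]]; rewrite /= scalerDl Zv // add0r.
have actH n : act a v A n `<=` H n.
  move=> _ [c + <-]; rewrite /sh; case: leqP => [le Ac|_ ->].
    by rewrite -(subnK le); apply/vA => //; apply: AG.
  by rewrite scale0r; apply: gfam0 gH.
apply: (J_mono actH); rewrite /act (J_image _ _ _ _ (linear_act v)).
by exists b; rewrite // -sh_J.
Qed.

End Module.

End Estimates.

Lemma sumn_cons (I : Type) (i : I) (r : seq I) (F : I -> nat) :
  (\sum_(j <- i :: r) F j = F i + \sum_(j <- r) F j)%N.
Proof. exact: big_cons. Qed.

(** * Modules killed by the nilradical *)

Section Reduced.
Variables (k : fieldType) (R : comAlgType k) (G : nat -> {pred R}).
Hypothesis hR : standard_graded G.
Variable e : nat.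
Hypothesis dim_le : forall P : spectrum R, ~ above P e.+3.
Variable fs : seq (nat * R).
Hypothesis hfs : homog_seq G fs.

Local Notation dG := (piece_direct hR).
Local Notation piece := (piece G).
Local Notation cyc := (cyc G).
Local Notation gfam := (gfam G).
Local Notation pfilt := (pfilt hR).
Local Notation hprime := (hprime hR).
Local Notation kfin_piece := (kfin_piece hR).
Local Notation hilb := (hilb G).
Local Notation J := (powers_fam fs).
Local Notation hk := (hk G fs).
Local Notation big := (big e).
Implicit Types P Q : spectrum R.

Lemma gfam_zerofam (V : lmodType R) : gfam (@zerofam V).
Proof. by split=> [m|i j b v _ ->]; [exact: ksub_set0 | rewrite /zerofam /= scaler0]. Qed.

Lemma kfin_zerofam (V : lmodType R) m : kfin (@zerofam V m).
Proof. exact: kfin_set0. Qed.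

(** Each multiplication by x descends one factor. The element x may be inhomogeneous, since its
    components lie in the same homogeneous primes. *)
Lemma bar_pfilt_mul (L H : nat -> set R^o) s (x : R) : gfam L -> pfilt L H s ->
  (forall y, y \in s -> pset y.1 x) ->
  forall v : R, bar hR H v -> bar hR L (x ^+ size s * v).
Proof.
move=> gL; elim=> [|{}H {}s P a w LH IH hP wP] sx v Hv; first by rewrite mul1r.
have gH := pfilt_gfam gL LH.
rewrite /= exprSr -mulrA; apply: IH => [y ys|m]; first by apply: sx; rewrite inE ys orbT.
rewrite hcompM; apply: (ksub_sum _ (gfam_ksub m gH)) => i.
have im : (i <= m)%N by rewrite -ltnS.
have [h [_ [Hh [b + <-] ->]]] := Hv (m - i)%N.
rewrite mulrDr => Gb; apply: (ksubD (gfam_ksub m gH)).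
  by apply: (gfamZ gH (hcomp_in dG x i) im).
move: Gb; rewrite /sh; case: leqP => [le Gb|_ ->]; last first.
  by rewrite scale0r mulr0; apply: gfam0 gH.
have Gxb := pieceM hR (hcomp_in dG x i) Gb.
have : H (i + (m - i - a) + a)%N ((hcomp dG x i * b) *: w).
  apply/wP => //; apply/psetM; left; apply: hP; apply: (sx (P, a)); exact: mem_head.
have -> : (i + (m - i - a) + a = m)%N by lia.
by rewrite -scalerA.
Qed.

Section Radical.
Variable sR : seq (spectrum R * nat).
Hypothesis psR : pfilt (@zerofam R^o) piece sR.

(** The nilradical, presented by the primes of a filtration of R: this yields the nilpotency
    exponent [size sR], which later decides how large Q must be. *)
Definition rad : set R^o := [set x | forall y, y \in sR -> pset y.1 x].
Definition radfam m : set R^o := rad `&` piece m.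

Lemma submod_rad : submod rad.
Proof.
split=> [y _|a u v Zu Zv y ys]; first exact: submod0 (submod_pset _).
exact: (proj2 (submod_pset y.1)) (Zu y ys) (Zv y ys).
Qed.

Lemma ksub_rad : ksub rad. Proof. exact/submod_ksub/submod_rad. Qed.

Lemma gideal_radfam : gideal G radfam.
Proof.
split; last by move=> m x [].
split=> [m|i j b v Gb [Zv Gv]].
  by apply: ksubI; [exact: ksub_rad | exact: gfam_ksub (gfam_piece hR)].
by split; [exact: submodZ submod_rad Zv | exact: (pieceM hR)].
Qed.

Lemma rad_nilpotent (x : R) : rad x -> x ^+ size sR = 0.
Proof.
move=> Zx; have H : bar hR piece (1 : R) by move=> m; apply: hcomp_in.
have := bar_pfilt_mul (gfam_zerofam _) psR Zx H; rewrite mulr1 => Lx.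
have [n xn] := hcomp_fin dG (x ^+ size sR); have [_ ->] := xn n (leqnn n).
by rewrite big1 // => i _; apply: Lx.
Qed.

(** A top-dimensional P is minimal, so no other prime of l lies inside it; c is a product of
    homogeneous elements of these primes chosen outside P. *)
Lemma separate (l : seq (spectrum R)) P : big P -> (forall Q, Q \in l -> hprime Q) ->
  exists i (c : R), [/\ c \in G i, ~ pset P c & forall Q, Q \in l -> Q <> P -> pset Q c].
Proof.
move=> bP; elim: l => [|Q l IH] hl.
  by exists 0%N, 1; split; [exact: piece1 | exact: pset1 |].
have [|i [c [Gc Pc lc]]] := IH; first by move=> Q' Q'l; apply: hl; rewrite inE Q'l orbT.
have [QP|QP] := eqVneq Q P.
  by exists i, c; split=> // Q'; rewrite inE => /predU1P[->|/lc//]; rewrite QP.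
have [j [z [Gz Qz Pz]]] : exists j (z : R), [/\ z \in G j, pset Q z & ~ pset P z].
  apply: contrapT => nz; move/eqP: QP; apply; apply: (big_minimal dim_le bP).
  apply: (hprime_sub (hl Q (mem_head _ _))) => j z Gz Qz; apply: contrapT => Pz.
  by apply: nz; exists j, z.
exists (j + i)%N, (z * c); split.
- exact: (pieceM hR).
- by move=> /psetM[].
move=> Q'; rewrite inE => /predU1P[-> _|Q'l ne]; apply/psetM; [left => // | right].
exact: lc.
Qed.

(* Modulo the radical R is reduced, so each top-dimensional prime occurs at most
   once in a filtration of R/rad. *)
Lemma pfilt_rad_count (H : nat -> set R^o) s P : big P -> pfilt radfam H s ->
  (forall m, H m `<=` piece m) ->
  (count (fun y => y.1 == P) s <= 1)%N /\
  (has (fun y => y.1 == P) s -> exists j x, H j x /\ ~ pset P x).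
Proof.
move=> bP; have hsR Q : Q \in [seq y.1 | y <- sR] -> hprime Q.
  by move=> /mapP[y ys ->]; apply: pfilt_hprime psR ys.
have [i [c [Gc Pc cl]]] := separate bP hsR.
have gZ := proj1 gideal_radfam.
elim=> [|{}H {}s P' a v LH IH hP vP] HG; first by [].
have gH := pfilt_gfam gZ LH; have gc := gfam_cyc hR a v.
have HG' m : H m `<=` piece m.
  by apply: subset_trans (HG m); apply: ksub_subl; apply: gfam_ksub gc.
have H'v : fadd H (cyc a v) a v.
  by apply: ksub_subr (gfam_ksub _ gH) _ (cyc_gen hR _ _).
have Gv : v \in G a := HG _ _ H'v.
have [IH1 IH2] := IH HG'.
rewrite /=; have [e1|ne] := eqVneq P' P; last first.
  split=> // /IH2[j [x [Hx Px]]]; exists j, x; split=> //.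
  by apply: ksub_subl Hx; apply: gfam_ksub gc.
(* If v were in P, then cv would lie in every prime of [sR], hence in the radical; c would
   annihilate v modulo H and so belong to P. *)
have Pv : ~ pset P v.
  move=> Pv; apply: Pc; rewrite -e1; apply/(vP i c Gc); apply: (pfilt_sub gZ LH).
  split; last exact: (pieceM hR).
  move=> y ys; have [ey|ney] := eqVneq y.1 P; first by rewrite ey; apply/psetM; right.
  by apply/psetM; left; apply: cl; [apply/mapP; exists y | apply/eqP].
split; last by move=> _; exists a, v.
(* An earlier occurrence leaves some x in H outside P; but xv lies in H, which puts x in the
   annihilator P of v. *)
have nh : ~~ has (fun y => y.1 == P) s.
  apply/negP => /IH2[j [x [Hx Px]]]; apply: Px; rewrite -e1.
  apply/(vP j x (HG' _ _ Hx)).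
  by have := proj2 gH _ _ _ _ Gv Hx; rewrite addnC /GRing.scale /= mulrC.
by move: nh; rewrite has_count -leqNgt leqn0 => /eqP->.
Qed.

Definition primes_meet (l : seq (spectrum R)) : set R^o :=
  [set x | forall P, P \in l -> pset P x].

Lemma ksub_primes_meet l : ksub (primes_meet l).
Proof.
split=> [P _|c u v lu lv P Pl]; first exact: ksub0 (ksub_pset P).
exact: (proj2 (ksub_pset P)) (lu P Pl) (lv P Pl).
Qed.

(** The primes are added one at a time. With S the meet of l plus I^[q] and T = P + I^[q], the
    modular law leaves the defect R/(S + T), a quotient of R/(P + cR) for some c in the meet but
    outside P. *)
Lemma primes_meet_lower (l : seq (spectrum R)) : uniq l ->
  (forall P, P \in l -> big P /\ hprime P) ->
  exists C, forall q m, (\sum_(P <- l) hk q P 0 m <=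
    krel (piece m) (primes_meet l :+: J q piece m) + C * m.+1 ^ e)%N.
Proof.
elim: l => [|P l IH] /=; first by exists 0%N => q m; rewrite big_nil.
move=> /andP[Pl ul] lP; have [bP hP] := lP P (mem_head _ _).
have {}lP Q : Q \in l -> big Q /\ hprime Q by move=> Ql; apply: lP; rewrite inE Ql orbT.
have [C lC] := IH ul lP.
have [i [c [Gc Pc cl]]] := separate bP (fun Q Ql => proj2 (lP Q Ql)).
have lc : primes_meet l c.
  by move=> Q Ql; apply: cl => // QP; rewrite -QP Ql in Pl.
have [D cD] := quotient_small dim_le hP Gc Pc.
exists (C + D)%N => q m; rewrite sumn_cons mulnDl.
have sG := gfam_ksub m (gfam_piece hR); have fG := kfin_piece m.
have sJ := gfam_ksub m (gfam_Jpiece hR fs q).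
have JG : J q piece m `<=` piece m by apply: J_sub hfs (gfam_piece hR).
have sl := ksub_primes_meet l; have sP := ksub_pset P.
pose S := (primes_meet l `&` piece m) :+: J q piece m.
pose T := (pset P `&` piece m) :+: J q piece m.
have sS : ksub S by apply: ksub_sumset => //; apply: ksubI.
have sT : ksub T by apply: ksub_sumset => //; apply: ksubI.
have SG : S `<=` piece m by apply: ksub_min => // x [].
have TG : T `<=` piece m by apply: ksub_min => // x [].
have restr (X : set R^o) : ksub X -> krel (piece m) (X :+: J q piece m) =
    krel (piece m) ((X `&` piece m) :+: J q piece m).
  move=> sX; apply: krel_eq => x Gx; split; last by apply: sumsetS => // y [].
  move=> [y [j [Xy Jj exy]]]; exists y, j; split=> //; split=> //.
  by apply: (ksubDr sG (JG _ Jj)); rewrite -exy.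
have le1 : (hk q P 0 m <= krel (piece m) T)%N by rewrite /hk !sh0 restr.
have le2 := lC q m; rewrite restr // -/S in le2.
have le3 := krel_cap_modular fG sS sT SG TG.
have le4 : (krel (piece m) (S `&` T) <=
    krel (piece m) (primes_meet (P :: l) :+: J q piece m))%N.
  apply: krel_mono => //.
  - by apply: ksub_sumset => //; exact: ksub_primes_meet.
  - exact: ksubI.
  move=> x Gx [y [j [ly Jj exy]]].
  have Gy : piece m y by apply: (ksubDr sG (JG _ Jj)); rewrite -exy.
  split; exists y, j; split=> //; split=> //.
    by move=> Q Ql; apply: ly; rewrite inE Ql orbT.
  by apply: ly; rewrite mem_head.
have le5 : (krel (piece m) (S :+: T) <= krel (piece m) (pset P :+: cyc i (c : R^o) m))%N.
  have gc := gfam_cyc hR i (c : R^o); have sc := gfam_ksub m gc.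
  have cG : cyc i (c : R^o) m `<=` piece m by apply: cyc_sub => //; apply: gfam_piece.
  apply: krel_mono => //; try exact: ksub_sumset.
  move=> x Gx [y [z [Py cz exy]]].
  have Gy : piece m y by apply: (ksubDr sG (cG _ cz)); rewrite -exy.
  exists z, y; split; [|by apply: ksub_subl; [|split]|by rewrite addrC].
  apply: ksub_subl => //; split; last exact: cG.
  case: cz => b _ <- Q Ql; apply/psetM; right; exact: lc.
have := cD m; move: le1 le2 le3 le4 le5.
set a1 := hk _ _ _ _; set a2 := \sum_(j <- l) _; set a3 := krel _ T; set a4 := krel _ S.
set a5 := krel _ (_ `&` _); set a6 := krel _ (S :+: T).
set a7 := krel _ (primes_meet (_ :: _) :+: _); set a8 := krel _ _; set x := (m.+1 ^ e)%N.
move: a1 a2 a3 a4 a5 a6 a7 a8 x; clear => a1 a2 a3 a4 a5 a6 a7 a8 x; lia.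
Qed.

Lemma pfilt_cyc (V : lmodType R) (H : nat -> set V) a v : gfam H ->
  exists (A : nat -> set R^o) s, [/\ gideal G A,
    forall i b, b \in G i -> (A i b <-> H (i + a)%N (b *: v)),
    pfilt A piece s &
    pfilt H (fadd H (cyc a v)) [seq (x.1, (x.2 + a)%N) | x <- s]].
Proof.
move=> gH; pose A i : set R^o := [set b | piece i b /\ H (i + a)%N ((b : R) *: v)].
have AP i b : b \in G i -> (A i b <-> H (i + a)%N (b *: v)).
  by move=> Gb; split=> [[]//|Hb]; split.
have gA : gideal G A.
  split; last by move=> m x [].
  split=> [m|i j b u Gb [Gu Hu]].
    apply: ksubI; first exact: gfam_ksub (gfam_piece hR).
    by apply: ksub_act; apply: gfam_ksub gH.
  split; first exact: (pieceM hR).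
  by have := proj2 gH _ _ _ _ Gb Hu; rewrite addnA scalerA.
have [s sP] := pfilt_gideal hR gA.
exists A, s; split=> //; apply: (pfilt_act (proj1 gA) gH sP _ AP) => m x.
by [].
Qed.

Lemma pfilt_gens (V : lmodType R) (H : nat -> set V) l : gfam H ->
  exists s, pfilt H (fadd H (gens G l)) s.
Proof.
move=> gH; elim: l => [|[a v] l [s IH]].
  exists [::]; suff -> : fadd H (gens G [::]) = H by apply: pfilt_nil.
  by apply/funext => m; rewrite /fadd /gens /= sumset0.
have [A [s' [_ _ _ ps]]] := pfilt_cyc a v (pfilt_gfam gH IH).
exists ([seq (x.1, (x.2 + a)%N) | x <- s'] ++ s).
suff -> : fadd H (gens G ((a, v) :: l)) = fadd (fadd H (gens G l)) (cyc a v).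
  exact: pfilt_cat IH ps.
by apply/funext => m; rewrite /fadd /gens /= -sumsetA (sumsetC (cyc a v m)).
Qed.

Lemma hk_sum_shift (s : seq (spectrum R * nat)) (a : nat -> nat) :
  (forall y, y \in s -> hprime y.1) ->
  exists C, forall q m,
  (\sum_(y <- s) hk q y.1 0 m <= \sum_(y <- s) hk q y.1 (a y.2) m + C * m.+1 ^ e)%N /\
  (\sum_(y <- s) hk q y.1 (a y.2) m <= \sum_(y <- s) hk q y.1 0 m + C * m.+1 ^ e)%N.
Proof.
elim: s => [|y s IH] hs; first by exists 0%N => q m; rewrite !big_nil.
have [|C sC] := IH; first by move=> z zs; apply: hs; rewrite inE zs orbT.
have [D yD] := hk_shift dim_le fs (a y.2) (hs y (mem_head _ _)).
exists (C + D)%N => q m; rewrite !sumn_cons mulnDl; have [h1 h2] := sC q m; have [h3 h4] := yD q m.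
split; [apply: leq_trans (leq_add h3 h1) _ | apply: leq_trans (leq_add h4 h2) _].
  by rewrite addnACA leq_add2l addnC.
by rewrite addnACA leq_add2l addnC.
Qed.

(** A filtration of A/rad bounds A/(rad + I^[q]A) from above. Joined to [sA] it filters R/rad, where
    no top-dimensional prime is repeated; so the sum over all factors exceeds the length of R/(rad +
    I^[q]) by O(m^e) at most. *)
Lemma rad_quotient_lower (A : nat -> set R^o) sA : gideal G A ->
  (forall m, radfam m `<=` A m) -> pfilt A piece sA ->
  exists C, forall q m, (\sum_(y <- sA) hk q y.1 0 m + krel (A m) (rad :+: J q A m) <=
    krel (piece m) (rad :+: J q piece m) + C * m.+1 ^ e)%N.
Proof.
move=> [gA AG] ZA psA; have [gZ ZG] := gideal_radfam.
have [l [lA Al]] := gideal_gens hR (conj gA AG).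
have [s0 ps0] := pfilt_gens l gZ.
have eA : fadd radfam (gens G l) = A.
  apply/funext => m; rewrite Al; apply: (@ksub_absorb k); [exact: gfam_ksub gZ | exact: ksub_gens|].
  by rewrite -Al.
rewrite eA in ps0; have ps := pfilt_cat ps0 psA.
set s := sA ++ s0 in ps.
have hs y : y \in s -> hprime y.1 by apply: pfilt_hprime ps.
(* The top-dimensional primes alone enter the lower bound; the others contribute O(m^e). *)
pose l' := [seq y.1 | y <- s & `[< big y.1 >]].
have ul : uniq l'.
  apply: count_mem_uniq => P; case: (boolP (P \in l')) => Pl; last by apply/count_memPn.
  have bP : big P by move: Pl => /mapP[y]; rewrite mem_filter => /andP[/asboolP + _ ->].
  have [le1 _] := pfilt_rad_count bP ps (fun m => @subset_refl _ (piece m)).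
  apply/eqP; rewrite eqn_leq -has_count has_pred1 Pl andbT.
  apply: leq_trans le1; rewrite count_map count_filter; apply: sub_count => y /=.
  by case/andP.
have lP P : P \in l' -> big P /\ hprime P.
  by move=> /mapP[y]; rewrite mem_filter => /andP[/asboolP bP ys ->]; split=> //; apply: hs.
have [C1 c1] := primes_meet_lower ul lP.
have fZ n : kfin (radfam n) := kfin_sub (gfam_ksub n gZ) (ZG n) (kfin_piece n).
have [|C2 c2] := @hk_sum_shift s0 id; first by move=> y ys; apply: hs; rewrite mem_cat ys orbT.
have [C3 c3] : exists C, forall q m,
    (\sum_(y <- s | ~~ `[< big y.1 >]) hk q y.1 0 m <= C * m.+1 ^ e)%N.
  have [C cC] : exists C, forall m,
      (\sum_(y <- [seq y <- s | ~~ `[< big y.1 >]]) hilb y.1 0 m <= C * m.+1 ^ e)%N.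
    apply: sum_small => y; rewrite mem_filter => /andP[/asboolPn nb ys].
    exact: hilb_small (hs y ys) nb.
  exists C => q m; apply: leq_trans (cC m); rewrite big_filter; apply: leq_sum => y _.
  exact: hk_le_hilb.
exists (C1 + C2 + C3)%N => q m; rewrite !mulnDl.
have h1 : (krel (A m) (rad :+: J q A m) <= \sum_(y <- s0) hk q y.1 y.2 m)%N.
  apply: leq_trans (hkm_subadditive hfs q m gZ fZ ps0).
  apply: krel_mono.
  - exact: kfin_sub (gfam_ksub m gA) (AG m) (kfin_piece m).
  - by apply: ksub_sumset; [exact: gfam_ksub gZ | exact: ksub_J gA].
  - by apply: ksub_sumset; [exact: ksub_rad | exact: ksub_J gA].
  by move=> x _; apply: sumsetS => // y [].
have h2 : (\sum_(P <- l') hk q P 0 m = \sum_(y <- s | `[< big y.1 >]) hk q y.1 0 m)%N.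
  by rewrite /l' big_map big_filter.
have h3 : (\sum_(y <- s) hk q y.1 0 m =
   \sum_(y <- sA) hk q y.1 0 m + \sum_(y <- s0) hk q y.1 0 m)%N.
  by rewrite /s big_cat.
have h4 : (\sum_(y <- s) hk q y.1 0 m = \sum_(y <- s | `[< big y.1 >]) hk q y.1 0 m +
   \sum_(y <- s | ~~ `[< big y.1 >]) hk q y.1 0 m)%N.
  by rewrite (bigID (fun y => `[< big y.1 >])).
have h5 : (krel (piece m) (primes_meet l' :+: J q piece m) <=
   krel (piece m) (rad :+: J q piece m))%N.
  have sJ := gfam_ksub m (gfam_Jpiece hR fs q).
  have JG : J q piece m `<=` piece m by apply: J_sub hfs (gfam_piece hR).
  have sG := gfam_ksub m (gfam_piece hR); have fG := kfin_piece m.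
  apply: krel_mono => //.
  - by apply: ksub_sumset => //; exact: ksub_rad.
  - by apply: ksub_sumset => //; exact: ksub_primes_meet.
  move=> x Gx [z [j [Zz Jj exz]]]; exists z, j; split=> // P /mapP[y].
  rewrite mem_filter => /andP[_ ys ->].
  have Gz : piece m z by apply: (ksubDr sG (JG _ Jj)); rewrite -exz.
  apply: (pfilt_annihilator gZ ps Gz _ ys) => n w Gw; split; last exact: (pieceM hR).
  by rewrite /GRing.scale /= mulrC; apply: (submodZ _ submod_rad Zz).
have := c1 q m; have := proj2 (c2 q m); have := c3 q m; lia.
Qed.

Section Good.
Variable V : lmodType R.
Hypothesis radV : forall (z : R) (v : V), rad z -> z *: v = 0.

(* The lower bound matching hkm_subadditive holds, up to lower order terms. *)
Definition good (H : nat -> set V) s := [/\ gfam H, forall n, kfin (H n),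
  pfilt (@zerofam V) H s &
  exists C, forall q m, (\sum_(y <- s) hk q y.1 0 m <= hkm fs q (@zerofam V) H m + C * m.+1 ^ e)%N].

Lemma good_zerofam : good (@zerofam V) [::].
Proof.
split; [exact: gfam_zerofam | exact: kfin_zerofam | exact: pfilt_nil |].
by exists 0%N => q m; rewrite big_nil.
Qed.

(** The length of A/(rad + I^[q]A) stands on opposite sides of [hkm_cyclic] and
    [rad_quotient_lower], and cancels when the two are added. *)
Lemma good_cyc H s a v : good H s -> exists s',
  pfilt H (fadd H (cyc a v)) s' /\ good (fadd H (cyc a v)) (s' ++ s).
Proof.
move=> [gH fH psH [C1 c1]].
have [A [sA [gA AP psA psH']]] := pfilt_cyc a v gH.
exists [seq (x.1, (x.2 + a)%N) | x <- sA]; split=> //.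
have gH' := gfam_fadd gH (gfam_cyc hR a v).
split=> //.
- by move=> n; apply: kfin_sumset => //; apply: kfin_cyc.
- exact: pfilt_cat psH psH'.
have ZA m : radfam m `<=` A m.
  by move=> z [Zz Gz]; apply/AP => //; rewrite radV //; apply: gfam0 gH.
have [C2 c2] := rad_quotient_lower gA ZA psA.
have hsA y : y \in sA -> hprime y.1 by apply: pfilt_hprime psA.
have [C3 c3] := hk_sum_shift (fun=> a) hsA.
exists (C1 + C2 + C3)%N => q m; rewrite !mulnDl big_cat big_map /=.
have h1 := hkm_cyclic hR hfs q m gH fH gA ksub_rad AP (fun b => radV v (z := b)).
have h2 : (\sum_(y <- sA) hk q y.1 a m + krel (sh a A m) (rad :+: sh a (J q A) m) <=
    krel (sh a piece m) (rad :+: sh a (J q piece) m) + C2 * m.+1 ^ e)%N.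
  (* Below degree a all the shifted families are zero. *)
  case: (leqP a m) => le; last first.
    have -> : (\sum_(y <- sA) hk q y.1 a m = 0)%N by apply: big1 => y _; rewrite hkE leqNgt le.
    by rewrite /sh (leqNgt a m) le /= sumset0 krel_set0 //; exact: ksub_rad.
  rewrite (eq_bigr (fun y => hk q y.1 0 (m - a))) => [|y _]; last by rewrite hkE le.
  rewrite /sh le; have := c2 q (m - a)%N; have := leq_small e C2 (leq_subr a m); lia.
have := c1 q m; have := proj1 (c3 q m); lia.
Qed.

Lemma good_gens H s l : good H s -> exists s',
  pfilt H (fadd H (gens G l)) s' /\ good (fadd H (gens G l)) (s' ++ s).
Proof.
move=> gH; elim: l => [|[a v] l [s1 [ps1 g1]]].
  exists [::]; have -> : fadd H (gens G [::]) = H; last by split=> //; apply: pfilt_nil.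
  by apply/funext => m; rewrite /fadd /gens /= sumset0.
have [s2 [ps2 g2]] := good_cyc a v g1.
exists (s2 ++ s1); rewrite -catA.
suff -> : fadd H (gens G ((a, v) :: l)) = fadd (fadd H (gens G l)) (cyc a v).
  by split=> //; apply: pfilt_cat ps1 ps2.
by apply/funext => m; rewrite /fadd /gens /= -sumsetA (sumsetC (cyc a v m)).
Qed.

Lemma good_upper H s : good H s -> exists C, forall q m,
  (hkm fs q (@zerofam V) H m <= \sum_(y <- s) hk q y.1 0 m + C * m.+1 ^ e)%N.
Proof.
move=> [gH fH psH _].
have hs y : y \in s -> hprime y.1 by apply: pfilt_hprime psH.
have [C cC] := hk_sum_shift id hs; exists C => q m.
apply: leq_trans (hkm_subadditive hfs q m (gfam_zerofam _) (@kfin_zerofam V) psH) _.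
exact: (proj2 (cC q m)).
Qed.

End Good.
End Radical.
End Reduced.

(** * Frobenius pushforward *)

(* V with scalars acting through phi; for phi a power of the Frobenius, the
   pushforward of V. *)
Definition twist (R : comNzRingType) (phi : {rmorphism R -> R}) (V : lmodType R) :
  Type := V.

Section Twist.
Variables (R : comNzRingType) (phi : {rmorphism R -> R}) (V : lmodType R).
Local Notation twist := (twist phi V).

HB.instance Definition _ := GRing.Zmodule.copy twist V.

Definition twist_scale (a : R) (v : twist) : twist := phi a *: (v : V).

Lemma twist_scalerA a b v : twist_scale a (twist_scale b v) = twist_scale (a * b) v.
Proof. by rewrite /twist_scale scalerA rmorphM. Qed.

Lemma twist_scale1r : left_id 1 twist_scale.
Proof. by move=> v; rewrite /twist_scale rmorph1 scale1r. Qed.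

Lemma twist_scalerDr : right_distributive twist_scale +%R.
Proof. by move=> a u v; rewrite /twist_scale scalerDr. Qed.

Lemma twist_scalerDl v : {morph twist_scale^~ v : a b / a + b}.
Proof. by move=> a b; rewrite /twist_scale rmorphD scalerDl. Qed.

HB.instance Definition _ := GRing.Zmodule_isLmodule.Build R twist
  twist_scalerA twist_scale1r twist_scalerDr twist_scalerDl.

End Twist.

Section FrobeniusPower.
Variables (R : comNzRingType) (p n : nat) (chR : p \in [pchar R]).

(** The characteristic is an argument so that the morphism structures below can be attached to the
    function. *)
Definition frobenius_iter of p \in [pchar R] := fun x : R => x ^+ (p ^ n).
Local Notation frob := (frobenius_iter chR).

Lemma frobenius_iter_zmod_morphism : zmod_morphism frob.
Proof.
move=> x y; rewrite /frobenius_iter.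
have pn : [pchar R].-nat (p ^ n)%N.
  by rewrite pnatX (eq_pnat _ (pcharf_eq chR)) pnat_id ?(pcharf_prime chR) ?orbT.
have e := exprDn_pchar (x - y) y pn.
by rewrite subrK in e; rewrite e addrK.
Qed.

Lemma frobenius_iter_monoid_morphism : monoid_morphism frob.
Proof. by split; [rewrite /frobenius_iter expr1n | move=> x y; rewrite /frobenius_iter exprMn]. Qed.

HB.instance Definition _ := GRing.isZmodMorphism.Build R R frob
  frobenius_iter_zmod_morphism.
HB.instance Definition _ := GRing.isMonoidMorphism.Build R R frob
  frobenius_iter_monoid_morphism.

End FrobeniusPower.

Section FrobeniusTwist.
Variables (k : fieldType) (R : comAlgType k) (G : nat -> {pred R}).
Hypothesis hR : standard_graded G.
Variables (p n : nat) (chR : p \in [pchar R]).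
Hypothesis perfect : forall a : k, exists b : k, b ^+ p = a.

Local Notation piece := (piece G).
Local Notation frob := (frobenius_iter n chR : {rmorphism R -> R}).
Local Notation Q := (p ^ n)%N.

Lemma perfect_exp (a : k) : exists b : k, b ^+ Q = a.
Proof.
elim: n a => [|n' IH] a; first by exists a; rewrite expn0 expr1.
have [b <-] := IH a; have [c <-] := perfect b.
by exists c; rewrite expnS exprM.
Qed.

Lemma Q_gt0 : (0 < Q)%N.
Proof. by rewrite expn_gt0 (prime_gt0 (pcharf_prime chR)). Qed.

Section Module.
Variable V : lmodType R.
Local Notation V' := (twist frob V).
Local Notation gens' := (@gens k R G V').

Lemma twist_scaleE (a : R) (v : V') : a *: v = (a ^+ Q *: (v : V) : V').
Proof. by []. Qed.

Lemma scalar_exp (c : k) : (c%:A : R) ^+ Q = (c ^+ Q)%:A.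
Proof. by rewrite exprZn expr1n. Qed.

Lemma twist_restrict_scale (c : k) (u : V) :
  c *: (u : restrict_scalars k R V') = (c ^+ Q) *: (u : restrict_scalars k R V) :> V.
Proof.
change ((c%:A : R) ^+ Q *: u = ((c ^+ Q)%:A : R) *: u).
by rewrite scalar_exp.
Qed.

Lemma ksub_twist (W : set V) : @ksub k R V' W <-> @ksub k R V W.
Proof.
split=> -[W0 WP]; split=> // c u v Wu Wv; last first.
  have := WP (c ^+ Q) u v Wu Wv; congr W; congr (_ + v).
  by rewrite twist_restrict_scale.
have [b eb] := perfect_exp c.
have := WP b u v Wu Wv; congr W; congr (_ + v).
by rewrite twist_restrict_scale eb.
Qed.

(* This is where perfectness of k enters: V and its Frobenius twist have the same
   k-subspaces, hence the same lengths. *)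
Lemma klen_twist (W : set V) : @klen k R V' W = @klen k R V W.
Proof.
rewrite /klen /len; congr xget.
have sE m : @schain k (restrict_scalars k R V') W m <-> @schain k (restrict_scalars k R V) W m.
  by split=> -[N [sN NW st]]; exists N; split=> // i lei; apply/ksub_twist/sN.
apply/seteqP; split=> m [cm max]; split; try exact/sE.
  by move=> m' /sE /max.
by move=> m' /sE /max.
Qed.

Lemma krel_twist (X T : set V) : @krel k R V' X T = @krel k R V X T.
Proof. by rewrite /krel /rlen -!/(klen _) !klen_twist. Qed.

(* The degrees congruent to r modulo Q, on which the Frobenius pushforward of H is
   graded. *)
Definition frob_fam r (H : nat -> set V) m : set V' := H (Q * m + r)%N.

(** On the pushforward the q-th power of f acts as its qQ-th power. As r < Q, the conditions Q q deg
    f <= Qm + r and q deg f <= m agree. *)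
Lemma J_twist fs q r H m : (r < Q)%N ->
  powers_fam fs q (frob_fam r H) m = powers_fam fs (q * Q) H (Q * m + r) :> set V.
Proof.
move=> rQ; elim: fs => [//|df fs IH] /=; rewrite IH; congr sumset.
have -> : sh (q * df.1) (frob_fam r H) m = sh (q * Q * df.1) H (Q * m + r) :> set V.
  have Q0 := Q_gt0.
  rewrite /sh /frob_fam; have -> : (q * Q * df.1 = Q * (q * df.1))%N by lia.
  have -> : (Q * (q * df.1) <= Q * m + r)%N = (q * df.1 <= m)%N.
    apply/idP/idP => le; last by apply: leq_trans (leq_addr _ _); rewrite leq_mul2l le orbT.
    rewrite leqNgt; apply/negP => lt.
    have : (Q * m.+1 <= Q * (q * df.1))%N by rewrite leq_mul2l lt orbT.
    rewrite mulnS; lia.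
  case: leqP => // le; congr H; rewrite mulnBr.
  have : (Q * (q * df.1) <= Q * m)%N by rewrite leq_mul2l le orbT.
  lia.
by apply/seteqP; split=> _ [v Hv <-]; exists v => //; rewrite twist_scaleE -exprM.
Qed.

Lemma hkm_twist fs q r H m : (r < Q)%N ->
  hkm fs q (@zerofam V') (frob_fam r H) m = hkm fs (q * Q) (@zerofam V) H (Q * m + r).
Proof. by move=> rQ; rewrite /hkm /zerofam !sumset0l krel_twist J_twist. Qed.

Lemma gfam_frob_fam r H : gfam G H -> @gfam k R G V' (frob_fam r H).
Proof.
move=> gH; split=> [m|i j b v Gb Hv]; first by apply/ksub_twist; apply: gfam_ksub gH.
rewrite twist_scaleE /frob_fam mulnDr -addnA.
apply: (proj2 gH) => //; exact: pieceX.
Qed.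

(** Degrees below a bound M are spanned by finitely many elements; from M on, [piece_pow] factors
    out some x^Q, which is the action of x on the pushforward. *)
Lemma twist_cyc a (v : V) r : exists l, forall m,
  cyc G a v (Q * m + r) = gens' l m :> set V.
Proof.
have [xs [Gxs xsP]] := piece_pow hR Q.
have [L LP] := choice (piece_spanning hR).
(* For m >= M the degree Qm + r - a exceeds [size xs * Q], the threshold of [piece_pow]. *)
pose M := (size xs + a).+1.
pose row b : seq (nat * V') :=
  if (a <= Q * b + r)%N then [seq (b, (g : R) *: v : V') | g <- L (Q * b + r - a)%N] else [::].
pose l := flatten [seq row b | b <- iota 0 M].
have lP (b : nat) (g : R) : (b < M)%N -> (a <= Q * b + r)%N ->
    g \in L (Q * b + r - a)%N -> (b, g *: v : V') \in l.
  move=> bM le gL; apply/flatten_mapP; exists b; first by rewrite mem_iota add0n.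
  by rewrite /row le; apply/mapP; exists g.
exists l => m; apply/seteqP; split; last first.
  apply: (@sums_min k R V') => [|[b w] /flatten_mapP[b' _]].
    exact/ksub_twist/(gfam_ksub _ (gfam_cyc hR a v)).
  rewrite /row; case: leqP => // le /mapP[g gL [-> ->]] /= _ [c + <-].
  have Gg := proj1 (LP _) g gL.
  rewrite /sh; case: leqP => [lem Gc|_ ->]; last first.
    by rewrite scale0r; apply: gfam0 (gfam_cyc hR a v).
  rewrite twist_scaleE scalerA; exists (c ^+ Q * g) => //.
  have := pieceM hR (pieceX hR Q Gc) Gg.
  have e1 : (Q * (m - b') + (Q * b' + r - a) = Q * m + r - a)%N.
    have := leq_mul (leqnn Q) lem; rewrite mulnBr; lia.
  have lem' := leq_mul (leqnn Q) lem.
  by rewrite /sh e1 ifT //; lia.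
have sg m' : ksub [set b : R^o | gens' l m' ((b : R) *: v : V)].
  by apply: (@ksub_act k R V); apply/ksub_twist; apply: ksub_gens.
have low m' y : (m' < M)%N -> cyc G a v (Q * m' + r) y -> gens' l m' y.
  move=> ltM [b + <-]; rewrite {1}/sh; case: leqP => [le Gb|_ ->]; last exact: ksub0 (sg m').
  apply: (sums_min (sg m')) (proj2 (LP _) b Gb) => g gL.
  move=> _ [c _ <-]; apply: (ksubZ c (sg m')).
  apply: (@sums_sub k R V' _ (fun av => cyc G av.1 av.2 m') l (m', (g : R) *: v : V')).
  - by move=> av; apply: gfam_ksub (gfam_cyc hR _ _).
  - exact: lP.
  exact: (@cyc_gen k R G hR V').
elim: m => [|m IH] y; first exact: low.
case: (ltnP m.+1 M) => [ltM|leM]; first exact: low.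
move=> [b + <-]; rewrite {1}/sh; case: leqP => [le Gb|_ ->]; last exact: ksub0 (sg m.+1).
have Q0 := Q_gt0.
have lt : (size xs * Q < Q * m.+1 + r - a)%N.
  have : (Q * (size xs + a).+1 <= Q * m.+1)%N by rewrite leq_mul2l leM orbT.
  have : (a.+1 <= Q * a.+1)%N by rewrite leq_pmull.
  rewrite !mulnS mulnDr; lia.
apply: (sums_min (sg m.+1)) (xsP _ lt b Gb) => x xxs _ [c Gc <-] /=.
have cv : cyc G a v (Q * m + r)%N ((c : R) *: v).
  have e1 : (Q * m.+1 + r - a - Q = Q * m + r - a)%N by rewrite mulnS; lia.
  exists c => //; rewrite e1 in Gc; rewrite /sh ifT //.
  have : (size xs * Q + Q <= Q * m.+1)%N by rewrite mulnC -mulnSr leq_mul2l; apply/orP; right; lia.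
  have : (Q * (size xs + a).+1 <= Q * m.+1)%N by rewrite leq_mul2l leM orbT.
  have : (a <= Q * a)%N by rewrite leq_pmull.
  rewrite !mulnS mulnDr; lia.
have := proj2 (@gfam_gens k R G hR V' l) _ _ _ _ (Gxs x xxs) (IH _ cv).
by rewrite add1n twist_scaleE scalerA.
Qed.

End Module.

Variable e : nat.
Hypothesis dim_le : forall P : spectrum R, ~ above P e.+3.
Local Notation hilb := (hilb G).
Local Notation big := (big e).
Local Notation pfilt := (pfilt hR).
Local Notation hprime := (hprime hR).

(** An empty list of generators makes I^[q] zero, and [hk] becomes the Hilbert function. *)
Lemma hilb_shift (P : spectrum R) a : hprime P -> exists C, forall m,
  (hilb P 0 m <= hilb P a m + C * m.+1 ^ e)%N /\
  (hilb P a m <= hilb P 0 m + C * m.+1 ^ e)%N.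
Proof.
move=> hP; have [C cC] := hk_shift dim_le [::] a hP; exists C => m.
have hkh b : hk G [::] 0 P b m = hilb P b m.
  rewrite /hk /hilb; have -> : sh b (powers_fam [::] 0 piece) m = [set 0].
    by rewrite /sh; case: ifP.
  by rewrite sumset0.
by have := cC 0%N m; rewrite !hkh.
Qed.

Definition nearly e (u v : nat -> nat -> nat) := exists C, forall q m,
  (u q m <= v q m + C * m.+1 ^ e)%N /\ (v q m <= u q m + C * m.+1 ^ e)%N.

Lemma nearlyD u v u' v' : nearly e u v -> nearly e u' v' ->
  nearly e (fun q m => u q m + u' q m)%N (fun q m => v q m + v' q m)%N.
Proof.
move=> [C cC] [D cD]; exists (C + D)%N => q m.
by have [h1 h2] := cC q m; have [h3 h4] := cD q m; rewrite mulnDl; lia.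
Qed.

Lemma nearly_trans u v w : nearly e u v -> nearly e v w -> nearly e u w.
Proof.
move=> [C cC] [D cD]; exists (C + D)%N => q m.
by have [h1 h2] := cC q m; have [h3 h4] := cD q m; rewrite mulnDl; lia.
Qed.

Lemma nearly_ext u v u' v' : (forall q m, u q m = u' q m) -> (forall q m, v q m = v' q m) ->
  nearly e u v -> nearly e u' v'.
Proof. by move=> uu vv [C cC]; exists C => q m; rewrite -uu -vv. Qed.

Lemma nearly_small u v C : (forall q m, u q m <= C * m.+1 ^ e)%N ->
  (forall q m, v q m <= C * m.+1 ^ e)%N -> nearly e u v.
Proof.
move=> uC vC; exists C => q m; have := uC q m; have := vC q m; lia.
Qed.

Lemma nearly_refl u : nearly e u u.
Proof. by exists 0%N => q m; rewrite mul0n addn0. Qed.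

(** The function f is abstract because the multiplicity of P is read both in Hilbert-Kunz lengths
    and in Hilbert functions. *)
Lemma nearly_split (s : seq (spectrum R * nat)) P (f : spectrum R -> nat -> nat -> nat -> nat) :
  (forall y, y \in s -> y.1 = P \/ exists C, forall q m, (f y.1 y.2 q m <= C * m.+1 ^ e)%N) ->
  (forall y, y \in s -> nearly e (f y.1 y.2) (f y.1 0)) ->
  nearly e (fun q m => \sum_(y <- s) f y.1 y.2 q m)%N
    (fun q m => count (fun y => y.1 == P) s * f P 0 q m)%N.
Proof.
elim: s => [|y s IH] sP sf.
  by exists 0%N => q m; rewrite big_nil /= mul0n addn0.
have ns := IH (fun z zs => sP z (mem_behead (s := y :: s) zs))
              (fun z zs => sf z (mem_behead (s := y :: s) zs)).
have ny := sf y (mem_head _ _).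
apply: (@nearly_ext (fun q m => f y.1 y.2 q m + \sum_(z <- s) f z.1 z.2 q m)%N
  (fun q m => (y.1 == P) * f P 0 q m + count (fun y => y.1 == P) s * f P 0 q m)%N).
- by move=> q m; rewrite sumn_cons.
- by move=> q m; rewrite /= mulnDl.
apply: nearlyD ns; have [e1|ne] := eqVneq y.1 P.
  by rewrite e1 in ny; apply: nearly_ext ny => q m //; rewrite ?e1 // mul1n.
have [e1|[C cC]] := sP y (mem_head _ _); first by rewrite e1 eqxx in ne.
by apply: (@nearly_small _ _ C) => // q m; rewrite mul0n.
Qed.

(** The primes of s other than P have smaller dimension, so only the multiplicity N of P matters.
    The same N governs the Hilbert functions, which involve no q, and their growth determines it. *)
Lemma frobenius_count (s : seq (spectrum R * nat)) P a r fs : hprime P ->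
  (forall y, y \in s -> hprime y.1 /\ pset P `<=` pset y.1) ->
  (forall m, (\sum_(y <- s) hilb y.1 y.2 m = hilb P a (Q * m + r))%N) ->
  nearly e (fun q m => \sum_(y <- s) hk G fs q y.1 0 m)%N
    (fun q m => Q ^ e.+1 * hk G fs q P 0 m)%N.
Proof.
move=> hP sP sE.
have dich y : y \in s -> y.1 = P \/ ~ big y.1.
  move=> ys; have [by1|nb] := pselect (big y.1); [left | by right].
  by have [hy Py] := sP y ys; rewrite (big_minimal dim_le by1 Py).
have n1 : nearly e (fun q m => \sum_(y <- s) hk G fs q y.1 0 m)%N
    (fun q m => count (fun y => y.1 == P) s * hk G fs q P 0 m)%N.
  apply: (@nearly_split s P (fun P' _ q m => hk G fs q P' 0 m)) => y ys; last exact: nearly_refl.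
  have [->|nb] := dich y ys; [by left | right].
  have [C cC] := hilb_small 0 (proj1 (sP y ys)) nb.
  by exists C => q m; apply: leq_trans (hk_le_hilb hR _ _ _ _ _) (cC m).
apply: nearly_trans n1 _.
set N := count _ s.
have n2 : nearly e (fun q m => \sum_(y <- s) hilb y.1 y.2 m)%N (fun q m => N * hilb P 0 m)%N.
  apply: (@nearly_split s P (fun P' b q m => hilb P' b m)) => y ys; last first.
    have [C cC] := hilb_shift y.2 (proj1 (sP y ys)); exists C => q m.
    by have [] := cC m.
  have [->|nb] := dich y ys; [by left | right].
  have [C cC] := hilb_small y.2 (proj1 (sP y ys)) nb.
  by exists C => q m; apply: cC.
have [C2 c2] := n2.
have [c cO] := evpoly_asymptotic (evpoly_hilb hP (dim_le (P := P))).
have nO : bigO e (fun m => (if (a <= Q * m + r)%N then (hilb P 0 (Q * m + r - a))%:Z else 0) -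
    N%:Z * (hilb P 0 m)%:Z).
  exists C2 => m; have [h1 h2] := c2 0%N m; rewrite sE in h1 h2.
  have -> : (if (a <= Q * m + r)%N then (hilb P 0 (Q * m + r - a))%:Z else 0) =
      (hilb P a (Q * m + r))%:Z.
    by rewrite (hilbE G P a); case: ifP.
  by rewrite -PoszM; lia.
(* If c = 0, the Hilbert function of R/P is O(m^e): N is not determined, but both sides are
   negligible. *)
have [c0|->] := count_unique Q_gt0 cO nO; last exact: nearly_refl.
have [D cD] := cO.
have hsmall m : (hilb P 0 m <= D * m.+1 ^ e)%N.
  have := cD m; rewrite c0 mul0r subr0 -PoszM normr_Posz lez_nat => le.
  by apply: leq_trans le; rewrite leq_pmull // fact_gt0.
have hks q m : (hk G fs q P 0 m <= D * m.+1 ^ e)%N.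
  by apply: leq_trans (hk_le_hilb hR _ _ _ _ _) (hsmall m).
apply: (@nearly_small _ _ ((N + Q ^ e.+1) * D)) => q m; rewrite -mulnA.
  by apply: leq_mul => //; apply: leq_addr.
by apply: leq_mul => //; apply: leq_addl.
Qed.

Section FrobeniusEstimate.
Variable sR : seq (spectrum R * nat).
Hypothesis psR : pfilt (@zerofam R^o) piece sR.
Hypothesis sizeQ : (size sR <= Q)%N.
Variable fs : seq (nat * R).
Hypothesis hfs : homog_seq G fs.
Variable V : lmodType R.
Local Notation V' := (twist frob V).

(* For Q large the radical of R acts as zero on the Frobenius pushforward. *)
Lemma rad_twist (z : R) (v : V') : rad sR z -> z *: v = 0.
Proof.
move=> Zz; rewrite twist_scaleE -(subnKC sizeQ) exprD (rad_nilpotent psR Zz) mul0r.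
by rewrite scale0r.
Qed.

(** Each factor (R/P)(-a) is pushed forward separately, with the generators of [twist_cyc]. The
    primes that filter it contain P, since x in P acts by x^Q. *)
Lemma frob_fam_good r (H : nat -> set V) s : (r < Q)%N -> pfilt (@zerofam V) H s ->
  exists s', good hR e fs (V := V') (frob_fam r H) s' /\
  nearly e (fun q m => \sum_(y <- s') hk G fs q y.1 0 m)%N
    (fun q m => Q ^ e.+1 * \sum_(y <- s) hk G fs q y.1 0 m)%N.
Proof.
move=> rQ; elim=> [|{}H {}s P a v LH [s' [g' n']] hP vP].
  exists [::]; split; first exact: good_zerofam.
  by exists 0%N => q m; rewrite !big_nil muln0.
have gH := pfilt_gfam (gfam_zerofam G V) LH.
have [l lE] := twist_cyc a v r.
have [s1 [ps1 g1]] := good_gens dim_le hfs psR rad_twist l g'.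
have eH : fadd (frob_fam r H) (@gens k R G V' l) =
    frob_fam r (fadd H (cyc G a v)) :> (nat -> set V).
  by apply/funext => m; rewrite /fadd /frob_fam lE.
exists (s1 ++ s'); split; first by rewrite -eH.
apply: (@nearly_ext
  (fun q m => \sum_(y <- s1) hk G fs q y.1 0 m + \sum_(y <- s') hk G fs q y.1 0 m)%N
  (fun q m => Q ^ e.+1 * hk G fs q P 0 m + Q ^ e.+1 * \sum_(y <- s) hk G fs q y.1 0 m)%N).
- by move=> q m; rewrite big_cat.
- by move=> q m; rewrite sumn_cons mulnDr.
apply: nearlyD n'.
have gF := gfam_frob_fam r gH.
have fF : forall m, @kfin k R V' (frob_fam r H m) by case: g'.
apply: (@frobenius_count _ _ a r) => // [y ys|m].
  split; first exact: pfilt_hprime ps1 ys.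
  apply: (hprime_sub hP) => i x Gx Px.
  apply: (pfilt_annihilator gF ps1 Gx _ ys) => m w.
  rewrite eH /frob_fam => -[h [c [Hh [b Gb bc] ->]]]; rewrite -bc => {bc}.
  rewrite scalerDr; apply: (ksubD (gfam_ksub _ gF)).
    exact: (proj2 gF).
  rewrite twist_scaleE scalerA /frob_fam.
  move: Gb; rewrite /sh; case: leqP => [le Gb|_ ->]; last first.
    by rewrite mulr0 scale0r; apply: gfam0 gH.
  have -> : (Q * (i + m) + r = (Q * i + (Q * m + r - a)) + a)%N by rewrite mulnDr; lia.
  apply/vP; first by apply: (pieceM hR) => //; apply: pieceX.
  apply/psetM; left; case: (Q) Q_gt0 => // Q' _.
  by rewrite exprS; apply/psetM; left.
rewrite -(pfilt_hilb gF (fF m) ps1) eH krel_twist /frob_fam {1}/fadd.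
have fH : kfin (H (Q * m + r)%N) := pfilt_kfin (kfin_zerofam _ _) LH.
rewrite sumsetC krel_sumset //; last 2 first.
- exact: kfin_cyc.
- exact: gfam_ksub gH.
have sH := gfam_ksub (Q * m + r) gH.
rewrite krel_subset // add0n (@ksub_absorb _ _ _ _ _ sH sH) //.
exact: krel_step.
Qed.

Lemma frobenius_estimate r (H : nat -> set V) s : (r < Q)%N -> pfilt (@zerofam V) H s ->
  exists C, forall q m,
  (hkm fs (q * Q) (@zerofam V) H (Q * m + r) <=
    Q ^ e.+1 * \sum_(y <- s) hk G fs q y.1 0 m + C * m.+1 ^ e)%N /\
  (Q ^ e.+1 * \sum_(y <- s) hk G fs q y.1 0 m <=
    hkm fs (q * Q) (@zerofam V) H (Q * m + r) + C * m.+1 ^ e)%N.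
Proof.
move=> rQ LH; have [s' [g' n']] := frob_fam_good rQ LH.
have [C1 c1] := good_upper dim_le hfs g'; have [_ _ _ [C2 c2]] := g'.
apply: (nearly_trans _ n'); exists (C1 + C2)%N => q m; rewrite mulnDl -(hkm_twist _ _ _ _ rQ).
split.
  by apply: leq_trans (c1 q m) _; rewrite leq_add2l leq_addr.
by apply: leq_trans (c2 q m) _; rewrite leq_add2l leq_addl.
Qed.

End FrobeniusEstimate.
End FrobeniusTwist.

(** * Lengths of localizations *)

Section LengthStep.
Variables (A : pzRingType) (V : lmodType A).

Lemma len_step (W W' : set V) : fin W -> submod W' -> simple_step W W' ->
  (exists2 x, W' x & ~ W x) -> fin W' /\ len W' = (len W).+1.
Proof.
move=> fW sW' [WW' st] [x W'x Wx]; have [sW [N [n [cN WN]]]] := fW.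
have [N0 sN stN] := cN.
pose M i := if (i <= n)%N then W `&` N i else W'.
have Mn : M n = W by rewrite /M leqnn; apply/seteqP; split=> [y []//|y Wy]; split=> //; apply: WN.
have MS : M n.+1 = W' by rewrite /M ltnn.
have cM m : (m <= n.+1)%N -> cseries M m.
  move=> lem; split.
  - rewrite /M /= N0; apply/seteqP; split=> [y []//|_ ->].
    by split=> //; apply: submod0.
  - by move=> i; rewrite /M; case: ifP => // _; apply: submodI.
  move=> i lti; have [ltn|len] := ltnP i n; last first.
    have -> : i = n by apply/eqP; rewrite eqn_leq len andbT -ltnS (leq_trans lti).
    by rewrite Mn MS.
  rewrite /M ltnW // ltn; have [Ni H] := stN i ltn; split.
    by move=> y [Wy Ny]; split=> //; apply: Ni.
  move=> y z [Wy Ny] nN [Wz Nz].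
  have [|a Na] := H y z Ny _ Nz; first by move=> Niy; apply: nN.
  by exists a; split=> //; apply: submodB => //; apply: submodZ.
have cMS := cM n.+1 (leqnn _); have cMn := cM n (leqnSn _).
split; first by split=> //; exists M, n.+1; split=> //; rewrite MS.
have W'M : W' `<=` M n.+1 by rewrite MS.
have WM : W `<=` M n by rewrite Mn.
rewrite (len_jumps cMS sW' W'M) (len_jumps cMn sW WM).
rewrite /jumps big_ord_recr /= -addn1; congr (_ + _)%N; last first.
  by rewrite /jump; case: asboolP => // -[]; exists x; rewrite MS Mn.
apply: eq_bigr => i _; congr (nat_of_bool _); apply/asboolP/asboolP.
  move=> [y [_ My nMy]]; exists y; split=> //.
  by rewrite -Mn; apply: (cseries_le cMn) My; rewrite ltn_ord leqnn.
by move=> [y [Wy My nMy]]; exists y; split=> //; apply: WW'.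
Qed.

End LengthStep.

Section LocalLength.
Variables (R : comNzRingType) (P : spectrum R) (M : lmodType R).
Implicit Types W : set M.

(** The localization of W, seen inside that of M. *)
Definition loc W : set (localization P M) :=
  [set x | exists m s, W m /\ x = locfrac m s].

Lemma fracN m (s : denominator P) : - locfrac m s = locfrac (- m : M) s.
Proof. exact: frac_oppE. Qed.

Lemma fracZ (b : R) (t : denominator P) m (s : denominator P) :
  (locfrac (b : R^o) t : local_ring P) *: locfrac (m : M) s = locfrac (b *: m) (denominatorM t s).
Proof. exact: frac_scaleE. Qed.

Lemma loc_locfrac W m (s : denominator P) : submod W ->
  (loc W (locfrac m s) <-> exists u : denominator P, W (den u *: m)).
Proof.
move=> sW; split.
  move=> [m' [s' [Wm' /frac_eqP[u e]]]]; exists (denominatorM u s').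
  by rewrite denM -scalerA e; do 2 apply: submodZ => //.
move=> [u Wum]; exists (den u *: m), (denominatorM u s); split=> //.
apply/frac_eqP; exists (denominator1 P).
by rewrite den1 !scale1r denM !scalerA mulrC.
Qed.

Lemma submod_loc W : submod W -> submod (loc W).
Proof.
move=> sW; split; first by exists 0, (denominator1 P); split=> //; apply: submod0.
elim/frac_ind=> b t _ _ [m [s [Wm ->]]] [m' [s' [Wm' ->]]].
rewrite fracZ fracD; apply/(loc_locfrac _ _ sW); exists (denominator1 P).
by rewrite den1 scale1r; apply: submodD => //; do ?apply: submodZ => //.
Qed.

Lemma loc_set0 : loc [set 0] = [set 0].
Proof.
apply/seteqP; split=> [_ [m [s [-> ->]]]|_ ->].
  by apply/frac_eqP; exists (denominator1 P); rewrite !scaler0.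
by exists 0, (denominator1 P).
Qed.

Lemma loc_setT : loc setT = setT.
Proof. by apply/seteqP; split=> // x _; elim/frac_ind: x => m s; exists m, s. Qed.

Section Step.
Variables (W : set M) (v : M) (Q : spectrum R).
Hypothesis sW : submod W.
Hypothesis vQ : forall b, W (b *: v) <-> b \in Q.

Let W' := W :+: range (fun a : R => a *: v).
Let sW' : submod W'. Proof. by apply: submod_sumset => //; apply: submod_line. Qed.

(** The element t kills v modulo W and becomes a unit in the localization. *)
Lemma loc_step_trivial t : t \in Q -> t \notin P -> loc W' = loc W.
Proof.
move=> tQ tP; apply/seteqP; split; last first.
  move=> _ [m [s [Wm ->]]]; exists m, s; split=> //.
  by apply: sumset_subl => //; apply: submod_line.
move=> _ [_ [s [[w [_ [Ww [b _ <-] ->]]] ->]]].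
apply/(loc_locfrac _ _ sW); exists (Sub t tP : denominator P); rewrite /den SubK.
rewrite scalerDr; apply: submodD => //; first exact: submodZ.
by rewrite scalerA mulrC -scalerA; apply: submodZ => //; apply/vQ.
Qed.

Lemma loc_step_simple : pset Q = pset P -> simple_step (loc W) (loc W') /\
  exists2 x, loc W' x & ~ loc W x.
Proof.
move=> QP; have QPE b : b \in Q <-> b \in P.
  by split=> h; [have : pset P b by rewrite -QP | have : pset Q b by rewrite QP].
split; last first.
  exists (locfrac v (denominator1 P)).
    exists v, (denominator1 P); split=> //.
    by apply: sumset_subr => //; exists 1; rewrite ?scale1r.
  by move=> /(loc_locfrac _ _ sW)[u /vQ/QPE]; apply/negP; exact: (valP u).
split.
  move=> _ [m [s [Wm ->]]]; exists m, s; split=> //.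
  by apply: sumset_subl => //; apply: submod_line.
move=> _ _ [_ [s [[w [_ [Ww [b _ <-] ->]]] ->]]] nW [_ [s' [[w' [_ [Ww' [b' _ <-] ->]]] ->]]].
have bP : b \notin P.
  apply/negP => /QPE/vQ Wb; apply: nW; exists (w + b *: v), s; split=> //.
  exact: submodD.
pose bd : denominator P := Sub b bP.
(* For the elements (w + bv)/s and (w' + b'v)/s', the scalar b's/(s'b) cancels the multiples of
   v. *)
exists (locfrac ((b' * den s) : R^o) (denominatorM s' bd)).
rewrite fracZ fracN fracD; apply/(loc_locfrac _ _ sW); exists (denominator1 P).
rewrite !denM den1 scale1r.
have -> : den bd = b by rewrite /den SubK.
have -> : den s' * b * den s *: (w' + b' *: v) + den s' *: - (b' * den s *: (w + b *: v)) =
   (den s' * b * den s) *: w' - (den s' * b' * den s) *: w.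
  rewrite scalerN !scalerDr !scalerA opprD addrACA.
  have -> : den s' * b * den s * b' = den s' * (b' * den s) * b by ring.
  by rewrite !mulrA subrr addr0.
by apply: submodB => //; apply: submodZ.
Qed.

End Step.
End LocalLength.

Section PfiltLocal.
Variables (k : fieldType) (R : comAlgType k) (G : nat -> {pred R}).
Hypothesis hR : standard_graded G.
Variables (M : lmodType R) (H : nat -> {pred M}).
Hypothesis gH : graded_module G H.

Local Notation dG := (piece_direct hR).
Local Notation dH := (proj1 gH).
Local Notation gfam := (gfam G).
Local Notation pfilt := (pfilt hR).

(* The submodule generated by the homogeneous pieces F m. *)
Definition total (F : nat -> set M) : set M :=
  [set v | forall W, submod W -> (forall m, F m `<=` W) -> W v].

Lemma submod_total F : submod (total F).
Proof.
split=> [W sW _|a u v Fu Fv W sW FW]; first exact: submod0.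
by apply: (proj2 sW); [exact: Fu | exact: Fv].
Qed.

Lemma total_sub F m : F m `<=` total F.
Proof. by move=> x Fx W _ FW; apply: FW Fx. Qed.

Lemma total_hcomp F v m : gfam F -> (forall m, F m `<=` hpiece H m) -> total F v ->
  F m (hcomp dH v m).
Proof.
move=> gF FH Fv; apply: (Fv [set v | forall m, F m (hcomp dH v m)]) => [|i x Fx j].
  split=> [j|a u w Fu Fw j]; first by rewrite hcomp0; apply: gfam0 gF.
  rewrite hcompD; apply: (ksubD (gfam_ksub j gF)) _ (Fw j).
  have [n an] := hcomp_fin dG a; have [_ ->] := an n (leqnn n).
  rewrite scaler_suml hcomp_sum; apply: (ksub_sum _ (gfam_ksub j gF)) => i.
  rewrite (hcompZ dH (proj2 gH) u j (hcomp_in dG a i)); case: ifP => ij.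
    by apply: (gfamZ gF (hcomp_in dG a i) ij).
  exact: gfam0 gF.
rewrite (hcomp_homog dH j (FH i x Fx)); case: eqP => [->//|_]; exact: gfam0 gF.
Qed.

Lemma total_zerofam : total (@zerofam M) = [set 0].
Proof.
apply/seteqP; split=> [v Zv|_ ->]; first by apply: (Zv [set 0] (submod_set0 M)) => m x.
exact: submod0 (submod_total _).
Qed.

Lemma total_hpiece : total (hpiece H) = setT.
Proof.
apply/seteqP; split=> // v _; have [n vn] := hcomp_fin dH v.
have [_ ->] := vn n (leqnn n); apply: (submod_sum _ (submod_total (hpiece H))) => i.
by apply: (@total_sub _ i); exact: hcomp_in.
Qed.

Lemma total_cyc F a v : gfam F ->
  total (fadd F (cyc G a v)) = total F :+: range (fun b : R => b *: v).
Proof.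
move=> gF; have gc := gfam_cyc hR a v.
have sL := submod_line v; have sT := submod_total F.
apply/seteqP; split=> x.
  apply; first exact: submod_sumset.
  move=> m; apply: sumsetS; first exact: total_sub.
  by move=> _ [b _ <-]; exists b.
move=> [w [_ [Fw [b _ <-] ->]]] W sW FW.
apply: submodD => //.
  apply: Fw => // m y Fy; apply: (FW m); apply: ksub_subl Fy; exact: gfam_ksub gc.
apply: submodZ => //; apply: (FW a); apply: ksub_subr (gfam_ksub _ gF) _ (cyc_gen hR a v).
Qed.

(** Localization at P kills a factor R/Q unless Q lies in P, hence equals P; a factor R/P becomes
    the residue field, of length 1. *)
Lemma pfilt_local_length (P : spectrum R) F s : pfilt (@zerofam M) F s ->
  (forall m, F m `<=` hpiece H m) -> (forall y, y \in s -> pset y.1 `<=` pset P -> y.1 = P) ->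
  fin (@loc R P M (total F)) /\ len (@loc R P M (total F)) = count (fun y => y.1 == P) s.
Proof.
elim=> [|{}F {}s Q a v LF IH hQ vQ] FH sP.
  rewrite total_zerofam loc_set0; split; first exact: fin_set0.
  exact: len_set0.
have gF := pfilt_gfam (gfam_zerofam G M) LF.
have gc := gfam_cyc hR a v.
have FH' m : F m `<=` hpiece H m.
  by apply: subset_trans (FH m); apply: ksub_subl; apply: gfam_ksub gc.
have Hv : v \in H a.
  by apply: (FH a); apply: ksub_subr (gfam_ksub _ gF) _ (cyc_gen hR a v).
have [|fF lF] := IH FH'; first by move=> y ys; apply: sP; rewrite inE ys orbT.
have sT := submod_total F.
(* The filtration speaks of homogeneous b only; the general case is componentwise, Q being
   homogeneous. *)
have TQ b : total F (b *: v) <-> b \in Q.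
  split=> [Tb|Qb].
    have [n bn] := hcomp_fin dG b; have [_ ->] := bn n (leqnn n).
    apply: (ksub_sum (W := pset Q) _ (ksub_pset Q)) => i.
    apply/(vQ i _ (hcomp_in dG b i)).
    have := total_hcomp (i + a) gF FH' Tb.
    by rewrite (hcompZr hR dH (proj2 gH) b (i + a) Hv) leq_addl addnK.
  have [n bn] := hcomp_fin dG b; have [_ ->] := bn n (leqnn n).
  rewrite scaler_suml; apply: (submod_sum _ sT) => i.
  apply: (@total_sub _ (i + a)%N); apply/vQ; first exact: hcomp_in.
  exact: hQ.
rewrite (total_cyc _ _ gF) /=.
have [QP|QP] := eqVneq Q P.
  have [st ex] := @loc_step_simple R P M _ _ _ sT TQ (congr1 (@pset R) QP).
  have sW' : submod (@loc R P M (total F :+: range (fun b : R => b *: v))).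
    by apply: submod_loc; apply: submod_sumset => //; apply: submod_line.
  by have [fF' lF'] := len_step fF sW' st ex; rewrite lF' lF add1n.
have [t tQ tP] : exists2 t, t \in Q & t \notin P.
  apply: contrapT => nt; move/eqP: QP; apply; apply: (sP (Q, a)); first exact: mem_head.
  by move=> t tQ; apply: contrapT => /negP tP; apply: nt; exists t.
by rewrite (loc_step_trivial sT TQ tQ tP) add0n.
Qed.

Lemma local_length_count (K : realType) (P : spectrum R) s :
  pfilt (@zerofam M) (hpiece H) s -> minimal_prime P ->
  module_length K (localization P M) = (count (fun y => y.1 == P) s)%:R%:E.
Proof.
move=> ps mP; have [|y ys yP|fT lT] := @pfilt_local_length P _ _ ps; first by move=> m x.
  apply: pset_inj; apply/seteqP; split=> // x; exact: mP.
rewrite total_hpiece loc_setT in fT lT.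
by rewrite -lT; apply: submodule_lengthE.
Qed.

End PfiltLocal.

(** * Hilbert-Kunz lengths of graded modules *)

Section HilbertKunzLength.
Variables (k : fieldType) (R : comAlgType k) (G : nat -> {pred R}).
Hypothesis hR : standard_graded G.
Variables (p : nat) (chR : p \in [pchar R]).

Local Notation dG := (piece_direct hR).

Lemma homogeneous_generators (I : submodClosed R^o) : homogeneous_ideal G I ->
  exists fs : seq (nat * R), homog_seq G fs /\
    forall x : R^o, x \in I <-> lin [seq df.2 : R^o | df <- fs] x.
Proof.
move=> hI; have [s sE] := sg_noetherian hR I.
have [l lH ls] : exists2 l : seq R^o,
    (forall x, x \in l -> x \in I /\ exists m, x \in G m) & forall y, y \in s -> lin l y.
  by apply: span_of_finite_seq => y ys; rewrite -hI sE; apply: span_of_gen.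
have IE (x : R^o) : x \in I <-> lin l x.
  split.
    rewrite sE => /span_of_lin; apply: lin_min; [exact: submod_lin | exact: ls].
  apply: (@lin_min R R^o l [set x | x \in I]) => [|y /lH[]//].
  exact/submod_pred/submodClosedP.
have [fs [hfs fl]] : exists fs : seq (nat * R), homog_seq G fs /\ [seq df.2 : R^o | df <- fs] = l.
  elim: l lH {ls IE} => [|x l IH] lH; first by exists [::].
  have [|fs [hfs fl]] := IH; first by move=> y yl; apply: lH; rewrite inE yl orbT.
  have [_ [m Gx]] := lH x (mem_head _ _).
  exists ((m, x) :: fs); split; last by rewrite /= fl.
  by move=> df; rewrite inE => /predU1P[->|/hfs].
by exists fs; rewrite fl.
Qed.

Section Ideal.
Variables (I : submodClosed R^o) (fs : seq (nat * R)).
Hypothesis hfs : homog_seq G fs.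
Hypothesis Ifs : forall x : R^o, x \in I <-> lin [seq df.2 : R^o | df <- fs] x.
Variable n : nat.
Local Notation q := (p ^ n)%N.

(** Raising to the power q = p^n is additive, so the q-th powers of generators of I suffice. *)
Lemma frobenius_power_lin (x : R^o) :
  x \in frobenius_power I q <-> lin [seq (df.2 ^+ q : R^o) | df <- fs] x.
Proof.
split.
  apply: span_of_min => [|_ [a /Ifs la ->]]; first exact: submod_lin.
  elim: (fs) a la => [|df fs' IH] a /=.
    by move=> ->; rewrite expr0n gtn_eqF // expn_gt0 (prime_gt0 (pcharf_prime chR)).
  move=> [_ [a' [[b _ <-] /IH la' ->]]].
  exists (b ^+ q * df.2 ^+ q), (a' ^+ q); split; [by exists (b ^+ q) | exact: la' |].
  rewrite -exprMn; exact: (rmorphD (frobenius_iter n chR : {rmorphism R -> R})).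
apply: (@lin_min R R^o _ [set x | x \in frobenius_power I q]).
  exact/submod_pred/span_of_closed.
move=> _ /mapP[df dffs ->]; apply: span_of_gen; exists df.2 => //.
by apply/Ifs; apply: lin_mem; apply: map_f.
Qed.

Section Module.
Variables (V : lmodType R) (H : nat -> {pred V}).
Hypothesis gH : graded_module G H.
Local Notation dH := (proj1 gH).

Definition powers_module : set V :=
  foldr (fun df S => smul (df.2 ^+ q) setT :+: S) [set 0] fs.

Lemma submod_smulT (x : R) : submod (smul x (setT : set V)).
Proof. exact: (submod_image (linear_smul x) (submod_setT V)). Qed.

Lemma submod_powers_module : submod powers_module.
Proof.
rewrite /powers_module; elim: fs => [|df fs' IH]; first exact: submod_set0.
by apply: submod_sumset => //; apply: submod_smulT.
Qed.

Lemma ideal_mul_powers (v : V) :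
  v \in ideal_mul_module (frobenius_power I q) V <-> powers_module v.
Proof.
split.
  apply: span_of_min => [|_ [a [w [/frobenius_power_lin la ->]]]].
    exact: submod_powers_module.
  rewrite /powers_module; elim: (fs) a la => [a /= -> |df fs' IH a]; first by rewrite scale0r.
  move=> /= [_ [a' [[b _ <-] /IH la' ->]]]; rewrite scalerDl.
  exists (b * df.2 ^+ q *: w), (a' *: w); split=> //.
  by exists (b *: w) => //; rewrite scalerA mulrC.
have sN : submod [set v | v \in ideal_mul_module (frobenius_power I q) V].
  exact/submod_pred/span_of_closed.
have : {subset fs <= fs} by [].
rewrite /powers_module; elim: {1 3}(fs) v => [v _ /= ->|df fs' IH v sub].
  exact: (submod0 sN).
move=> [_ [v' [[w _ <-] lv' ->]]]; apply: (submodD sN); last first.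
  by apply: IH lv' => x xf; apply: sub; rewrite inE xf orbT.
apply: span_of_gen; exists (df.2 ^+ q), w; split=> //.
apply/frobenius_power_lin; apply: lin_mem; apply/mapP.
by exists df => //; apply: sub; rewrite mem_head.
Qed.

Lemma powers_module_homog m (v : V) : v \in H m ->
  (powers_module v <-> powers_fam fs q (hpiece H) m v).
Proof.
move=> Hv; split; last first.
  rewrite /powers_module; elim: (fs) v {Hv} => //= df fs' IH v.
  by apply: sumsetS => // _ [w _ <-]; exists w.
move=> pv; rewrite -(hcomp_eq dH Hv); move: v pv {Hv}.
rewrite /powers_module; move: hfs.
elim: (fs) => [_ v /= ->|df fs' IH /homog_seq_cons[Gdf /IH {}IH] v].
  by rewrite hcomp0.
move=> [_ [v' [[w _ <-] /IH lv' ->]]]; rewrite hcompD.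
exists (hcomp dH (df.2 ^+ q *: w) m), (hcomp dH v' m); split=> //.
rewrite (hcompZ dH (proj2 gH) w m (pieceX hR q Gdf)) /sh; case: ifP => le.
  by exists (hcomp dH w (m - q * df.1)) => //; apply: hcomp_in.
by exists 0; rewrite ?scaler0.
Qed.

(** Rank-nullity for the projection to V/I^[q]V, whose kernel in degree m is the degree m part of
    I^[q]V. *)
Lemma HK_length_nat (K : realType) m : kfin (hpiece H m) ->
  @HK_length K k R I V H q (Posz m) = (hkm fs q (@zerofam V) (hpiece H) m)%:R%:E.
Proof.
move=> fH; set N := ideal_mul_module (frobenius_power I q) V.
have lproj : linear (quotmod_proj N : V -> quotmod N).
  by move=> a u v; rewrite quotmod_projD quotmod_projZ.
have sN : ksub [set v | v \in N] by apply: submod_ksub; apply/submod_pred/submodClosedP.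
have fimg := kfin_image lproj fH.
rewrite /HK_length /component (@klenE _ _ _ _ _ (quotmod_proj N @` hpiece H m)) //; last first.
  move=> y; split; first by move=> /asboolP[v Hv ->]; exists v.
  by move=> [v Hv <-]; apply/asboolP; exists v.
congr (_%:R%:E); rewrite /hkm /zerofam sumset0l.
have e1 := krank_nullity lproj fH.
have e2 : (krel (hpiece H m) [set v | v \in N] + klen (hpiece H m `&` [set v | v \in N]) =
    klen (hpiece H m))%N := rlen_cap_len fH sN.
have e3 : krel (hpiece H m) [set v | v \in N] = krel (hpiece H m) (powers_fam fs q (hpiece H) m).
  apply: krel_eq => v Hv; split=> [/ideal_mul_powers|h].
    by move/(powers_module_homog Hv).
  by apply/ideal_mul_powers/(powers_module_homog Hv).
have e4 : hpiece H m `&` [set x | quotmod_proj N x = 0%R] = hpiece H m `&` [set v | v \in N].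
  have e0 := linear_fun0 lproj.
  apply/seteqP; split=> v [Hv Nv]; split=> //.
    by have := (quotmod_projE N v 0); rewrite subr0 e0 => -[+ _]; apply.
  by rewrite /= -e0; apply/quotmod_projE; rewrite subr0.
rewrite -e3; rewrite e4 in e1.
apply: (@addIn (klen (hpiece H m `&` [set v | v \in N]))).
exact: (etrans (esym e1) (esym e2)).
Qed.

Lemma HK_length_neg (K : realType) m : @HK_length K k R I V H q (Negz m) = 0%E.
Proof.
rewrite /HK_length /component (@klenE _ _ _ _ _ [set 0]); last 2 first.
- by move=> x; rewrite inE; split=> [/eqP|->].
- exact: kfin_set0.
by rewrite /klen len_set0.
Qed.

End Module.
End Ideal.

Lemma finitely_generated_pfilt (V : lmodType R) (H : nat -> {pred V}) :
  graded_module G H -> finitely_generated (predT : {pred V}) ->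
  exists s, pfilt hR (@zerofam V) (hpiece H) s.
Proof.
move=> gH [s0 sE].
have [l [Hl lP]] := homogeneous_gens hR (proj1 gH) (proj2 gH) s0.
have [s ps] := pfilt_gens hR l (gfam_zerofam G V).
exists s; suff <- : fadd (@zerofam V) (gens G l) = hpiece H by [].
apply/funext => m; rewrite /fadd /zerofam sumset0l; apply/seteqP; split=> v.
  apply: sums_min; first exact: gfam_ksub (gfam_hpiece hR gH).
  move=> av /Hl[y _ e]; apply: cyc_sub; first exact: gfam_hpiece.
  by rewrite e; apply: hcomp_in.
move=> Hv; rewrite -(hcomp_eq (proj1 gH) Hv); apply: lP.
by apply/span_of_lin; rewrite -sE.
Qed.

Section QuotientByPrime.
Variable P : spectrum R.
Hypothesis hP : hprime hR P.
Local Notation V := (quotmod (prime_submod P)).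
Local Notation proj := (quotmod_proj (prime_submod P)).
Local Notation H := (quot_grading (prime_submod P) G).

Lemma quot_proj_linear : linear (proj : R^o -> V).
Proof. by move=> a u v; rewrite quotmod_projD quotmod_projZ. Qed.

Lemma quot_proj_eq0 (b : R^o) : proj b = 0 <-> b \in P.
Proof.
rewrite -[X in _ = X](linear_fun0 quot_proj_linear).
by rewrite (quotmod_projE (prime_submod P)) subr0.
Qed.

Lemma quot_proj1 (a : R) : a *: proj (1 : R^o) = proj (a : R^o).
Proof.
have := quotmod_projZ (prime_submod P) a (1 : R^o).
by rewrite [in proj _]/GRing.scale /= mulr1 => ->.
Qed.

Lemma quot_proj_sum (I : Type) (r : seq I) (F : I -> R^o) :
  proj (\sum_(i <- r) F i) = \sum_(i <- r) proj (F i).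
Proof.
elim: r => [|i r IH]; first by rewrite !big_nil; apply/quot_proj_eq0; apply: idealr0.
by rewrite !big_cons quotmod_projD IH.
Qed.

Lemma graded_quot_prime : graded_module G H.
Proof.
split; last first.
  move=> i j a _ Ga /asboolP[v Gv ->]; apply/asboolP; exists (a *: v).
    exact: (pieceM hR).
  by rewrite quotmod_projZ.
split.
- move=> m; have [/(_ m) [G0 GB] _ _] := dG; split.
    apply/asboolP; exists 0 => //; symmetry; apply/quot_proj_eq0; exact: idealr0.
  move=> _ _ /asboolP[u Gu ->] /asboolP[v Gv ->]; apply/asboolP.
  exists (u - v); first exact: GB.
  by have := quot_proj_linear (-1) v u; rewrite !scaleN1r ![- _ + _]addrC.
- move=> y; have [n bn] := hcomp_fin dG (quotmod_repr y : R); have [_ e] := bn n (leqnn n).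
  exists n, (fun i => proj (hcomp dG (quotmod_repr y : R) i)); split.
    by move=> i; apply/asboolP; exists (hcomp dG (quotmod_repr y : R) i) => //; apply: hcomp_in.
  by rewrite -quot_proj_sum -e quotmod_projK.
move=> n f Hf f0 i lti.
have [|g gP] := @choice nat R^o (fun i g => g \in G i /\ f i = proj g).
  move=> j; by have /asboolP[v Gv fv] := Hf j; exists v.
have : \sum_(i < n) g i \in P.
  apply/quot_proj_eq0; rewrite quot_proj_sum.
  transitivity (\sum_(j < n) f j); last exact: f0.
  apply: eq_bigr => j _.
  by rewrite (proj2 (gP j)).
move=> gsum; have := hP i gsum; rewrite /pset /= hcomp_sum (bigD1 (Ordinal lti)) //=.
rewrite (hcomp_eq dG (proj1 (gP i))) big1 => [|j ne]; last first.
  rewrite (hcomp_homog dG i (proj1 (gP j))); case: eqP => // e.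
  by move: ne; rewrite -val_eqE /= e eqxx.
by rewrite addr0 (proj2 (gP i)) => /quot_proj_eq0.
Qed.

Lemma hpiece_quot_prime : hpiece H = fadd (@zerofam V) (cyc G 0 (proj (1 : R^o))).
Proof.
apply/funext => m; rewrite /fadd /zerofam sumset0l /cyc sh0.
apply/seteqP; split=> [_ /asboolP[b Gb ->]|_ [b Gb <-]].
  by exists b => //; rewrite quot_proj1.
by apply/asboolP; exists b => //; rewrite quot_proj1.
Qed.

Lemma pfilt_quot_prime : pfilt hR (@zerofam V) (hpiece H) [:: (P, 0%N)].
Proof.
rewrite hpiece_quot_prime; apply: pfilt_cons => //; first exact: pfilt_nil.
by move=> i b Gb; rewrite /zerofam /= quot_proj1 quot_proj_eq0.
Qed.

Lemma hkm_quot_prime fs q m :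
  hkm fs q (@zerofam V) (hpiece H) m = hk G fs q P 0 m.
Proof.
have gP := graded_quot_prime; have gH := gfam_hpiece hR gP.
have sJ : ksub (powers_fam fs q (hpiece H) m) := ksub_J _ _ _ gH.
rewrite /hkm /zerofam sumset0l hpiece_quot_prime.
have eF : fadd (fun=> [set 0]) (cyc G 0 (proj (1 : R^o))) =
    cyc G 0 (proj (1 : R^o)) :> (nat -> set V).
  by apply/funext => i; rewrite /fadd sumset0l.
rewrite /zerofam eF.
rewrite (krel_cyc _ _ _ (kfin_piece hR)); last by apply: ksub_J; apply: gfam_cyc.
rewrite J_cyc /hk sh0; apply: krel_eq => b Gb.
split=> [[j Jj]|[z [j [Pz Jj e]]]].
  rewrite /= !quot_proj1 => /quotmod_projE jb; exists (b - j), j; split=> //; last by rewrite subrK.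
  by rewrite -opprB; apply: submodN (submod_pset P) jb.
exists j => //; rewrite /= !quot_proj1; apply/quotmod_projE.
by rewrite e opprD addrCA subrr addr0; apply: submodN (submod_pset P) Pz.
Qed.

End QuotientByPrime.
End HilbertKunzLength.

(** * Krull dimension of quotients *)

Section KrullDimension.
Variables (K : realType) (R : comNzRingType) (d : nat).
Hypothesis hdim : krull_dim K R = d%:R%:E.
Implicit Types P Q : spectrum R.

Lemma strict_chain_le n (Q : nat -> spectrum R) :
  strict_chain n (fun i => (Q i : {pred R})) -> (n <= d)%N.
Proof.
move=> ch; have : (n%:R%:E <= krull_dim K R)%E.
  by apply: ereal_sup_ubound; exists n => //; exists Q.
by rewrite hdim lee_fin ler_nat.
Qed.

Lemma krull_above P : ~ above P d.+1.
Proof.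
move=> [Q [_ st]]; have : (d.+1 <= d)%N; last by rewrite ltnn.
apply: (@strict_chain_le _ Q) => i lti; have [Qi [x Qx Qix]] := st i lti.
by split; [exact: Qi | exists x => //; apply/negP].
Qed.

Section Quotient.
Variable P : spectrum R.
Local Notation RP := {ideal_quot P}.
Local Notation pi := (\pi_RP : R -> RP).

Lemma pi_eq (x y : R) : pi x = pi y <-> x - y \in P.
Proof.
by split=> [/eqP|h]; [rewrite -(Quotient.idealrBE P) | apply/eqP; rewrite -(Quotient.idealrBE P)].
Qed.

Lemma piD (x y : R) : pi (x + y) = pi x + pi y. Proof. by rewrite rmorphD. Qed.
Lemma piM (x y : R) : pi (x * y) = pi x * pi y. Proof. by rewrite rmorphM. Qed.

Section Preimage.
Variable Q : spectrum RP.

Let pre (x : R) : bool := pi x \in Q.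

Let pre_ideal : idealr_closed pre.
Proof.
split.
- by change (is_true (pi 0 \in Q)); rewrite rmorph0 idealr0.
- by change (is_true (pi 1 \notin Q)); rewrite rmorph1 idealr1.
move=> a u v Qu Qv; change (is_true (pi (a * u + v) \in Q)); rewrite piD piM.
by apply: (@rpredD _ Q) => //; apply: (@idealMr _ Q).
Qed.

Let pre_prime : prime_idealr_closed pre.
Proof.
move=> u v uv; have {}uv : pi (u * v) \in Q := uv.
by rewrite piM prime_idealrM in uv.
Qed.

Definition spec_preimage : spectrum R := Spectrum pre_ideal pre_prime.

Lemma spec_preimageE x : (x \in spec_preimage) = (pi x \in Q).
Proof. by []. Qed.

End Preimage.

Section Image.
Variable Q : spectrum R.
Hypothesis PQ : pset P `<=` pset Q.

Lemma repr_piE x : (repr (pi x) \in Q) = (x \in Q).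
Proof.
have d1 : repr (pi x) - x \in Q by apply: PQ; apply/pi_eq; rewrite reprK.
apply/idP/idP => [h|h]; last first.
  by rewrite -(subrK x (repr (pi x))) (@rpredD _ Q).
by rewrite -(subKr (repr (pi x)) x) (@rpredB _ Q).
Qed.

Let img (y : RP) : bool := repr y \in Q.

Let imgE x : img (pi x) = (x \in Q). Proof. exact: repr_piE. Qed.

Let img_ideal : idealr_closed img.
Proof.
split.
- change (is_true (img 0)); have -> : 0 = pi 0 :> RP by rewrite rmorph0.
  by rewrite imgE idealr0.
- change (is_true (~~ img 1)); have -> : 1 = pi 1 :> RP by rewrite rmorph1.
  by rewrite imgE idealr1.
move=> a u v Qu Qv; change (is_true (img (a * u + v))).
have -> : a * u + v = pi (repr a * repr u + repr v) by rewrite piD piM !reprK.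
by rewrite imgE; apply: (@rpredD _ Q) => //; apply: (@idealMr _ Q).
Qed.

Let img_prime : prime_idealr_closed img.
Proof.
move=> u v uv; have {}uv : img (pi (repr u * repr v)) by rewrite piM !reprK.
by rewrite imgE prime_idealrM in uv.
Qed.

Definition spec_image : spectrum RP := Spectrum img_ideal img_prime.

Lemma spec_imageE x : (pi x \in spec_image) = (x \in Q).
Proof. exact: repr_piE. Qed.

End Image.

Lemma krull_quot : above P d -> krull_dim K RP = d%:R%:E.
Proof.
move=> [Q [PQ st]]; apply/eqP; rewrite eq_le; apply/andP; split.
  apply: ge_ereal_sup => _ [n [C ch] <-]; rewrite lee_fin ler_nat.
  apply: (@strict_chain_le _ (fun i => spec_preimage (C i))) => i lti.
  have [Ci [y Cy Ciy]] := ch i lti; split.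
    by move=> x; rewrite !spec_preimageE; apply: Ci.
  by exists (repr y); rewrite spec_preimageE reprK.
have PQi i : (i <= d)%N -> pset P `<=` pset (Q i).
  elim: i => // i IH lti; apply: subset_trans (IH (ltnW lti)) _.
  by have [] := st i lti.
(* Beyond index d nothing is known of [Q i]; the zero ideal of R/P is a placeholder. *)
pose C i := if pselect (pset P `<=` pset (Q i)) is left h then spec_image h
            else spec_image (@subset_refl _ (pset P)).
have CE i x : (i <= d)%N -> (pi x \in C i) = (x \in Q i).
  by move=> /PQi h; rewrite /C; case: pselect => // h'; apply: spec_imageE.
apply: ereal_sup_ubound; exists d => //; exists C => i lti.
have [Qi [x Qx Qix]] := st i lti; split.
  move=> y; rewrite -[y]reprK CE ?(ltnW lti) // CE //; exact: Qi.
exists (pi x); first by rewrite CE.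
by rewrite CE ?(ltnW lti) //; apply/negP.
Qed.

End Quotient.
End KrullDimension.

(** * Limits of normalized lengths *)

Section Limits.
Variables (K : realType) (p e : nat) (x : K).
Hypotheses (p1 : (1 < p)%N) (x0 : 0 <= x).

Lemma geometric_cvg (w : nat -> K) C :
  (forall n, `|w n.+1 - w n| <= C * 2^-1 ^+ n) -> cvgn w.
Proof.
move=> wC.
have C0 : 0 <= C by have := wC 0%N; rewrite expr0 mulr1; apply: le_trans.
have h : cvgn (series (telescope w)).
  apply: normed_cvg; apply: (@series_le_cvg _ _ (geometric C 2^-1)).
  - by move=> n; apply: normr_ge0.
  - by move=> n; rewrite /= mulr_ge0 // exprn_ge0 // invr_ge0.
  - by move=> n; apply: wC.
  by apply: is_cvg_geometric_series; rewrite ger0_norm ?invr_ge0 // invf_lt1 // ltr1n.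
rewrite telescopeK in h.
have -> : w = (fun n => (w n - w 0%N) + w 0%N) by apply/funext => n; rewrite subrK.
by apply: is_cvgD h _; apply: is_cvg_cst.
Qed.

Definition fl n : nat := `|Num.floor (x * (p ^ n)%:R)|%N.

Lemma fl_floor n : Num.floor (x * (p ^ n)%:R) = Posz (fl n).
Proof. by rewrite /fl gez0_abs // floor_ge_int mulr_ge0. Qed.

Lemma fl_le n : (fl n)%:R <= x * (p ^ n)%:R.
Proof.
by have := floor_le (x * (p ^ n)%:R); rewrite fl_floor.
Qed.

Lemma fl_gt n : x * (p ^ n)%:R < (fl n).+1%:R.
Proof.
by have := floorD1_gt (x * (p ^ n)%:R); rewrite fl_floor -[(fl n).+1]addn1 natrD rmorphD.
Qed.

Lemma p_gt0 n : (0 < p ^ n)%N. Proof. by rewrite expn_gt0 (ltnW p1). Qed.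

(** Passing from scale q to scale qQ turns the degree m into Qm + r with r < Q, the form of the
    degrees in [frob_fam]. *)
Lemma fl_add n N : exists r, (r < p ^ N)%N /\ fl (n + N) = (p ^ N * fl n + r)%N.
Proof.
have Q0 : 0 < (p ^ N)%:R :> K by rewrite ltr0n p_gt0.
have e1 : x * (p ^ (n + N))%:R = (p ^ N)%:R * (x * (p ^ n)%:R).
  by rewrite expnD natrM; ring.
have h1 : (p ^ N * fl n < (fl (n + N)).+1)%N.
  rewrite -(ltr_nat K); apply: le_lt_trans (fl_gt _); rewrite e1 natrM.
  by rewrite ler_pM2l // fl_le.
have h2 : (fl (n + N) < p ^ N * (fl n).+1)%N.
  rewrite -(ltr_nat K); apply: le_lt_trans (fl_le _) _; rewrite e1 natrM.
  by rewrite ltr_pM2l // fl_gt.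
exists (fl (n + N) - p ^ N * fl n)%N; rewrite mulnS in h2; split; lia.
Qed.

Definition normalized (g : nat -> nat -> nat) n : K :=
  ((p ^ n) ^ e.+1)%:R^-1 * (g (p ^ n)%N (fl n))%:R.

(** With q = p^n one has [fl n] + 1 <= (x + 1) q, which leaves a factor 1/q <= 2^-n: errors O(m^e)
    become geometrically small. *)
Lemma small_bound n : ((p ^ n) ^ e.+1)%:R^-1 * ((fl n).+1 ^ e)%:R <= (x + 1) ^+ e * 2^-1 ^+ n.
Proof.
have q0 : 0 < (p ^ n)%:R :> K by rewrite ltr0n p_gt0.
have le1 : (fl n).+1%:R <= (x + 1) * (p ^ n)%:R.
  by rewrite -natr1 mulrDl mul1r lerD ?fl_le // ler1n p_gt0.
have le2 : ((fl n).+1 ^ e)%:R <= (x + 1) ^+ e * (p ^ n)%:R ^+ e.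
  rewrite natrX -exprMn; apply: lerXn2r => //; rewrite nnegrE //.
  by apply: mulr_ge0; [apply: addr_ge0 | apply: ltW].
have le3 : (p ^ n)%:R^-1 <= 2^-1 ^+ n :> K.
  rewrite exprVn lef_pV2 ?posrE ?exprn_gt0 // -natrX ler_nat.
  by case: (n) => // n'; rewrite leq_exp2r.
have A0 : 0 <= ((p ^ n) ^ e.+1)%:R^-1 :> K by rewrite invr_ge0.
apply: le_trans (ler_wpM2l A0 le2) _.
have -> : ((p ^ n) ^ e.+1)%:R^-1 * ((x + 1) ^+ e * (p ^ n)%:R ^+ e) = (x + 1) ^+ e * (p ^ n)%:R^-1.
  rewrite natrX exprSr mulrCA; congr (_ * _).
  by rewrite invfM mulrAC mulVf ?mul1r // expf_neq0 // lt0r_neq0.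
by apply: ler_wpM2l le3; rewrite exprn_ge0 // addr_ge0.
Qed.

Lemma geometric_to0 (C : K) : (fun n => C * 2^-1 ^+ n) @ \oo --> (0 : K).
Proof.
apply: cvg_geometric; rewrite ger0_norm ?invr_ge0 // invf_lt1 // ltr1n //.
Qed.

Lemma normalized_ge0 h n : 0 <= normalized h n.
Proof. by rewrite /normalized mulr_ge0 // invr_ge0. Qed.

Lemma normalized_small h C : (forall q m, h q m <= C * m.+1 ^ e)%N ->
  normalized h @ \oo --> (0 : K).
Proof.
move=> hC; apply: (@squeeze_cvgr _ _ _ _ (fun=> 0) (fun n => (C%:R * (x + 1) ^+ e) * 2^-1 ^+ n)).
- apply: nearW => n; rewrite normalized_ge0 /= /normalized -mulrA.
  apply: (@le_trans _ _ (((p ^ n) ^ e.+1)%:R^-1 * (C * (fl n).+1 ^ e)%:R)).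
    by rewrite ler_wpM2l ?invr_ge0 // ler_nat.
  by rewrite natrM mulrCA ler_wpM2l // small_bound.
- exact: cvg_cst.
exact: geometric_to0.
Qed.

Definition close (g h : nat -> nat -> nat) N C r := forall q m,
  (g (q * p ^ N) (p ^ N * m + r) <= (p ^ N) ^ e.+1 * h q m + C * m.+1 ^ e)%N /\
  ((p ^ N) ^ e.+1 * h q m <= g (q * p ^ N) (p ^ N * m + r) + C * m.+1 ^ e)%N.

Definition compares (g h : nat -> nat -> nat) N :=
  forall r, (r < p ^ N)%N -> exists C, close g h N C r.

Lemma compares_normalized g h N : compares g h N -> exists C, forall n,
  `|normalized g (n + N) - normalized h n| <= C * 2^-1 ^+ n.
Proof.
move=> gh.
(* There are finitely many remainders r, so one constant serves for all. *)
have [C gC] : exists C, forall r, (r < p ^ N)%N -> close g h N C r.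
  have closeW C D r : (C <= D)%N -> close g h N C r -> close g h N D r.
    move=> CD gC q m; have [h1 h2] := gC q m.
    have le : (C * m.+1 ^ e <= D * m.+1 ^ e)%N by rewrite leq_mul2r CD orbT.
    by split; [apply: leq_trans h1 _ | apply: leq_trans h2 _]; rewrite leq_add2l.
  suff : forall b, (b <= p ^ N)%N -> exists C, forall r, (r < b)%N -> close g h N C r.
    exact.
  elim=> [|b IH] le; first by exists 0%N.
  have [C1 c1] := IH (ltnW le); have [C2 c2] := gh b le.
  exists (C1 + C2)%N => r; rewrite ltnS leq_eqVlt => /predU1P[->|rb].
    exact: closeW (leq_addl _ _) c2.
  exact: closeW (leq_addr _ _) (c1 r rb).
exists (C%:R * (x + 1) ^+ e) => n.
have [r [rQ fr]] := fl_add n N; have [h1 h2] := gC r rQ (p ^ n)%N (fl n).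
rewrite /normalized fr expnD expnMn.
set A := ((p ^ n) ^ e.+1)%N; set B := ((p ^ N) ^ e.+1)%N.
rewrite -/B in h1 h2; set g1 := g _ _ in h1 h2 *; set h0 := h _ _ in h1 h2 *.
have A0 : 0 < A%:R :> K by rewrite ltr0n /A expn_gt0 p_gt0.
have B1 : 1 <= B%:R :> K by rewrite ler1n /B expn_gt0 p_gt0.
have B0 : 0 < B%:R :> K by apply: lt_le_trans B1.
have -> : (A * B)%:R^-1 * g1%:R - A%:R^-1 * h0%:R =
    A%:R^-1 * (B%:R^-1 * (g1%:R - B%:R * h0%:R)) :> K.
  rewrite natrM; field; rewrite !lt0r_neq0 //.
have le1 : `|g1%:R - B%:R * h0%:R| <= C%:R * ((fl n).+1 ^ e)%:R :> K.
  have dist (a b c : K) : a <= b + c -> b <= a + c -> `|a - b| <= c.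
    by move=> ab ba; rewrite ler_norml; apply/andP; split; lra.
  by apply: dist; rewrite -!natrM -natrD ler_nat.
have iA : 0 <= A%:R^-1 :> K by rewrite invr_ge0 ltW.
have iB : 0 <= B%:R^-1 :> K by rewrite invr_ge0 ltW.
rewrite normrM (ger0_norm iA) normrM (ger0_norm iB).
apply: (@le_trans _ _ (A%:R^-1 * (C%:R * ((fl n).+1 ^ e)%:R))).
  apply: ler_wpM2l => //; apply: le_trans le1.
  by rewrite ler_piMl // invf_le1.
by rewrite mulrCA -mulrA ler_wpM2l // small_bound.
Qed.

Lemma normalized_limit g h N l : compares g h N -> normalized h @ \oo --> (l : K) ->
  normalized g @ \oo --> l.
Proof.
move=> /compares_normalized[C gh] hl.
rewrite -(cvg_shiftn N).
have -> : [sequence normalized g (n + N)]_n =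
    (fun n => (normalized g (n + N) - normalized h n) + normalized h n).
  by apply/funext => n; rewrite subrK.
rewrite -[l]add0r; apply: cvgD hl.
apply: (@squeeze_cvgr _ _ _ _ (fun n => - (C * 2^-1 ^+ n)) (fun n => C * 2^-1 ^+ n)).
- by apply: nearW => n; rewrite -ler_norml gh.
- by rewrite -oppr0; apply: cvgN; apply: geometric_to0.
exact: geometric_to0.
Qed.

(** The comparison is available for large N only, perhaps not for N = 1. Using N0 and N0 + 1 puts
    two consecutive terms near the same [normalized h n], so their difference is geometrically
    small. *)
Lemma normalized_cvg h N0 : (forall N, (N0 <= N)%N -> compares h h N) ->
  cvgn (normalized h).
Proof.
move=> hh; have [C1 c1] := compares_normalized (hh N0 (leqnn _)).
have [C2 c2] := compares_normalized (hh N0.+1 (leqnSn _)).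
have : cvgn [sequence normalized h (n + N0)]_n.
  apply: (@geometric_cvg _ (C1 + C2)) => n /=.
  have := c1 n; have := c2 n; rewrite -addSnnS => h2 h1.
  rewrite mulrDl.
  have -> : normalized h (n.+1 + N0) - normalized h (n + N0) =
    (normalized h (n.+1 + N0) - normalized h n) - (normalized h (n + N0) - normalized h n).
    by rewrite opprB addrA subrK.
  by apply: le_trans (ler_normB _ _) _; rewrite addrC lerD.
move=> /cvg_ex[l]; rewrite cvg_shiftn => hl; apply/cvg_ex; by exists l.
Qed.

End Limits.

(** * Density functions *)

Section Density.
Variables (K : realType) (k : fieldType) (R : comAlgType k) (G : nat -> {pred R}).
Hypothesis hR : standard_graded G.
Variables (p e : nat) (chR : p \in [pchar R]).
Hypothesis perfect : forall a : k, exists b : k, b ^+ p = a.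
Hypothesis hdim : krull_dim K R = e.+2%:R%:E.
Variables (I : submodClosed R^o) (fs : seq (nat * R)).
Hypothesis hfs : homog_seq G fs.
Hypothesis Ifs : forall x : R^o, x \in I <-> lin [seq df.2 : R^o | df <- fs] x.
Variable sR : seq (spectrum R * nat).
Hypothesis psR : pfilt hR (@zerofam R^o) (piece G) sR.
Variable x : K.
Hypothesis x0 : 0 <= x.

Let p1 : (1 < p)%N. Proof. exact: prime_gt1 (pcharf_prime chR). Qed.

Local Notation normalized := (normalized p e x).

Definition prime_density (P : spectrum R) : K :=
  limn (normalized (fun q m => hk G fs q P 0 m)).

Lemma HKd_hkm (V : lmodType R) (H : nat -> {pred V}) : graded_module G H ->
  (forall m, kfin (hpiece H m)) ->
  HKd p e.+2 I H x = limn (normalized (fun q m => hkm fs q (@zerofam V) (hpiece H) m)).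
Proof.
move=> gH fH; rewrite /HKd; congr (limn _); apply/funext => n.
by rewrite /normalized (fl_floor _ x0) (HK_length_nat hR chR hfs Ifs n gH).
Qed.

Lemma pfilt_compares (V : lmodType R) (H : nat -> set V) s N :
  pfilt hR (@zerofam V) H s -> (size sR <= N)%N ->
  compares p e (fun q m => hkm fs q (@zerofam V) H m)
    (fun q m => \sum_(y <- s) hk G fs q y.1 0 m)%N N.
Proof.
move=> ps sN r rN; apply: (frobenius_estimate chR perfect (krull_above hdim) psR) => //.
(* Q = p^N exceeds N, hence the nilpotency exponent of the radical. *)
by apply: leq_trans sN _; apply: ltnW; apply: ltn_expl.
Qed.

(** The module R/P is filtered by R/P alone, so its length function is compared with itself. *)
Lemma prime_density_cvg P : hprime hR P ->
  normalized (fun q m => hk G fs q P 0 m) @ \oo --> prime_density P.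
Proof.
move=> hP; apply: (@normalized_cvg _ _ _ _ p1 x0 _ (size sR)) => N sN r rN.
have [C cC] := pfilt_compares (pfilt_quot_prime hP) sN rN.
by exists C => q m; have := cC q m; rewrite big_seq1 !(hkm_quot_prime hP).
Qed.

Lemma HKd_quotient_density P : hprime hR P ->
  HKd_quotient G p e.+2 I P x = prime_density P.
Proof.
move=> hP; rewrite /HKd_quotient HKd_hkm; last 2 first.
- exact: graded_quot_prime hP.
- by move=> m; apply: pfilt_kfin (pfilt_quot_prime hP); apply: kfin_zerofam.
congr (limn _); apply/funext => n; rewrite /normalized.
by rewrite (hkm_quot_prime hP).
Qed.

Lemma prime_density_small P : hprime hR P -> ~ big e P -> prime_density P = 0.
Proof.
move=> hP nP; have [C hC] := hilb_small 0 hP nP.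
apply: cvg_lim => //; apply: (@normalized_small _ _ _ _ p1 x0 _ C) => q m.
exact: leq_trans (hk_le_hilb hR fs q P 0 m) (hC m).
Qed.

Lemma HKd_sum (V : lmodType R) (H : nat -> {pred V}) s : graded_module G H ->
  pfilt hR (@zerofam V) (hpiece H) s ->
  HKd p e.+2 I H x = \sum_(y <- s) prime_density y.1.
Proof.
move=> gH ps; rewrite HKd_hkm //; last first.
  by move=> m; apply: pfilt_kfin ps; apply: kfin_zerofam.
apply: cvg_lim => //.
apply: (normalized_limit p1 x0 (pfilt_compares ps (leqnn _))).
have : forall y, y \in s -> hprime hR y.1 by move=> y; apply: pfilt_hprime ps.
elim: s {ps} => [|y s IH] hs.
  rewrite big_nil; rewrite (_ : normalized _ = fun=> 0); first exact: cvg_cst.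
  by apply/funext => n; rewrite /normalized big_nil mulr0.
rewrite big_cons; rewrite (_ : normalized _ =
    normalized (fun q m => hk G fs q y.1 0 m) \+
    normalized (fun q m => \sum_(z <- s) hk G fs q z.1 0 m)%N).
  apply: cvgD; first by apply: prime_density_cvg; apply: hs; apply: mem_head.
  by apply: IH => z zs; apply: hs; rewrite inE zs orbT.
by apply/funext => n; rewrite /normalized /= big_cons natrD mulrDr.
Qed.

(* The product of all primes of a filtration of R is nilpotent. *)
Lemma minimal_prime_filtration P : minimal_prime P -> exists2 y, y \in sR & y.1 = P.
Proof.
move=> mP; apply: contrapT => no.
have [|t tP] := @choice (spectrum R * nat) R
    (fun y z => y \in sR -> z \in y.1 /\ z \notin P).
  move=> y; case: (boolP (y \in sR)) => ys; last by exists 0.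
  apply: contrapT => nt; apply: no; exists y => //; apply: pset_inj; apply/seteqP.
  have sub : {subset y.1 <= P}.
    move=> z yz; apply: contrapT => Pz; apply: nt; exists z => _; split=> //.
    exact/negP.
  by split; [exact: sub | exact: (mP _ sub)].
have radt : rad sR (\prod_(y <- sR) t y).
  move=> y ys; rewrite (big_rem y) //= /pset /= mulrC.
  by apply: (@idealMr _ y.1); have [] := tP y ys.
have := rad_nilpotent psR radt => /(congr1 (fun z => z \in P)).
rewrite idealr0.
have Pprod : \prod_(y <- sR) t y \notin P.
  rewrite big_seq; elim/big_ind: _ => [|u v Pu Pv|y /tP[]//].
  - by rewrite idealr1.
  - by rewrite prime_idealrM negb_or Pu.
elim: (size sR) => [|n IH]; first by rewrite expr0 idealr1.
by rewrite exprS prime_idealrM (negbTE Pprod).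
Qed.

Lemma big_top_dim P : big e P -> P \in top_dim_minimal_primes K R.
Proof.
move=> bP; rewrite inE; split; last by rewrite hdim; apply: krull_quot.
by move=> Q QP; rewrite (big_minimal (krull_above hdim) bP QP).
Qed.

End Density.

(** * Summation over the primes *)

Lemma sum_count_fst (K : pzRingType) (T : eqType) (S : Type) (f : T -> K)
    (r : seq T) (s : seq (T * S)) : uniq r -> (forall y, y \in [seq y.1 | y <- s] -> y \in r) ->
  \sum_(y <- s) f y.1 = \sum_(P <- r) f P * (count (fun y => y.1 == P) s)%:R.
Proof.
move=> ur; elim: s => [|y s IH] sr.
  by rewrite big_nil big1 // => P _; rewrite mulr0.
rewrite big_cons IH; last by move=> z zs; apply: sr; rewrite inE zs orbT.
under [RHS]eq_bigr do rewrite /= natrD mulrDr.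
rewrite big_split /=; congr (_ + _).
rewrite (bigD1_seq y.1) //=; last by apply: sr; apply: mem_head.
rewrite eqxx mulr1 big1 ?addr0 // => P; rewrite eq_sym => /negbTE ->.
by rewrite mulr0.
Qed.

Theorem proposition2p14 (K : realType)
    (p : nat) (k : fieldType) (hp : p \in [pchar k])
    (hperfect : forall a : k, exists b : k, b ^+ p = a)
    (R : comAlgType k) (G : nat -> {pred R}) (hR : standard_graded G)
    (d : nat) (hd : (2 <= d)%N) (hdim : krull_dim K R = d%:R%:E)
    (I : submodClosed R^o) (hI : homogeneous_ideal G I)
    (hcolength : (module_length K (quotmod I) < +oo)%E)
    (M : lmodType R) (H : nat -> {pred M}) (hM : graded_module G H)
    (hfg : finitely_generated (predT : {pred M})) :
  forall x : K,
    HKd p d I H x =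
    \sum_(P \in top_dim_minimal_primes K R)
      HKd_quotient G p d I P x *
        fine (@module_length K (local_ring P) (localization P M)).
Proof.
move=> x; have chR : p \in [pchar R] by rewrite (fmorph_pchar (in_alg R)).
have p1 : (1 < p)%N := prime_gt1 (pcharf_prime chR).
(* For negative x all degrees involved are negative, and both sides vanish. *)
case: (ltP x 0) => x0.
  have HKd0 (V : lmodType R) (H' : nat -> {pred V}) : HKd p d I H' x = 0.
    rewrite /HKd; apply: cvg_lim => //.
    rewrite (_ : (fun n => _) = fun=> 0); first exact: cvg_cst.
    apply/funext => n.
    have : Num.floor (x * (p ^ n)%:R) < 0.
      by rewrite floor_lt0 pmulr_llt0 // ltr0n expn_gt0 ltnW.
    by case: (Num.floor _) => // m _; rewrite HK_length_neg mulr0.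
  rewrite HKd0 fsbig1 // => P _; rewrite /HKd_quotient HKd0 mul0r //.
case: d hd hdim => [|[|e]] // _ hdim.
have [fs [hfs Ifs]] := homogeneous_generators hR hI.
have [sR psR] : exists sR, pfilt hR (@zerofam R^o) (piece G) sR.
  apply: pfilt_gideal; split; first exact: gfam_zerofam.
  by move=> m _ ->; apply: gfam0 (gfam_piece hR).
have [s ps] := finitely_generated_pfilt hR hM hfg.
rewrite (HKd_sum chR hperfect hdim hfs Ifs psR x0 hM ps).
(* A finite list containing all top-dimensional minimal primes, through [sR], and all primes of the
   filtration of M. Its other members have density 0, so both sides become sums over r. *)
pose r := undup [seq y.1 | y <- sR ++ s].
have rP P : P \in r -> hprime hR P.
  rewrite mem_undup => /mapP[y]; rewrite mem_cat => /orP[ys|ys] ->.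
    exact: pfilt_hprime psR ys.
  exact: pfilt_hprime ps ys.
have dens0 P : P \in r -> ~ top_dim_minimal_primes K R P -> prime_density G p e fs x P = 0.
  move=> Pr nP; apply: (prime_density_small chR fs x0 (rP P Pr)) => bP.
  exact: nP (set_mem (big_top_dim hdim bP)).
rewrite (fsbig_fwiden r); first last.
- move=> P [Pr nP]; rewrite /preimage /=.
  by rewrite (HKd_quotient_density e chR hfs Ifs x0 (rP P Pr)) dens0 // mul0r.
- exact: undup_uniq.
- move=> P [mP _] /=; have [y ys <-] := minimal_prime_filtration psR mP.
  by rewrite /r mem_undup map_f // mem_cat ys.
rewrite (sum_count_fst _ (undup_uniq [seq y.1 | y <- sR ++ s])); last first.
  by move=> P; rewrite mem_undup map_cat mem_cat => ->; rewrite orbT.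
rewrite big_seq [RHS]big_seq; apply: eq_bigr => P Pr.
rewrite (HKd_quotient_density e chR hfs Ifs x0 (rP P Pr)).
(* The multiplicity of P in s is identified with a local length for minimal P; in the other case the
   density vanishes. *)
have [[mP _]|nP] := pselect (top_dim_minimal_primes K R P).
  by rewrite (local_length_count hM K ps mP).
by rewrite dens0 // !mul0r.
Qed.
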